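(* Let $k>0$, let $\alpha,\mu,\omega,\gamma\in\mathbb{C}$ with $\operatorname{Re}(\alpha)>0$, $\operatorname{Re}(\mu)>0$, and let $m=[\operatorname{Re}(\mu)/k]+1$. Let $f\in AC^{m}[0,b]$ for every $b>0$ be such that the Sumudu transforms of $f$ and of the regularized $k$-Prabhakar derivative ${}_{k}^{C}D_{\alpha,\mu,\omega}^{\gamma}f$ exist, and let $F(u)=\mathcal{S}[f](u)$. Then, for $u>0$ with $\left|\omega k\left(\frac uk\right)^{\alpha/k}\right|<1$, $$\mathcal{S}\big({}_{k}^{C}D_{\alpha,\mu,\omega}^{\gamma}f(t)\big)(u)=\Big(\frac{u}{k}\Big)^{-\frac{\mu}{k}}\Big(1-\omega k\Big(\frac{u}{k}\Big)^{\frac{\alpha}{k}}\Big)^{\frac{\gamma}{k}}F(u)-\sum_{n=0}^{m-1}k^{n}\Big(\frac{u}{k}\Big)^{\frac{nk-\mu}{k}}\Big(1-\omega k\Big(\frac{u}{k}\Big)^{\frac{\alpha}{k}}\Big)^{\frac{\gamma}{k}}f^{(n)}(0).$$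
   Context: The Sumudu transform is $\mathcal{S}[f](u)=\int_0^\infty\frac1u e^{-t/u}f(t)\,dt$, considered for functions $f$ in the set $A$ of functions for which there are $M,\tau_1,\tau_2>0$ with $|f(t)|\le Me^{|t|/\tau_j}$ for $t\in(-1)^j\times[0,\infty)$, and $u\in(-\tau_1,\tau_2)$; here $u>0$. Complex powers are principal branches; $[\cdot]$ in the definition of $m$ is the integer part. $AC^{n}[a,b]$ is the set of $f:[a,b]\to\mathbb{R}$ with $\frac{d^{n-1}}{dt^{n-1}}f$ absolutely continuous on $[a,b]$. The $k$-gamma function is $\Gamma_k(z)=\int_0^\infty e^{-t^k/k}t^{z-1}\,dt$ for $\operatorname{Re}z>0$, and the $k$-Pochhammer symbol is $(\gamma)_{n,k}=\gamma(\gamma+k)\cdots(\gamma+(n-1)k)$, $(\gamma)_{0,k}=1$. The $k$-Mittag-Leffler function is $E_{k,\alpha,\mu}^{\gamma}(z)=\sum_{n=0}^\infty \frac{(\gamma)_{n,k}}{\Gamma_k(\alpha n+\mu)}\frac{z^n}{n!}$. The $k$-Prabhakar integral (for $\operatorname{Re}\alpha,\operatorname{Re}\mu>0$) is $$\big({}_{k}P_{\alpha,\mu,\omega}^{\gamma}f\big)(x)=\int_0^x\frac{(x-t)^{\frac{\mu}{k}-1}}{k}E_{k,\alpha,\mu}^{\gamma}\big[\omega(x-t)^{\frac{\alpha}{k}}\big]f(t)\,dt .$$ The regularized $k$-Prabhakar fractional derivative of order $\mu$, with $m=[\operatorname{Re}(\mu)/k]+1$, is $${}_{k}^{C}D_{\alpha,\mu,\omega}^{\gamma}f(t)=k^{m}\,{}_{k}P_{\alpha,mk-\mu,\omega}^{-\gamma}\Big(\frac{d}{dt}\Big)^{m}f(t).$$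 *)

(* Defs.v *)
From HB Require Import structures.
From mathcomp Require Import all_boot all_order all_algebra.
From mathcomp Require Import all_classical all_reals all_analysis.
From mathcomp Require Import measurable_realfun complex.

Set Implicit Arguments.
Unset Strict Implicit.
Unset Printing Implicit Defensive.

Import Order.TTheory GRing.Theory Num.Theory.
Import numFieldNormedType.Exports.

Local Open Scope classical_set_scope.
Local Open Scope ring_scope.
Local Open Scope complex_scope.

Section complex_functions.
Context {R : realType}.
Implicit Types z w : R[i].

Definition cexp z : R[i] :=
  (expR (complex.Re z))%:C * (cos (complex.Im z) +i* sin (complex.Im z)).

(* Principal argument, with values in ]-pi, pi] for z != 0. *)
Definition carg z : R :=
  if 0 <= complex.Im z then acos (complex.Re z / complex.Re `|z|)
  else - acos (complex.Re z / complex.Re `|z|).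

Definition clog z : R[i] := ln (complex.Re `|z|) +i* carg z.

(* Principal power; the convention at z = 0 is that of powR. *)
Definition cpow z w : R[i] :=
  if z == 0 then (w == 0)%:R else cexp (w * clog z).

Definition cintegrable (D : set R) (f : R -> R[i]) : Prop :=
  lebesgue_measure.-integrable D (fun t => (complex.Re (f t))%:E) /\
  lebesgue_measure.-integrable D (fun t => (complex.Im (f t))%:E).

Definition cintegral (D : set R) (f : R -> R[i]) : R[i] :=
  (\int[lebesgue_measure]_(t in D) complex.Re (f t)) +i*
  (\int[lebesgue_measure]_(t in D) complex.Im (f t)).

End complex_functions.

Section derivatives_within.
Context {R : realType}.
Implicit Types (D : set R) (f : R -> R).

Definition diff_quotient f (t x : R) : R := (f x - f t) / (x - t).

(* Derivative of f as a function on D, hence one-sided at an endpoint of an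
   interval D; the values of f outside D are irrelevant. *)
Definition derivable_within D f t : Prop :=
  cvg (diff_quotient f t x @[x --> within D t^']).

Definition derive_within D f t : R :=
  lim (diff_quotient f t x @[x --> within D t^']).

Definition deriven_within D n f : R -> R := iter n (derive_within D) f.

Definition abs_continuous (a b : R) f : Prop :=
  forall e : R, 0 < e -> exists2 d : R, 0 < d &
    forall (n : nat) (l r : 'I_n -> R),
      (forall i, a <= l i /\ l i <= r i /\ r i <= b) ->
      trivIset setT (fun i => `]l i, r i[%classic) ->
      \sum_(i < n) (r i - l i) < d ->
      \sum_(i < n) `|f (r i) - f (l i)| < e.

(* AC^n[a,b], for n > 0. *)
Definition ACn (n : nat) (a b : R) f : Prop :=
  (forall j, (j.+1 < n)%N -> forall t, t \in `[a, b] ->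
     derivable_within `[a, b] (deriven_within `[a, b] j f) t) /\
  abs_continuous a b (deriven_within `[a, b] n.-1 f).

End derivatives_within.

Section k_prabhakar.
Context {R : realType}.
Implicit Types (k : R) (alpha mu omega gamma z : R[i]).

Definition kGamma k z : R[i] :=
  cintegral `[0, +oo[
    (fun t => (expR (- (t `^ k / k)))%:C * cpow t%:C (z - 1)).

Definition kPochhammer k gamma (n : nat) : R[i] :=
  \prod_(i < n) (gamma + i%:R * k%:C).

Definition kMittagLeffler k alpha mu gamma z : R[i] :=
  limn (series (fun n : nat =>
    kPochhammer k gamma n / kGamma k (alpha * n%:R + mu)
      * (z ^+ n / (n`!)%:R) : R[i]^o)).

Definition kPrabhakar k alpha mu omega gamma (f : R -> R[i]) (x : R) : R[i] :=
  cintegral `[0, x]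
    (fun t => cpow (x - t)%:C (mu / k%:C - 1) / k%:C
      * kMittagLeffler k alpha mu gamma
          (omega * cpow (x - t)%:C (alpha / k%:C))
      * f t).

Definition kPrabhakar_order k mu : nat := (Num.truncn (complex.Re mu / k)).+1.

Definition reg_kPrabhakar_derivative k alpha mu omega gamma (f : R -> R)
    (t : R) : R[i] :=
  let m := kPrabhakar_order k mu in
  (k ^+ m)%:C
    * kPrabhakar k alpha (m%:R * k%:C - mu) omega (- gamma)
        (fun s => (deriven_within `[0, +oo[ m f s)%:C) t.

End k_prabhakar.

Section sumudu_transform.
Context {R : realType}.
Implicit Types (f : R -> R[i]) (u : R).

Definition sumudu_integrand f u (t : R) : R[i] :=
  (u^-1 * expR (- (t / u)))%:C * f t.

Definition sumudu f u : R[i] := cintegral `[0, +oo[ (sumudu_integrand f u).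

Definition sumudu_exists f u : Prop :=
  cintegrable `[0, +oo[ (sumudu_integrand f u).

End sumudu_transform.

(* In particular the transform exists at u for every u in ]0, tau[ when f is
   measurable and of exponential type at most 1/tau on [0, +oo[. *)
Lemma sumudu_exists_exponential_order (R : realType) (f : R -> R[i])
    (M tau u : R) :
  measurable_fun (`[0, +oo[ : set R) (fun t => complex.Re (f t)) ->
  measurable_fun (`[0, +oo[ : set R) (fun t => complex.Im (f t)) ->
  (forall t, 0 <= t -> complex.Re `|f t| <= M * expR (t / tau)) ->
  0 < u -> u < tau -> sumudu_exists f u.
Proof.
move=> mRe mIm fM u0 utau.
have tau0 : 0 < tau := lt_trans u0 utau.
pose r : R := u^-1 - tau^-1.
have r0 : 0 < r by rewrite subr_gt0 ltf_pV2.
have C0 : 0 <= u^-1 * M.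
  apply: mulr_ge0; first by rewrite invr_ge0 ltW.
  have := fM 0 (lexx _); rewrite mul0r expR0 mulr1; apply: le_trans.
  by rewrite normc_def /= sqrtr_ge0.
have mexp : measurable_fun (`[0, +oo[ : set R) (fun t : R => u^-1 * expR (- (t / u))).
  apply: measurable_funM => //; apply: measurable_funTS.
  apply: (@measurableT_comp _ _ _ R R R expR) => //.
  by apply: measurableT_comp => //; exact: measurable_funM.
have main (g : R[i] -> R) : (forall z, `|g z| <= complex.Re `|z|) ->
    (forall t, g (sumudu_integrand f u t) = u^-1 * expR (- (t / u)) * g (f t)) ->
    measurable_fun (`[0, +oo[ : set R) (fun t => g (f t)) ->
    lebesgue_measure.-integrable `[0, +oo[
      (fun t => (g (sumudu_integrand f u t))%:E).
  move=> gle gE mg.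
  apply: (@le_integrable _ _ _ lebesgue_measure _ _ _
    (fun t => ((u^-1 * M / r) * exponential_pdf r t)%:E)) => //.
  - apply/measurable_EFinP; rewrite (_ : (fun t => g _) =
      (fun t => u^-1 * expR (- (t / u)) * g (f t))); last exact/funext.
    exact: measurable_funM.
  - move=> t; rewrite /= in_itv /= andbT => t0; rewrite lee_fin gE.
    rewrite exponential_pdfE // normrM (@ger0_norm _ (u^-1 * _)); last first.
      by rewrite mulr_ge0 ?expR_ge0 // invr_ge0 ltW.
    rewrite mulrA divfK ?gt_eqF // [leRHS]ger0_norm; last first.
      by rewrite mulr_ge0 ?expR_ge0.
    rewrite -[leLHS]mulrA -[leRHS]mulrA ler_wpM2l ?invr_ge0 ?(ltW u0) //.
    apply: (@le_trans _ _ (expR (- (t / u)) * (M * expR (t / tau)))).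
      by rewrite ler_wpM2l ?expR_ge0 // (le_trans (gle _)) ?fM.
    rewrite mulrCA -expRD le_eqVlt; apply/orP; left; apply/eqP.
    by congr (_ * expR _); rewrite /r mulNr mulrBl opprB addrC (mulrC t) (mulrC t).
  - apply: (@integrableZl _ _ _ lebesgue_measure _ _ (u^-1 * M / r)
      (EFin \o exponential_pdf r)) => //.
    exact: (integrableS measurableT _ _ (integrable_exponential_pdf r0)).
split; apply: main => //.
- by move=> [a b]; have := normc_ge_Re (a +i* b); rewrite normc_def /= lecR.
- by move=> t; rewrite /sumudu_integrand; case: (f t) => a b /=; rewrite mul0r subr0.
- move=> [a b]; rewrite normc_def /= -sqrtr_sqr.
  by apply: ler_wsqrtr; rewrite lerDr sqr_ge0.
- by move=> t; rewrite /sumudu_integrand; case: (f t) => a b /=; rewrite mul0r addr0.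
Qed.

(* Main.v *)
Require Import Defs.
From HB Require Import structures.
From mathcomp Require Import all_boot all_order all_algebra.
From mathcomp Require Import all_classical all_reals all_analysis.
From mathcomp Require Import measurable_realfun complex.
From mathcomp Require Import ring lra.

(** Write [A = alpha / k], [B = (m k - mu) / k] and [s = 1 / u]. The k-Gamma
    function is a power of [k] times the Gamma function, so the kernel of the
    k-Prabhakar integral of order [m k - mu] is the series
<<
      K(t) = sum_n beta_n t^(z_n - 1) / Gamma(z_n),     z_n = A n + B,
>>
    with [beta_n] a binomial coefficient times [(k omega)^n k^(- z_n)], and the
    regularized derivative is [D = k^m K * f^(m)] (convolution on the half-line).
    Integrating termwise, [K] has the Laplace transform
    [Phi(s) = sum_n beta_n s^(- z_n)], which the binomial series sums to
    [v^B (1 - omega k v^A)^(gamma / k)] with [v = 1 / (k s) = u / k]. The product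
    rule for Laplace transforms would then give the theorem, the Sumudu transform
    at [u] being [s] times the Laplace transform at [s]. Two points need more care.

    First, the transform of [f^(m)] need not exist, and for complex [alpha] the
    condition [|omega k v^A| < 1] makes [Phi] converge at [s] while the Laplace
    integral of [K] at [s] may diverge. The first defect is removed by
    integrating [m] times: primitives commute with convolution ([prim_conv]), so
    the [m]-fold primitive of [K * f^(m)] is [K * q] with [q] equal to [f] minus
    its Taylor polynomial of degree [m - 1] at 0, and both have transforms at [s].
    For the second, [laplace_continuation] shows that
    [L(K * q) = Phi . L(q)] holds for large [s], where the transform of [K]
    converges absolutely, and that the two sides are power series around each
    point of the half-line to the right of [s]; the identity theorem carries the
    equality down to [s] in finitely many steps, a step multiplying the abscissa
    by a constant. Absolute convergence for large [s] rests on the bound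
    [Gamma(Re z_n) <= D C^n |Gamma(z_n)|] ([gamma_ratio]): by the Beta integral
    the ratio [|Gamma(z)| / Gamma(Re z)] is supermultiplicative.

    Secondly, [f^(m)] exists only almost everywhere. An absolutely continuous
    function is the difference of two nondecreasing ones, its variation and the
    rest, which are again absolutely continuous; their Lebesgue-Stieltjes measures
    are dominated by Lebesgue measure, so the Radon-Nikodym theorem provides a
    density ([abs_continuous_density]), and Lebesgue differentiation identifies
    it with the derivative ([half_line_density]). With this, [ACn_taylor] is
    Taylor's formula with integral remainder.

    Series are treated as integrals over the counting measure, so that one
    complex Fubini theorem serves double integrals, double series and termwise
    integration. *)

Set Implicit Arguments.
Unset Strict Implicit.
Unset Printing Implicit Defensive.

Import Order.TTheory GRing.Theory Num.Theory.
Import numFieldNormedType.Exports.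

Local Open Scope classical_set_scope.
Local Open Scope ring_scope.
Local Open Scope complex_scope.

Local Notation normc := ComplexField.Normc.normc.
Local Notation cnormM := ComplexField.Normc.normcM.
Local Notation Re := complex.Re.
Local Notation Im := complex.Im.

(** * Integrals of complex-valued functions *)

Section modulus.
Context {R : realType}.
Implicit Types z w : R[i].

Lemma normcE z : normc z = Re `|z|. Proof. by []. Qed.

Lemma normc_ge0 z : 0 <= normc z.
Proof. by case: z => a b; exact: sqrtr_ge0. Qed.

Lemma cReD z w : Re (z + w) = Re z + Re w.
Proof. by case: z w => a b [c d]. Qed.
Lemma cImD z w : Im (z + w) = Im z + Im w.
Proof. by case: z w => a b [c d]. Qed.
Lemma cReN z : Re (- z) = - Re z.
Proof. by case: z. Qed.
Lemma cImN z : Im (- z) = - Im z.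
Proof. by case: z. Qed.
Lemma cReM z w : Re (z * w) =
  Re z * Re w - Im z * Im w.
Proof. by case: z w => a b [c d]. Qed.
Lemma cImM z w : Im (z * w) =
  Re z * Im w + Im z * Re w.
Proof. by case: z w => a b [c d]. Qed.
Lemma complex_eq z w : Re z = Re w ->
  Im z = Im w -> z = w.
Proof. by case: z w => a b [c d] /= -> ->. Qed.

Lemma normr_Re_le z : `|Re z| <= normc z.
Proof.
case: z => a b; rewrite /= -sqrtr_sqr.
by apply: ler_wsqrtr; rewrite lerDl sqr_ge0.
Qed.

Lemma normr_Im_le z : `|Im z| <= normc z.
Proof.
case: z => a b; rewrite /= -sqrtr_sqr.
by apply: ler_wsqrtr; rewrite lerDr sqr_ge0.
Qed.

Lemma Re_le_normc z : Re z <= normc z.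
Proof. exact: le_trans (ler_norm _) (normr_Re_le z). Qed.

Lemma normcR (x : R) : normc x%:C = `|x|.
Proof. by rewrite /= expr0n /= addr0 sqrtr_sqr. Qed.

Lemma normcRM (x : R) z : normc (x%:C * z) = `|x| * normc z.
Proof. by rewrite cnormM normcR. Qed.

Lemma normc_0 : normc (0 : R[i]) = 0. Proof. by rewrite -[0]/(0%:C) normcR normr0. Qed.
Lemma normc_1 : normc (1 : R[i]) = 1. Proof. by rewrite -[1]/(1%:C) normcR normr1. Qed.

Lemma normcX z n : normc (z ^+ n) = normc z ^+ n.
Proof.
by elim: n => [|n IH]; rewrite ?normc_1 // !exprS cnormM IH.
Qed.

Lemma normc_natr n : normc (n%:R : R[i]) = n%:R.
Proof. by rewrite -(rmorph_nat (real_complex R)) normcR ger0_norm. Qed.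

Lemma normc_le_ReIm z : normc z <= `|Re z| + `|Im z|.
Proof.
rewrite -[leRHS]ger0_norm ?addr_ge0 // -sqrtr_sqr.
case: z => a b /=; apply: ler_wsqrtr.
rewrite sqrrD !real_normK ?num_real // -addrA lerD2l lerDr.
by rewrite mulrn_wge0 // mulr_ge0.
Qed.

Lemma normc_Conj z : z * z^*%C = (normc z ^+ 2)%:C.
Proof.
case: z => a b; rewrite /= sqr_sqrtr ?addr_ge0 ?sqr_ge0 //.
by apply: complex_eq; rewrite /= ?mulrN ?opprK ?expr2 // mulrC addrC subrr.
Qed.

Lemma normcJ z : normc z^*%C = normc z.
Proof. by case: z => a b; rewrite /= sqrrN. Qed.

Lemma normc_div z w : normc (z / w) = normc z / normc w.
Proof. by rewrite cnormM ComplexField.Normc.normcV. Qed.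

Lemma normc_eq0 z : (normc z == 0) = (z == 0).
Proof.
apply/eqP/eqP => [/ComplexField.Normc.eq0_normc //|->]; exact: normc_0.
Qed.

Lemma normc_gt0 z : (0 < normc z) = (z != 0).
Proof. by rewrite lt_def normc_ge0 andbT normc_eq0. Qed.

End modulus.

Arguments ComplexField.Normc.normc : simpl never.

Section complex_integral.
Context d (T : measurableType d) (R : realType).
Implicit Types (f g : T -> R[i]).

Definition cmeas f := measurable_fun setT (fun x => Re (f x)) /\
  measurable_fun setT (fun x => Im (f x)).

Lemma cmeas_cst (c : R[i]) : cmeas (fun _ => c).
Proof. by split; exact: measurable_cst. Qed.

Lemma cmeas_real (h : T -> R) : measurable_fun setT h -> cmeas (fun x => (h x)%:C).
Proof. by move=> mh; split => //=; exact: measurable_cst. Qed.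

Lemma cmeasD f g : cmeas f -> cmeas g -> cmeas (fun x => f x + g x).
Proof.
move=> [f1 f2] [g1 g2]; split.
  by under eq_fun do rewrite cReD; exact: measurable_funD.
by under eq_fun do rewrite cImD; exact: measurable_funD.
Qed.

Lemma cmeasM f g : cmeas f -> cmeas g -> cmeas (fun x => f x * g x).
Proof.
move=> [f1 f2] [g1 g2]; split.
  under eq_fun do rewrite cReM.
  by apply: measurable_funB; exact: measurable_funM.
under eq_fun do rewrite cImM.
by apply: measurable_funD; exact: measurable_funM.
Qed.

Lemma measurable_normc f : cmeas f -> measurable_fun setT (fun x => normc (f x)).
Proof.
move=> [f1 f2]; have -> : (fun x => normc (f x)) =
    Num.sqrt \o (fun x => Re (f x) ^+ 2 + Im (f x) ^+ 2).
  by apply/funext => x /=; case: (f x).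
apply: measurableT_comp; last by apply: measurable_funD; exact: measurable_funX.
by apply: continuous_measurable_fun; exact: sqrt_continuous.
Qed.

Lemma emeasurable_normc f : cmeas f -> measurable_fun setT (fun x => (normc (f x))%:E).
Proof. by move=> mf; apply/measurable_EFinP; exact: measurable_normc. Qed.

Lemma cmeas_if (b : T -> bool) f g : measurable_fun setT b -> cmeas f -> cmeas g ->
  cmeas (fun x => if b x then f x else g x).
Proof.
move=> mb [f1 f2] [g1 g2].
have E (h : R[i] -> R) x : h (if b x then f x else g x) =
  if b x then h (f x) else h (g x) by case: ifP.
by split; under eq_fun do rewrite E; exact: measurable_fun_ifT.
Qed.

Variable mu : {measure set T -> \bar R}.

Definition cmass f : \bar R := \int[mu]_x (normc (f x))%:E.

Definition cL1 f := cmeas f /\ (cmass f < +oo)%E.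

Definition cint f : R[i] :=
  (\int[mu]_x Re (f x)) +i* (\int[mu]_x Im (f x)).

Lemma cmass_ge0 f : (0 <= cmass f)%E.
Proof. by apply: integral_ge0 => x _; rewrite lee_fin normc_ge0. Qed.

Lemma le_cmass f g : cmeas f -> cmeas g ->
  (forall x, normc (f x) <= normc (g x)) -> (cmass f <= cmass g)%E.
Proof.
move=> mf mg fg; apply: ge0_le_integral => //.
- by move=> x _; rewrite lee_fin normc_ge0.
- exact: emeasurable_normc.
- exact: emeasurable_normc.
- by move=> x _; rewrite lee_fin.
Qed.

Lemma cL1_le f g : cmeas f -> cL1 g ->
  (forall x, normc (f x) <= normc (g x)) -> cL1 f.
Proof. by move=> mf [mg g1] fg; split => //; apply: le_lt_trans g1; exact: le_cmass. Qed.

Lemma cL1_part (p : R[i] -> R) f : (forall z, `|p z| <= normc z) ->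
  measurable_fun setT (fun x => p (f x)) -> cL1 f ->
  mu.-integrable setT (fun x => (p (f x))%:E).
Proof.
move=> pn mp [mf f1]; apply/integrableP; split; first exact/measurable_EFinP.
apply: le_lt_trans f1; apply: ge0_le_integral => //.
- by apply: measurableT_comp => //; exact/measurable_EFinP.
- exact: emeasurable_normc.
- by move=> x _ /=; rewrite lee_fin.
Qed.

Lemma cL1_Re f : cL1 f -> mu.-integrable setT (fun x => (Re (f x))%:E).
Proof. by move=> f1; apply: cL1_part (f1) => //; [exact: normr_Re_le|case: f1 => -[]]. Qed.

Lemma cL1_Im f : cL1 f -> mu.-integrable setT (fun x => (Im (f x))%:E).
Proof. by move=> f1; apply: cL1_part (f1) => //; [exact: normr_Im_le|case: f1 => -[]]. Qed.

Lemma cL1_parts f : mu.-integrable setT (fun x => (Re (f x))%:E) ->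
  mu.-integrable setT (fun x => (Im (f x))%:E) -> cL1 f.
Proof.
move=> f1 f2.
have m1 : measurable_fun setT (fun x => Re (f x)).
  by apply/measurable_EFinP; exact: measurable_int f1.
have m2 : measurable_fun setT (fun x => Im (f x)).
  by apply/measurable_EFinP; exact: measurable_int f2.
split => //; have /integrableP[_] := integrableD measurableT (integrable_abse f1)
  (integrable_abse f2).
apply: le_lt_trans; apply: ge0_le_integral => //.
- by move=> x _; rewrite lee_fin normc_ge0.
- exact: emeasurable_normc.
- apply: measurableT_comp => //; apply: emeasurable_funD.
    by apply: measurableT_comp => //; exact/measurable_EFinP.
  by apply: measurableT_comp => //; exact/measurable_EFinP.
- move=> x _ /=; rewrite lee_fin ger0_norm ?addr_ge0 //; exact: normc_le_ReIm.
Qed.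

Lemma cL1D f g : cL1 f -> cL1 g -> cL1 (fun x => f x + g x).
Proof.
move=> f1 g1; apply: cL1_parts.
  under eq_fun do rewrite cReD EFinD.
  by apply: integrableD => //; exact: cL1_Re.
under eq_fun do rewrite cImD EFinD.
by apply: integrableD => //; exact: cL1_Im.
Qed.

Lemma cL1Z (c : R[i]) f : cL1 f -> cL1 (fun x => c * f x).
Proof.
move=> f1; have [fr fi] := (cL1_Re f1, cL1_Im f1); apply: cL1_parts.
  under eq_fun do rewrite cReM EFinB !EFinM.
  by apply: integrableB => //; exact: integrableZl.
under eq_fun do rewrite cImM EFinD !EFinM.
by apply: integrableD => //; exact: integrableZl.
Qed.

Lemma cL1N f : cL1 f -> cL1 (fun x => - f x).
Proof. by move=> /(cL1Z (-1)); under eq_fun do rewrite mulN1r. Qed.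

Lemma cintD f g : cL1 f -> cL1 g -> cint (fun x => f x + g x) = cint f + cint g.
Proof.
move=> f1 g1; apply: complex_eq; rewrite ?cReD ?cImD /=.
  by under eq_Rintegral do rewrite cReD; rewrite RintegralD //; exact: cL1_Re.
by under eq_Rintegral do rewrite cImD; rewrite RintegralD //; exact: cL1_Im.
Qed.

Lemma cintZ (c : R[i]) f : cL1 f -> cint (fun x => c * f x) = c * cint f.
Proof.
move=> f1; have [fr fi] := (cL1_Re f1, cL1_Im f1).
apply: complex_eq; rewrite ?cReM ?cImM /=.
  under eq_Rintegral do rewrite cReM.
  by rewrite RintegralB ?RintegralZl //;
    [rewrite /comp; under eq_fun do rewrite EFinM; exact: integrableZl..].
under eq_Rintegral do rewrite cImM.
by rewrite RintegralD ?RintegralZl //;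
    [rewrite /comp; under eq_fun do rewrite EFinM; exact: integrableZl..].
Qed.

Lemma cintN f : cL1 f -> cint (fun x => - f x) = - cint f.
Proof.
move=> f1; rewrite -mulN1r -cintZ //; congr cint.
by apply/funext => x; rewrite mulN1r.
Qed.

Lemma cintB f g : cL1 f -> cL1 g -> cint (fun x => f x - g x) = cint f - cint g.
Proof. by move=> f1 g1; rewrite cintD ?cintN //; exact: cL1N. Qed.

(** Rotating by a unimodular constant makes the integral real; then compare real
    parts. *)
Lemma normc_cint f : cL1 f -> ((normc (cint f))%:E <= cmass f)%E.
Proof.
move=> f1; have [I0|I0] := eqVneq (cint f) 0.
  by rewrite I0 normc_0 cmass_ge0.
have nI : normc (cint f) != 0 by rewrite normc_eq0.
pose c : R[i] := (cint f)^*%C * ((normc (cint f))^-1)%:C.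
have cI : c * cint f = (normc (cint f))%:C.
  rewrite /c mulrAC mulrC (mulrC (_ ^*%C)) normc_Conj -rmorphM /=.
  by rewrite expr2 mulKf.
have nc : normc c = 1.
  by rewrite /c mulrC normcRM normcJ ger0_norm ?mulVf // invr_ge0 normc_ge0.
have h1 := cL1Z c f1.
have -> : (normc (cint f))%:E = (\int[mu]_x (Re (c * f x))%:E)%E.
  rewrite -[normc _]/(Re (normc (cint f))%:C) -cI -cintZ //= fineK //.
  by apply: integrable_fin_num => //; exact: cL1_Re.
apply: (@le_trans _ _ (\int[mu]_x `|(Re (c * f x))%:E|)%E).
  apply: le_integral => //; first exact: cL1_Re h1.
    exact: (integrable_abse (cL1_Re h1)).
  by move=> x _; rewrite lee_fin /= ler_norm.
apply: ge0_le_integral => //.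
- by apply: measurableT_comp => //; exact: measurable_int (cL1_Re h1).
- exact: (emeasurable_normc f1.1).
- move=> x _; rewrite /= lee_fin; apply: (le_trans (normr_Re_le _)).
    by rewrite cnormM nc mul1r.
Qed.

End complex_integral.

Section complex_fubini.
Context d1 d2 (T1 : measurableType d1) (T2 : measurableType d2) (R : realType).
Variable m1 : {sigma_finite_measure set T1 -> \bar R}.
Variable m2 : {sigma_finite_measure set T2 -> \bar R}.

(* The inner integrals are finite only almost everywhere, and [fine] hides the
   exceptional values. *)
Let real_fubini (g : T1 * T2 -> R) :
  (m1 \x m2)%E.-integrable setT (fun p => (g p)%:E) ->
  m1.-integrable setT (fun x => (\int[m2]_y g (x, y))%:E) /\
  \int[m1]_x \int[m2]_y g (x, y) = \int[m2]_y \int[m1]_x g (x, y).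
Proof.
move=> ig.
have iF := integrable_fubini_F ig.
have iG : m2.-integrable setT (fubini_G m1 (fun p => (g p)%:E)).
  have mg := measurable_int _ ig.
  apply: (@integrable_fubini_F _ _ _ _ _ m2 m1 (fun p => (g (p.2, p.1))%:E)).
  apply/integrable12ltyP; last exact: ((integrable21ltyP m1 m2 mg).1 ig).
  apply: (measurableT_comp mg (g := fun p => (p.2, p.1))).
  by apply: measurable_fun_pair; [exact: measurable_snd|exact: measurable_fst].
have finm d (T : measurableType d) (m : {measure set T -> \bar R})
    (F : T -> \bar R) : m.-integrable setT F ->
    ae_eq m setT (fun x => (fine (F x))%:E) F.
  move=> /integrable_ae => /(_ measurableT); apply: filterS => x + _.
  by move=> /(_ Logic.I)/fineK.
have mfin d (T : measurableType d) (m : {measure set T -> \bar R})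
    (F : T -> \bar R) : m.-integrable setT F ->
    measurable_fun setT (fun x => (fine (F x))%:E).
  move=> iF'; have mF := measurable_int _ iF'; apply/measurable_EFinP.
  by apply: measurableT_comp => //; exact: fine_measurable.
split.
  apply: le_integrable (iF) => //; first exact: mfin iF.
  move=> x _; rewrite -/(fubini_F m2 (fun p => (g p)%:E) x).
  by rewrite /Rintegral -/(fubini_F m2 (fun p => (g p)%:E) x); case: (fubini_F _ _ _) => [r||] //=; rewrite normr0 leey.
rewrite /Rintegral; congr fine.
transitivity (\int[m1]_x fubini_F m2 (fun p => (g p)%:E) x)%E.
  apply: ae_eq_integral => //; [exact: mfin iF|exact: measurable_int _ iF|exact: finm].
rewrite (Fubini ig); apply: ae_eq_integral => //.
- exact: measurable_int _ iG.
- exact: mfin iG.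
- by apply: ae_eq_sym; exact: finm.
Qed.

Variable f : T1 * T2 -> R[i].
Hypothesis mf : cmeas f.

Let mn : measurable_fun setT (fun p => (normc (f p))%:E).
Proof. exact: emeasurable_normc. Qed.

Lemma cmass_swap : (\int[m1]_x cmass m2 (fun y => f (x, y)) =
  \int[m2]_y cmass m1 (fun x => f (x, y)))%E.
Proof.
by apply: (fubini_tonelli (fun p => (normc (f p))%:E)) => // p; rewrite lee_fin normc_ge0.
Qed.

Hypothesis fin : (\int[m1]_x cmass m2 (fun y => f (x, y)) < +oo)%E.

Let fprod : cL1 (m1 \x m2)%E f.
Proof.
split => //; rewrite /cmass (fubini_tonelli1 (fun p => (normc (f p))%:E)) //.
by move=> p; rewrite lee_fin normc_ge0.
Qed.

Lemma cL1_cint : cL1 m1 (fun x => cint m2 (fun y => f (x, y))).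
Proof.
apply: cL1_parts.
  exact: (real_fubini (cL1_Re fprod)).1.
exact: (real_fubini (cL1_Im fprod)).1.
Qed.

Lemma cint_swap : cint m1 (fun x => cint m2 (fun y => f (x, y))) =
  cint m2 (fun y => cint m1 (fun x => f (x, y))).
Proof.
apply: complex_eq.
  exact: (real_fubini (cL1_Re fprod)).2.
exact: (real_fubini (cL1_Im fprod)).2.
Qed.

Lemma cL1_ae : {ae m1, forall x, cL1 m2 (fun y => f (x, y))}.
Proof.
have mx x : cmeas (fun y => f (x, y)).
  by case: mf => m3 m4; split;
    [exact: (measurableT_comp m3 (pair1_measurable x))|
     exact: (measurableT_comp m4 (pair1_measurable x))].
have := ae_integrable1 (cL1_Re fprod); have := ae_integrable1 (cL1_Im fprod).
by apply: filterS2 => x; move=> h1 h2; exact: cL1_parts.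
Qed.

End complex_fubini.

(** * Change of variables, sums and null sets *)

Section transport.
Context d1 d2 (X : measurableType d1) (Y : measurableType d2) (R : realType).
Variables (mu : {measure set X -> \bar R}) (nu : {measure set Y -> \bar R}).
Variables (phi : X -> Y) (w : X -> R).
Hypothesis w0 : forall x, 0 <= w x.

Variable f : Y -> R[i].
Hypothesis transp : forall p : R[i] -> R,
  (p = @complex.Re R \/ p = @complex.Im R) ->
  (\int[nu]_y (Num.max (p (f y)) 0)%:E =
   \int[mu]_x (w x * Num.max (p (f (phi x))) 0)%:E)%E /\
  (\int[nu]_y (Num.max (- p (f y)) 0)%:E =
   \int[mu]_x (w x * Num.max (- p (f (phi x))) 0)%:E)%E.

(** A change of variables known for nonnegative functions extends to complex
    integrands with no integrability assumption, because each side is assembled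
    from the positive and negative parts of the two components. *)
Lemma cint_transport : cint nu f = cint mu (fun x => (w x)%:C * f (phi x)).
Proof.
have key (p : R[i] -> R) : (p = @complex.Re R \/ p = @complex.Im R) ->
  \int[nu]_y p (f y) = \int[mu]_x (w x * p (f (phi x))).
  move=> pP; have [h1 h2] := transp pP.
  rewrite /Rintegral (integralE nu) (integralE mu); congr (fine (_ - _)).
    transitivity (\int[nu]_y (Num.max (p (f y)) 0)%:E)%E.
      by apply: eq_integral => y _; rewrite unlock EFin_max.
    rewrite h1; apply: eq_integral => x _.
    by rewrite unlock -EFin_max -{2}(mulr0 (w x)) maxr_pMr.
  transitivity (\int[nu]_y (Num.max (- p (f y)) 0)%:E)%E.
    by apply: eq_integral => y _; rewrite unlock EFin_max.
  rewrite h2; apply: eq_integral => x _.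
  by rewrite unlock -EFinN -EFin_max -{2}(mulr0 (w x)) -mulrN maxr_pMr.
rewrite /cint; congr (_ +i* _).
  rewrite (key (@complex.Re R)); last by left.
  by apply: eq_Rintegral => x _; rewrite cReM mul0r subr0.
rewrite (key (@complex.Im R)); last by right.
by apply: eq_Rintegral => x _; rewrite cImM mul0r addr0.
Qed.

End transport.

(* Counting measure as a factor in Fubini's theorem. *)
HB.instance Definition _ (R : realType) := @isSFinite.Build _ nat R (@counting nat R)
  (sfinite_measure_sigma_finite (sigma_finite_counting R)).

Section counting_sums.
Context {R : realType}.
Implicit Types u v : nat -> R[i].

Definition csum u : R[i] := cint (@counting nat R) u.
Definition csummable u : Prop := cL1 (@counting nat R) u.
Definition nsum u : \bar R := cmass (@counting nat R) u.

Lemma cmeas_nat u : cmeas u. Proof. by split. Qed.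

Lemma measurable_fun_prod_nat d1 d2 (T : measurableType d1) (U : measurableType d2)
    (f : T * nat -> U) :
  (forall n, measurable_fun setT (fun x => f (x, n))) -> measurable_fun setT f.
Proof.
move=> mf _ B mB; rewrite setTI.
have -> : f @^-1` B = \bigcup_n (((fun x => f (x, n)) @^-1` B) `*` [set n]).
  apply/seteqP; split => [[x n] /= Bf|[x n] [m _ /= [Bf ->]] //].
  by exists n.
apply: bigcup_measurable => n _; apply: measurableX => //.
by rewrite -[X in measurable X]setTI; exact: mf.
Qed.

Lemma cmeas_prod_nat d1 (T : measurableType d1) (f : T * nat -> R[i]) :
  (forall n, cmeas (fun x => f (x, n))) -> cmeas f.
Proof.
move=> mf; split; apply: (measurable_fun_prod_nat (f := fun p => _ (f p))) => n.
  exact: (mf n).1.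
exact: (mf n).2.
Qed.

Lemma nat_integral_recl (h : nat -> \bar R) : (forall n, 0 <= h n)%E ->
  (\int[@counting nat R]_n h n = h 0%N + \int[@counting nat R]_n h n.+1)%E.
Proof.
move=> h0; rewrite !ge0_integral_count // nneseries_recl //; congr (_ + _)%E.
rewrite -(nneseries_addn 1) //; apply: eq_eseriesr => i _.
by rewrite addn1.
Qed.

Lemma nsum_recl u : nsum u = ((normc (u 0%N))%:E + nsum (fun n => u n.+1))%E.
Proof. by apply: nat_integral_recl => n; rewrite lee_fin normc_ge0. Qed.

Lemma csummable_shift u : csummable u -> csummable (fun n => u n.+1).
Proof.
move=> [_ fin]; split; first exact: cmeas_nat.
apply: le_lt_trans fin; rewrite -/(nsum u) nsum_recl leeDr // lee_fin.
exact: normc_ge0.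
Qed.

Lemma csum0 u : (forall n, u n = 0) -> csum u = 0.
Proof.
move=> u0; apply: complex_eq; rewrite /csum /cint /=.
  by rewrite /Rintegral integral0_eq // => n _; rewrite u0.
by rewrite /Rintegral integral0_eq // => n _; rewrite u0.
Qed.

Lemma csum_shift u : u 0%N = 0 -> csum u = csum (fun n => u n.+1).
Proof.
move=> u0; rewrite /csum (@cint_transport _ _ _ _ _ (@counting nat R) (@counting nat R) S (fun=> 1)) //.
  by congr cint; apply/funext => n; rewrite mul1r.
move=> p pP; have p0 : p (u 0%N) = 0 by rewrite u0; case: pP => ->.
have g0 (z : R) : (0 <= (Num.max z 0)%:E)%E by rewrite lee_fin le_max lexx orbT.
split; rewrite nat_integral_recl // p0 ?oppr0 maxxx add0e.
  by apply: eq_integral => n _; rewrite mul1r.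
by apply: eq_integral => n _; rewrite mul1r.
Qed.

Lemma csummable_single (c : R[i]) m : csummable (fun n => if n == m then c else 0).
Proof.
elim: m => [|m IH]; split; try exact: cmeas_nat.
  rewrite -/(nsum _) nsum_recl /= [nsum _]integral0_eq ?adde0 ?ltry // => n _.
  by rewrite /= normc_0.
by rewrite -/(nsum _) nsum_recl /= normc_0 add0e; exact: IH.2.
Qed.

Lemma csum_single0 u : (forall n, u n.+1 = 0) -> csum u = u 0%N.
Proof.
move=> u0.
have key (a : nat -> R) : (forall n, a n.+1 = 0) ->
    \int[@counting nat R]_n a n = a 0%N.
  move=> a0; rewrite /Rintegral integralE.
  rewrite nat_integral_recl; last by move=> n; exact: funepos_ge0.
  rewrite [X in (_ - X)%E]nat_integral_recl; last by move=> n; exact: funeneg_ge0.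
  rewrite [X in (_ + X - _)%E]integral0_eq; last first.
    by move=> n _; rewrite unlock /= a0 maxxx.
  rewrite [X in (_ - (_ + X))%E]integral0_eq; last first.
    by move=> n _; rewrite unlock /= a0 oppr0 maxxx.
  by rewrite !adde0; have <- := congr1 (fun h => h 0%N) (funeposneg (EFin \o a)).
by apply: complex_eq; rewrite /= key // => n; rewrite u0.
Qed.

Lemma csum_recl u : csummable u -> csum u = u 0%N + csum (fun n => u n.+1).
Proof.
move=> su; pose v n := if n == 0%N then u 0%N else 0.
pose w n := if n is n'.+1 then u n else 0.
have -> : u = (fun n => v n + w n).
  by apply/funext => -[|n]; rewrite /v /w /= ?addr0 ?add0r.
have sv : csummable v by exact: csummable_single.
have sw : csummable w.
  apply: (cL1_le (cmeas_nat w) su) => -[|n] //=.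
  by rewrite normc_0 normc_ge0.
rewrite /csum cintD // -!/(csum _) csum_single0 // (csum_shift (u := w)) //=.
by rewrite addr0 /v /=; congr (_ + csum _); apply/funext => n; rewrite add0r.
Qed.

Lemma csummable_cons u : csummable (fun n => u n.+1) -> csummable u.
Proof.
move=> [_ su]; split; first exact: cmeas_nat.
by rewrite -/(nsum u) nsum_recl lte_add_pinfty ?ltry.
Qed.

Lemma csummable_drop u n : csummable u -> csummable (fun k => u (n + k)%N).
Proof.
elim: n u => [|n IH] u su //.
exact: (IH (fun k => u k.+1) (csummable_shift su)).
Qed.

Lemma csum_split u n : csummable u ->
  csum u = \sum_(k < n) u k + csum (fun k => u (n + k)%N).
Proof.
elim: n u => [|n IH] u su; first by rewrite big_ord0 add0r.
rewrite csum_recl // big_ord_recl -addrA; congr (_ + _).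
by rewrite IH //; exact: csummable_shift.
Qed.

Lemma nsum_split u n : nsum u =
  ((\sum_(k < n) normc (u k))%:E + nsum (fun k => u (n + k)%N))%E.
Proof.
elim: n u => [|n IH] u; first by rewrite big_ord0 add0e.
by rewrite nsum_recl big_ord_recl EFinD -addeA; congr (_ + _)%E; rewrite IH.
Qed.

(** Partial sums differ from the total by at most the tail of the series of
    moduli, which vanishes in the limit. *)
Lemma csum_cvg u : csummable u -> forall e : R, 0 < e -> exists N, forall n, (N <= n)%N ->
  normc (csum u - \sum_(k < n) u k) < e.
Proof.
move=> su e e0.
have fin : nsum u \is a fin_num.
  by rewrite fin_numElt su.2 (lt_le_trans _ (cmass_ge0 _ _)) ?ltNyr.
pose S n := \sum_(k < n) normc (u k).
have Sle n : S n <= fine (nsum u).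
  by rewrite -lee_fin fineK // (nsum_split u n) leeDl // cmass_ge0.
have tail n : nsum (fun k => u (n + k)%N) = (fine (nsum u) - S n)%:E.
  by rewrite EFinB fineK // (nsum_split u n) -/(S n) addeAC subee ?add0e.
have cS : S n @[n --> \oo] --> fine (nsum u).
  have -> : S = (fun n => \sum_(0 <= k < n) normc (u k)).
    by apply/funext => n; rewrite big_mkord.
  have : (fun n => (\sum_(0 <= k < n) (normc (u k))%:E)%E) @ \oo --> nsum u.
    rewrite /nsum /cmass ge0_integral_count; last first.
      by move=> k; rewrite lee_fin normc_ge0.
    by apply: is_cvg_nneseries => k _ _; rewrite lee_fin normc_ge0.
  rewrite -{1}(fineK fin); under eq_fun do rewrite sumEFin.
  exact: fine_cvg.
move/cvgrPdist_lt : cS => /(_ _ e0)[N _ HN]; exists N => n /HN /=.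
rewrite ger0_norm ?subr_ge0 // => lt; apply: le_lt_trans lt.
rewrite (csum_split n su) addrAC subrr add0r -lee_fin -tail.
exact: (normc_cint (csummable_drop n su)).
Qed.

End counting_sums.

Section null_sets.
Context d (T : measurableType d) (R : realType) (mu : {measure set T -> \bar R}).
Import HBNNSimple.

(** Only the simple functions below an integrand matter for its integral, and
    they can be cut off on a null set; hence no measurability is needed. *)
Lemma null_set_integral_eq (D N : set T) (f g : T -> \bar R) :
  measurable N -> mu N = 0%E ->
  (forall x, ~ N x -> (f \_ D) x = g x) ->
  (\int[mu]_(x in D) f x = \int[mu]_x g x)%E.
Proof.
move=> mN N0 fg.
have key (h1 h2 : T -> \bar R) : (forall x, 0 <= h2 x)%E ->
   (forall x, ~ N x -> h1 x = h2 x) ->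
   (ereal_sup [set sintegral mu h |
     h in [set h : {nnsfun T >-> R} | forall x, ((h x)%:E <= h1 x)%E]] <=
   ereal_sup [set sintegral mu h |
     h in [set h : {nnsfun T >-> R} | forall x, ((h x)%:E <= h2 x)%E]])%E.
  move=> h20 h12; apply: ge_ereal_sup => _ [h /= hh1 <-].
  have mNc : measurable (~` N) by exact: measurableC.
  apply: ereal_sup_ubound; exists (proj_nnsfun h mNc) => /=.
    move=> x; rewrite mindicE; have [xN|xN] := boolP (x \in ~` N).
      by rewrite mulr1 -h12 //; rewrite inE in xN.
    by rewrite mulr0.
  rewrite -!integralT_nnsfun; apply: ge0_ae_eq_integral => //.
  - by apply/measurable_EFinP; exact: measurable_funPT.
  - by apply/measurable_EFinP; exact: measurable_funPT.
  - by move=> x _; rewrite lee_fin; exact: fun_ge0.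
  - by move=> x _; rewrite lee_fin; exact: fun_ge0.
  exists N; split => // x /= xN; apply: contrapT => nN; apply: xN => _.
  by rewrite mindicE mem_set ?mulr1.
have pg (h : T -> \bar R) x : (0 <= h^\+ x)%E by exact: funepos_ge0.
have ng (h : T -> \bar R) x : (0 <= h^\- x)%E by exact: funeneg_ge0.
rewrite /integral patch_setT; congr (_ - _)%E; apply/eqP; rewrite eq_le; apply/andP; split;
  apply: key => // x xN; rewrite unlock /=; by rewrite ?fg // -?fg.
Qed.

End null_sets.

Section null_sets_complex.
Context {R : realType}.
Local Notation mu := (@lebesgue_measure R).

(** The derivative of order m of f is an arbitrary function on a null set, so
    this comparison must not assume that the integrand is measurable. *)
Lemma cintegral_cint (D N : set R) (f g : R -> R[i]) :
  measurable N -> mu N = 0%E ->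
  (forall x, ~ N x -> (if x \in D then f x else 0) = g x) ->
  cintegral D f = cint mu g.
Proof.
move=> mN N0 fg.
have key (p : R[i] -> R) : p 0 = 0 ->
    \int[mu]_(t in D) p (f t) = \int[mu]_t p (g t).
  move=> p0; rewrite /Rintegral; congr fine.
  apply: (@null_set_integral_eq _ _ _ mu D N (fun t => (p (f t))%:E) (fun t => (p (g t))%:E) mN N0) => x /fg <-.
  by rewrite /patch; case: ifPn => // _; rewrite p0.
by rewrite /cintegral /cint (key (@complex.Re R)) // (key (@complex.Im R)).
Qed.

Lemma cint_null (N : set R) (f g : R -> R[i]) : measurable N -> mu N = 0%E ->
  (forall x, ~ N x -> f x = g x) -> cint mu f = cint mu g.
Proof.
move=> mN N0 fg; transitivity (cintegral setT f); first by [].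
by apply: (cintegral_cint mN N0) => x xN; rewrite in_setT; exact: fg.
Qed.

Lemma cintegrable_cL1 (D : set R) (f : R -> R[i]) : measurable D ->
  cintegrable D f <-> cL1 mu (fun x => if x \in D then f x else 0).
Proof.
move=> mD.
have E (p : R[i] -> R) : p 0 = 0 -> mu.-integrable D (fun t => (p (f t))%:E) <->
    mu.-integrable setT (fun x => (p (if x \in D then f x else 0))%:E).
  move=> p0; rewrite integrable_mkcond //.
  have -> : (fun t => (p (f t))%:E) \_ D =
    (fun x => (p (if x \in D then f x else 0))%:E) => //.
  by apply/funext => x; rewrite /patch; case: ifP => // _; rewrite p0.
split => [[/E h1 /E h2]|h]; first by apply: cL1_parts; [exact: h1|exact: h2].
by split; apply/E => //; [exact: cL1_Re|exact: cL1_Im].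
Qed.

End null_sets_complex.

Section series_limit.
Context {R : realType}.

Lemma limn_series_csum (u : nat -> R[i]) : csummable u ->
  limn (series (fun n => u n : R[i]^o)) = csum u.
Proof.
move=> su; apply: cvg_lim => //; apply/cvgrPdist_lt => e e0.
have [eR e1] : Re e = Re e /\ 0 < Re e.
  by split => //; move: e0; rewrite ltcE => /andP[].
have eE : e = (Re e)%:C.
  by apply: complex_eq => //=; move: e0; rewrite ltcE => /andP[/eqP ->].
have [N HN] := csum_cvg su e1.
exists N => // n /= /HN; rewrite /series /= big_mkord.
by rewrite eE -ltcR.
Qed.

End series_limit.

Section affine.
Context {R : realType}.
Local Notation mu := (@lebesgue_measure R).
Variables (a c : R).
Hypothesis a0 : a != 0.
Let phi (x : R) := a * x + c.

Let mphi : measurable_fun setT phi.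
Proof. by apply: measurable_funD => //; exact: measurable_funM. Qed.

Let k : {nonneg R} := NngNum (normr_ge0 a).

Let nu : {measure set (measurableTypeR R) -> \bar R} :=
  @measure_function_pushforward__canonical__measure_function_Measure _ _
    (measurableTypeR R) (measurableTypeR R) R mu phi mphi.

Let affine_measure (A : set R) : measurable A ->
  mu A = mscale k nu A.
Proof.
move=> mA; apply: (@lebesgue_measure_unique _ (mscale k nu)) => //.
move=> _ [[p q] _ /= <-]; rewrite /mscale /= /pushforward /=.
have [an|ap|/eqP] := ltgtP a 0; last by rewrite (negbTE a0).
  have -> : phi @^-1` `]p, q]%classic = `[(q - c) / a, (p - c) / a[%classic.
    apply/seteqP; split => x /=; rewrite !in_itv /= /phi ler_ndivrMr // ltr_ndivlMr //.
      by move=> /andP[h1 h2]; rewrite mulrC; apply/andP; split; lra.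
    by move=> /andP[h1 h2]; move: h1 h2; rewrite mulrC => h1 h2; apply/andP; split; lra.
  rewrite !lebesgue_measure_itv /= !lte_fin ltr_ndivrMr // divfK ?lt_eqF //.
  rewrite ltrD2r; case: ifP => pq; last by rewrite mule0.
  by rewrite -!EFinB -EFinM ltr0_norm //; congr EFin; field.
have -> : phi @^-1` `]p, q]%classic = `](p - c) / a, (q - c) / a]%classic.
  apply/seteqP; split => x /=; rewrite !in_itv /= /phi ler_pdivlMr // ltr_pdivrMr //.
    by move=> /andP[h1 h2]; rewrite mulrC; apply/andP; split; lra.
  by move=> /andP[h1 h2]; move: h1 h2; rewrite mulrC => h1 h2; apply/andP; split; lra.
rewrite !lebesgue_measure_itv /= !lte_fin ltr_pdivrMr // divfK ?gt_eqF //.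
rewrite ltrD2r; case: ifP => pq; last by rewrite mule0.
by rewrite -!EFinB -EFinM gtr0_norm //; congr EFin; field.
Qed.

Lemma ge0_integral_affine (h : R -> R) : measurable_fun setT h -> (forall x, 0 <= h x) ->
  (\int[mu]_x (h x)%:E = \int[mu]_x (`|a| * h (a * x + c))%:E)%E.
Proof.
move=> mh h0; transitivity (\int[mscale k nu]_x (h x)%:E)%E.
  by apply: eq_measure_integral => A mA _; exact: affine_measure.
have mE : measurable_fun setT (fun x => (h x)%:E) by exact/measurable_EFinP.
rewrite ge0_integral_mscale //=.
have -> : (\int[nu]_x (h x)%:E = \int[mu]_x (h (phi x))%:E)%E.
  have := @ge0_integral_pushforward _ _ (measurableTypeR R)
    (measurableTypeR R) R phi mphi mu setT (EFin \o h).
  by rewrite preimage_setT; apply => // y _; rewrite lee_fin.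
transitivity (\int[mu]_x ((`|a|)%:E * (h (phi x))%:E))%E => //.
rewrite ge0_integralZl //.
- by apply: (measurableT_comp mE); exact: mphi.
- by move=> x _; rewrite /= lee_fin.
- by move=> x _; rewrite /= lee_fin.
Qed.

Lemma cint_affine (f : R -> R[i]) : cmeas f ->
  cint mu f = cint mu (fun x => (`|a|)%:C * f (a * x + c)).
Proof.
move=> [f1 f2]; apply: (@cint_transport _ _ _ _ _ mu mu phi (fun=> `|a|)) => //.
move=> p pP; have mp : measurable_fun setT (fun x => p (f x)) by case: pP => ->.
have mx0 (z : R) : 0 <= Num.max z 0 by rewrite le_max lexx orbT.
split; apply: (ge0_integral_affine (h := fun y => Num.max _ 0)) => // .
  exact: measurable_maxr.
by apply: measurable_maxr => //; exact: measurable_funN.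
Qed.

Lemma cmass_affine (f : R -> R[i]) : cmeas f ->
  cmass mu f = cmass mu (fun x => (`|a|)%:C * f (a * x + c)).
Proof.
move=> mf; rewrite /cmass (ge0_integral_affine (h := fun x => normc (f x))).
- by apply: eq_integral => x _; rewrite normcRM normr_id.
- exact: measurable_normc.
- by move=> x; exact: normc_ge0.
Qed.

End affine.

(** * Convolution and the Laplace transform *)

Section measurable_cint.
Context d1 d2 (T1 : measurableType d1) (T2 : measurableType d2) (R : realType).
Variable m2 : {sigma_finite_measure set T2 -> \bar R}.

Lemma cmeas_cint (f : T1 * T2 -> R[i]) : cmeas f ->
  cmeas (fun x => cint m2 (fun y => f (x, y))).
Proof.
have key (g : T1 * T2 -> R) : measurable_fun setT g ->
    measurable_fun setT (fun x => \int[m2]_y g (x, y)).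
  move=> mg; have mE : measurable_fun setT (EFin \o g) by exact/measurable_EFinP.
  rewrite /Rintegral; apply: (measurableT_comp (f := fine)); first exact: fine_measurable.
  have -> : (fun x => \int[m2]_y (g (x, y))%:E)%E =
     (fun x => \int[m2]_y ((EFin \o g)^\+%E (x, y)) -
               \int[m2]_y ((EFin \o g)^\-%E (x, y)))%E.
    apply/funext => x; rewrite integralE; congr (_ - _)%E;
      by apply: eq_integral => y _; rewrite unlock.
  apply: emeasurable_funB; apply: measurable_fun_fubini_tonelli_F => //.
  - exact: measurable_funepos.
  - exact: measurable_funeneg.
by move=> [f1 f2]; split; [exact: (key (fun p => Re (f p)))|
  exact: (key (fun p => Im (f p)))].
Qed.

End measurable_cint.

Section convolution.
Context {R : realType}.
Local Notation mu := (@lebesgue_measure R).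
Implicit Types (K f psi : R -> R[i]).

Definition conv K f (x : R) : R[i] := cint mu (fun t => K (x - t) * f t).

(** The running integral of a function that vanishes on the negative axis. *)
Definition prim f (x : R) : R[i] := cint mu (fun t => if t <= x then f t else 0).

Definition causal f := forall t, t <= 0 -> f t = 0.

Definition trunc f (x t : R) : R[i] := if t <= x then f t else 0.

(* The functions of interest vanish on the negative axis, hence truncating on the
   right suffices. *)
Definition locL1 f := forall x, cL1 mu (trunc f x).

Definition eweight (s t : R) : R[i] := (expR (- (s * t)))%:C.

Definition laplace f (s : R) : R[i] := cint mu (fun t => eweight s t * f t).

Definition lapL1 f (s : R) := cL1 mu (fun t => eweight s t * f t).

Lemma cmeas_comp d1 d2 (T1 : measurableType d1) (T2 : measurableType d2)
   (h : T1 -> T2) (f : T2 -> R[i]) :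
  measurable_fun setT h -> cmeas f -> cmeas (fun x => f (h x)).
Proof. by move=> mh [f1 f2]; split; [exact: (measurableT_comp f1)|exact: (measurableT_comp f2)]. Qed.

Lemma cmeas_eweight s : cmeas (eweight s).
Proof.
apply: cmeas_real; apply: (measurableT_comp (@measurable_expR R)).
by apply: measurable_funN; exact: measurable_funM.
Qed.

Lemma eweightD s r t : eweight s (r + t) = eweight s r * eweight s t.
Proof. by rewrite /eweight mulrDr opprD expRD rmorphM. Qed.

Lemma normc_eweight s t : normc (eweight s t) = expR (- (s * t)).
Proof. by rewrite normcR ger0_norm // expR_ge0. Qed.

Lemma eweight_neq0 s t : eweight s t != 0.
Proof. by rewrite -normc_eq0 normc_eweight gt_eqF // expR_gt0. Qed.

Lemma eweightN s t : eweight s t * eweight (- s) t = 1.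
Proof. by rewrite /eweight -rmorphM /= -expRD mulNr opprK addNr expR0. Qed.

Lemma lapL1_cmeas f s : lapL1 f s -> cmeas f.
Proof.
move=> [mf _].
have -> : f = (fun t => eweight (- s) t * (eweight s t * f t)).
  by apply/funext => t; rewrite mulrA (mulrC (eweight (- s) t)) eweightN mul1r.
by apply: cmeasM => //; exact: cmeas_eweight.
Qed.

Lemma ge0_nmassZ (c : R[i]) f : cmeas f ->
  (cmass mu (fun x => (c * f x)%R) = (normc c)%:E * cmass mu f)%E.
Proof.
move=> mf; rewrite /cmass -ge0_integralZl //.
- by apply: eq_integral => x _; rewrite cnormM.
- exact: emeasurable_normc.
- by move=> x _; rewrite lee_fin normc_ge0.
- by rewrite lee_fin normc_ge0.
Qed.

Section pairing.
Variables K f psi : R -> R[i].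
Hypotheses (mK : cmeas K) (mf : cmeas f) (mpsi : cmeas psi).
Hypothesis fin :
  (\int[mu]_t cmass mu (fun r => (K r * f t * psi (r + t))%R) < +oo)%E.

Let F (p : R * R) := psi p.1 * (K (p.1 - p.2) * f p.2).

Let m1 : measurable_fun setT (fst : R * R -> R). Proof. exact: measurable_fst. Qed.
Let m2 : measurable_fun setT (snd : R * R -> R). Proof. exact: measurable_snd. Qed.

Let mconv : cmeas (fun p : R * R => K (p.1 - p.2) * f p.2).
Proof.
apply: cmeasM; last exact: (cmeas_comp m2).
by apply: (cmeas_comp (h := fun p : R * R => p.1 - p.2)) => //; exact: measurable_funB.
Qed.

Let mF : cmeas F.
Proof. by apply: cmeasM => //; exact: (cmeas_comp m1). Qed.

Let slice t : cmeas (fun y => F (y, t)).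
Proof. by apply: (cmeas_comp (h := fun y => (y, t))) => //; exact: pair2_measurable. Qed.

Let shift t :
  (fun r => (`|1 : R|)%:C * F (1 * r + t, t)) = (fun r => K r * f t * psi (r + t)).
Proof.
by apply/funext => r; rewrite /F normr1 mul1r mul1r /= addrK mulrC.
Qed.

Let finF : (\int[mu]_y cmass mu (fun t => F (y, t)) < +oo)%E.
Proof.
rewrite (@cmass_swap _ _ (measurableTypeR R) (measurableTypeR R) R mu mu F mF); apply: le_lt_trans fin.
rewrite le_eqVlt; apply/orP; left; apply/eqP; apply: eq_integral => t _.
by rewrite (cmass_affine t (oner_neq0 _) (slice t)) shift.
Qed.

Let aeE : {ae mu, forall y, cint mu (fun t => F (y, t)) = psi y * conv K f y}.
Proof.
have := @cL1_ae _ _ (measurableTypeR R) (measurableTypeR R) R mu mu F mF finF; apply: filterS => y h1.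
have [p0|p0] := eqVneq (psi y) 0.
  rewrite p0 mul0r /F /=.
  under eq_fun do rewrite p0 mul0r.
  by rewrite /cint /= /Rintegral integral0.
rewrite /conv -cintZ //.
have := cL1Z (psi y)^-1 h1; rewrite /F /=.
by under eq_fun do rewrite mulKf //.
Qed.

(** The weight [psi] makes the double integral finite; where it does not vanish
    it can be divided out of the almost everywhere integrable slices. *)
Lemma cL1_slice_ae : (forall y, psi y != 0) ->
  {ae mu, forall y, cL1 mu (fun t => K (y - t) * f t)}.
Proof.
move=> p0; have [N [mN N0 NE]] := @cL1_ae _ _ (measurableTypeR R) (measurableTypeR R) R mu mu F mF finF.
exists N; split => // y h; apply: NE => h1; apply: h.
have := cL1Z (psi y)^-1 h1; rewrite /F /=.
by under eq_fun do rewrite mulKf //.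
Qed.

Lemma cL1_pairing : cL1 mu (fun y => psi y * conv K f y).
Proof.
have mc : cmeas (fun y => psi y * conv K f y).
  by apply: cmeasM => //; exact: (cmeas_cint mu mconv).
split => //; have [mg] := @cL1_cint _ _ (measurableTypeR R) (measurableTypeR R) R mu mu F mF finF; apply: le_lt_trans.
rewrite le_eqVlt; apply/orP; left; apply/eqP; apply: ge0_ae_eq_integral => //.
- exact: emeasurable_normc.
- exact: emeasurable_normc.
- by move=> x _; rewrite lee_fin normc_ge0.
- by move=> x _; rewrite lee_fin normc_ge0.
have [N [mN N0 NE]] := aeE; exists N; split => // y /= h.
by apply: NE => /= E; apply: h => _; rewrite -E.
Qed.

(** Fubini followed by the translation y = r + t: testing a convolution against
    [psi] amounts to testing the product kernel against [psi (r + t)]. The choice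
    of [psi] as an exponential gives the Laplace transform, as an indicator the
    primitive. *)
Lemma cint_pairing : cint mu (fun y => psi y * conv K f y) =
  cint mu (fun t => cint mu (fun r => K r * f t * psi (r + t))).
Proof.
have [N [mN N0 NE]] := aeE.
rewrite -(cint_null (f := fun y => cint mu (fun t => F (y, t))) mN N0); last first.
  by move=> y yN; apply: contrapT => h; apply: yN; apply: NE.
rewrite (@cint_swap _ _ (measurableTypeR R) (measurableTypeR R) R mu mu F mF finF); congr cint; apply/funext => t.
by rewrite (cint_affine t (oner_neq0 _) (slice t)) shift.
Qed.

End pairing.

Section laplace_convolution.
Variables (K f : R -> R[i]) (s : R).
Hypotheses (hK : lapL1 K s) (hf : lapL1 f s).

Let E t : (fun r => K r * f t * eweight s (r + t)) =
    (fun r => (eweight s t * f t) * (eweight s r * K r)).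
Proof. by apply/funext => r; rewrite eweightD; ring. Qed.

Let fin : (\int[mu]_t cmass mu (fun r => (K r * f t * eweight s (r + t))%R) < +oo)%E.
Proof.
have -> : (\int[mu]_t cmass mu (fun r => (K r * f t * eweight s (r + t))%R) =
  \int[mu]_t ((normc (eweight s t * f t))%:E *
    cmass mu (fun r => (eweight s r * K r)%R)))%E.
  by apply: eq_integral => t _; rewrite E ge0_nmassZ //; exact: hK.1.
have fK : cmass mu (fun r => eweight s r * K r) \is a fin_num.
  by rewrite fin_numElt hK.2 (lt_le_trans _ (cmass_ge0 _ _)) ?ltNyr.
rewrite -(fineK fK) ge0_integralZr //.
- rewrite lte_mul_pinfty ?cmass_ge0 //; last by rewrite ltry.
  rewrite ge0_fin_numE ?cmass_ge0 //; exact: hf.2.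
- by apply: emeasurable_normc; exact: hf.1.
- by move=> t _; rewrite lee_fin normc_ge0.
- by rewrite lee_fin fine_ge0 // cmass_ge0.
Qed.

(** The exponential is multiplicative, so the double integral factors. *)
Lemma laplace_conv :
  lapL1 (conv K f) s /\ laplace (conv K f) s = laplace K s * laplace f s.
Proof.
have mK := lapL1_cmeas hK; have mf := lapL1_cmeas hf.
split; first exact: (cL1_pairing mK mf (cmeas_eweight s) fin).
rewrite /laplace (cint_pairing mK mf (cmeas_eweight s) fin).
have -> : (fun t => cint mu (fun r => K r * f t * eweight s (r + t))) =
    (fun t => laplace K s * (eweight s t * f t)).
  by apply/funext => t; rewrite E cintZ // mulrC.
exact: cintZ.
Qed.

Lemma cL1_conv_ae : {ae mu, forall y, cL1 mu (fun t => K (y - t) * f t)}.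
Proof.
have mK := lapL1_cmeas hK; have mf := lapL1_cmeas hf.
exact: (cL1_slice_ae mK mf (cmeas_eweight s) fin (eweight_neq0 s)).
Qed.

End laplace_convolution.

Lemma measurable_le_cst (x : R) : measurable_fun setT (fun t : R => t <= x).
Proof. by apply: measurable_fun_ler. Qed.

Lemma cmeas_trunc f x : cmeas f -> cmeas (trunc f x).
Proof.
by move=> mf; apply: cmeas_if; [exact: measurable_le_cst|exact: mf|exact: cmeas_cst].
Qed.

(** Both sides integrate K(r) f(t) over the triangle r + t <= x. *)
Lemma prim_conv K f x : cmeas K -> cmeas f -> causal K -> causal f ->
  locL1 K -> locL1 f -> prim (conv K f) x = conv K (prim f) x.
Proof.
move=> mK mf cK cf lK lf.
pose psi (y : R) : R[i] := if y <= x then 1 else 0.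
have mpsi : cmeas psi.
  by apply: cmeas_if; [exact: measurable_le_cst|exact: cmeas_cst|exact: cmeas_cst].
pose G (p : R * R) : R[i] := K p.2 * f p.1 * psi (p.2 + p.1).
have mG : cmeas G.
  have ms : measurable_fun setT (snd : R * R -> R) by exact: measurable_snd.
  have mt : measurable_fun setT (fst : R * R -> R) by exact: measurable_fst.
  apply: cmeasM; first by apply: cmeasM; [exact: (cmeas_comp ms)|exact: (cmeas_comp mt)].
  by apply: (cmeas_comp (h := fun p : R * R => p.2 + p.1)) => //; exact: measurable_funD.
have Gle t r : normc (G (t, r)) <= normc (trunc f x t * trunc K x r).
  rewrite /G /psi /trunc /=; case: (leP (r + t) x) => rtx; last first.
    by rewrite mulr0 normc_0 normc_ge0.
  rewrite mulr1; have [r0|r0] := leP r 0; first by rewrite cK // mul0r normc_0 normc_ge0.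
  have [t0|t0] := leP t 0; first by rewrite (cf t) // mulr0 normc_0 normc_ge0.
  by rewrite !ifT ?(mulrC (K r)) //; lra.
have mslice t : cmeas (fun r => G (t, r)).
  by apply: (cmeas_comp (h := fun r => (t, r))) => //; exact: pair1_measurable.
have fin : (\int[mu]_t cmass mu (fun r => G (t, r)) < +oo)%E.
  apply: (@le_lt_trans _ _ (\int[mu]_t ((normc (trunc f x t))%:E *
       cmass mu (trunc K x)))%E).
    apply: ge0_le_integral => //.
    - by move=> t _; exact: cmass_ge0.
    - apply: (@measurable_fun_fubini_tonelli_F _ _ (measurableTypeR R)
        (measurableTypeR R) R mu (fun p => (normc (G p))%:E)) => //.
        exact: emeasurable_normc.
      by move=> p; rewrite lee_fin normc_ge0.
    - have mE := emeasurable_normc (cmeas_trunc x mf).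
      by under eq_fun do rewrite muleC; exact: measurable_funeM.
    - move=> t _; rewrite -ge0_nmassZ; last exact: cmeas_trunc.
      apply: (@le_cmass _ (measurableTypeR R)); [exact: mslice| |exact: Gle].
      by apply: cmeasM; [exact: cmeas_cst|exact: cmeas_trunc].
  have fK : cmass mu (trunc K x) \is a fin_num.
    by rewrite ge0_fin_numE ?cmass_ge0 //; exact: (lK x).2.
  rewrite ge0_integralZr ?cmass_ge0 //.
  - rewrite lte_mul_pinfty ?cmass_ge0 //; last exact: (lK x).2.
    rewrite ge0_fin_numE ?cmass_ge0 //; exact: (lf x).2.
  - by apply: emeasurable_normc; exact: cmeas_trunc.
  - by move=> t _; rewrite lee_fin normc_ge0.
have -> : prim (conv K f) x = cint mu (fun y => psi y * conv K f y).
  congr cint; apply/funext => y; rewrite /psi; case: ifP => _; by rewrite ?mul1r ?mul0r.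
rewrite (cint_pairing mK mf mpsi fin).
rewrite (@cint_swap _ _ (measurableTypeR R) (measurableTypeR R) R mu mu G mG fin).
have mpf : cmeas (prim f).
  apply: (cmeas_cint mu (f := fun p : R * R => if p.2 <= p.1 then f p.2 else 0)).
  have ms : measurable_fun setT (snd : R * R -> R) by exact: measurable_snd.
  have mt : measurable_fun setT (fst : R * R -> R) by exact: measurable_fst.
  apply: cmeas_if; [exact: measurable_fun_ler|exact: (cmeas_comp ms)|exact: cmeas_cst].
have N1 : (-1 : R) != 0 by rewrite oppr_eq0 oner_eq0.
have mc : cmeas (fun t : R => K (x - t) * prim f t).
  by apply: cmeasM => //; apply: (cmeas_comp (h := fun t : R => x - t)) => //; exact: measurable_funB.
rewrite /conv (cint_affine x N1 mc); congr cint; apply/funext => r.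
rewrite normrN1 mul1r mulN1r opprD opprK addrCA subrr addr0 /prim -cintZ; last exact: lf.
congr cint; apply/funext => t; rewrite /G /psi /= -lerBrDl addrC.
by case: ifP => _; rewrite ?mulr1 ?mulr0.
Qed.

Definition heaviside (t : R) : R[i] := if 0 <= t then 1 else 0.

Lemma conv_heaviside f : conv heaviside f = prim f.
Proof.
apply/funext => x; congr cint; apply/funext => t; rewrite /heaviside subr_ge0.
by case: ifP => _; rewrite ?mul1r ?mul0r.
Qed.

Lemma laplace_heaviside s : 0 < s ->
  lapL1 heaviside s /\ laplace heaviside s = (s^-1)%:C.
Proof.
move=> s0.
have E t : eweight s t * heaviside t = (s^-1 * exponential_pdf s t)%:C.
  rewrite /heaviside; case: ifPn => t0.
    by rewrite mulr1 exponential_pdfE // mulKf ?gt_eqF // mulNr.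
  by rewrite mulr0 /exponential_pdf patchE memNset ?mulr0 //= in_itv /= andbT; apply/negP.
have iE : mu.-integrable setT (fun t => (s^-1 * exponential_pdf s t)%:E).
  apply: (@integrableZl _ _ _ mu _ measurableT s^-1 (EFin \o exponential_pdf s)).
  exact: integrable_exponential_pdf.
split.
  by rewrite /lapL1; under eq_fun do rewrite E; apply: cL1_parts => //=; exact: integrable0.
rewrite /laplace; under eq_fun do rewrite E.
apply: complex_eq => /=; last by rewrite /Rintegral integral0.
rewrite RintegralZl //; last exact: integrable_exponential_pdf.
by rewrite /Rintegral integral_exponential_pdf //= mulr1.
Qed.

Lemma laplace_prim f s : 0 < s -> lapL1 f s ->
  lapL1 (prim f) s /\ laplace (prim f) s = (s^-1)%:C * laplace f s.
Proof.
move=> s0 hf; have [h1 h2] := laplace_heaviside s0.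
by rewrite -conv_heaviside -h2; exact: laplace_conv.
Qed.

Lemma lapL1_le f s s' : causal f -> s <= s' -> lapL1 f s -> lapL1 f s'.
Proof.
move=> cf ss' hf; apply: (cL1_le _ hf).
  by apply: cmeasM; [exact: cmeas_eweight|exact: lapL1_cmeas hf].
move=> t; rewrite !cnormM !normc_eweight.
have [t0|t0] := leP t 0; first by rewrite cf // normc_0 !mulr0.
by rewrite ler_wpM2r ?normc_ge0 // ler_expR lerN2 ler_wpM2r // ltW.
Qed.

Lemma lapL1_locL1 f s : 0 <= s -> lapL1 f s -> locL1 f.
Proof.
move=> s0 hf x; have mf := lapL1_cmeas hf.
apply: (cL1_le _ (cL1Z (expR (s * x))%:C hf)); first exact: cmeas_trunc.
move=> t; rewrite /trunc; case: ifP => tx; last by rewrite normc_0 normc_ge0.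
rewrite normcRM ger0_norm ?expR_ge0 // cnormM normc_eweight mulrA.
rewrite -expRD ler_peMl ?normc_ge0 //.
by rewrite -expR0 ler_expR subr_ge0 ler_wpM2l.
Qed.

End convolution.

(** * Complex powers of positive reals *)

Section complex_power.
Context {R : realType}.
Implicit Types (z w : R[i]) (x y t : R).

Lemma cexpD z w : cexp (z + w) = cexp z * cexp w.
Proof.
rewrite /cexp cReD cImD expRD cosD sinD.
apply: complex_eq; rewrite !(cReM, cImM) /=; ring.
Qed.

Lemma cexp0 : cexp 0 = 1 :> R[i].
Proof. by rewrite /cexp /= expR0 cos0 sin0 mul1r. Qed.

Lemma normc_cexp z : normc (cexp z) = expR (Re z).
Proof.
rewrite /cexp normcRM ger0_norm ?expR_ge0 // /ComplexField.Normc.normc.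
by rewrite cos2Dsin2 sqrtr1 mulr1.
Qed.

Lemma cexp_neq0 z : cexp z != 0.
Proof. by rewrite -normc_eq0 normc_cexp gt_eqF // expR_gt0. Qed.

Lemma cexpN z : cexp (- z) = (cexp z)^-1.
Proof.
apply: (mulfI (cexp_neq0 z)); rewrite divff ?cexp_neq0 //.
by rewrite -cexpD subrr cexp0.
Qed.

Lemma cexpMn z n : cexp (z * n%:R) = cexp z ^+ n.
Proof.
elim: n => [|n IH]; first by rewrite mulr0 cexp0.
by rewrite exprS -IH -cexpD; congr cexp; rewrite -addn1 natrD; ring.
Qed.

Lemma cexpR x : cexp x%:C = (expR x)%:C.
Proof. by rewrite /cexp /= cos0 sin0; exact: mulr1. Qed.

Lemma clogR x : 0 < x -> clog x%:C = (ln x)%:C.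
Proof.
move=> x0; rewrite /clog /carg -!normcE normcR gtr0_norm //= lexx.
by rewrite divff ?gt_eqF // acos1.
Qed.

Lemma cpowE x w : 0 < x -> cpow x%:C w = cexp (w * (ln x)%:C).
Proof.
move=> x0; rewrite /cpow ifN ?clogR //.
by apply/eqP => -[]; apply/eqP; rewrite gt_eqF.
Qed.

Lemma normc_cpow x w : 0 < x -> normc (cpow x%:C w) = x `^ Re w.
Proof.
by move=> x0; rewrite cpowE // normc_cexp cReM /= mulr0 subr0 /powR gt_eqF.
Qed.

Lemma cpow_neq0 x w : 0 < x -> cpow x%:C w != 0.
Proof. by move=> x0; rewrite cpowE // cexp_neq0. Qed.

Lemma cpowD x z w : 0 < x -> cpow x%:C (z + w) = cpow x%:C z * cpow x%:C w.
Proof. by move=> x0; rewrite !cpowE // mulrDl cexpD. Qed.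

Lemma cpowN x w : 0 < x -> cpow x%:C (- w) = (cpow x%:C w)^-1.
Proof. by move=> x0; rewrite !cpowE // mulNr cexpN. Qed.

Lemma cpowB x z w : 0 < x -> cpow x%:C (z - w) = cpow x%:C z / cpow x%:C w.
Proof. by move=> x0; rewrite cpowD // cpowN. Qed.

Lemma cpowMn x w n : 0 < x -> cpow x%:C (w * n%:R) = cpow x%:C w ^+ n.
Proof. by move=> x0; rewrite !cpowE // mulrAC cexpMn. Qed.

Lemma cpow_powR x (r : R) : 0 < x -> cpow x%:C r%:C = (x `^ r)%:C.
Proof. by move=> x0; rewrite cpowE // -rmorphM /= cexpR /powR gt_eqF. Qed.

Lemma cpow1 x : 0 < x -> cpow x%:C 1 = x%:C.
Proof. by move=> x0; rewrite (cpow_powR 1) // powRr1 // ltW. Qed.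

Lemma cpow_nat x n : 0 < x -> cpow x%:C n%:R = (x ^+ n)%:C.
Proof.
by move=> x0; rewrite -[n%:R]mul1r cpowMn // cpow1 // -rmorphXn.
Qed.

Lemma cpow_mul x y w : 0 < x -> 0 < y -> cpow (x * y)%:C w = cpow x%:C w * cpow y%:C w.
Proof.
move=> x0 y0; rewrite !cpowE ?mulr_gt0 // lnM ?posrE // rmorphD mulrDr.
by rewrite cexpD.
Qed.

Lemma cpowV x w : 0 < x -> cpow (x^-1)%:C w = cpow x%:C (- w).
Proof.
by move=> x0; rewrite !cpowE ?invr_gt0 // lnV ?posrE // rmorphN mulrN mulNr.
Qed.

Lemma cpow_powR_base x (r : R) w : 0 < x -> cpow (x `^ r)%:C w = cpow x%:C (r%:C * w).
Proof.
move=> x0; rewrite !cpowE ?powR_gt0 // ln_powR rmorphM mulrA; congr cexp.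
by rewrite (mulrC w).
Qed.

(** [jpow z] is the kernel t^(z-1) of fractional integration of order z, up to
    the factor 1/Gamma(z). *)
Definition jpow z t : R[i] := if 0 < t then cpow t%:C (z - 1) else 0.

Lemma causal_jpow z : causal (jpow z).
Proof. by move=> t t0; rewrite /jpow ifN // -leNgt. Qed.

Lemma cmeas_jpow z : cmeas (jpow z).
Proof.
have -> : jpow z = (fun t => if 0 < t then cexp ((z - 1) * (ln t)%:C) else 0).
  by apply/funext => t; rewrite /jpow; case: ifP => // t0; rewrite cpowE.
apply: cmeas_if; [exact: measurable_fun_ltr| |exact: cmeas_cst].
have ml (a : R) : measurable_fun setT (fun t : R => a * ln t).
  by apply: measurable_funM => //; exact: measurable_ln.
have ms : measurable_fun setT (@sin R).
  by apply: continuous_measurable_fun; exact: continuous_sin.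
have mc : measurable_fun setT (@cos R).
  by apply: continuous_measurable_fun; exact: continuous_cos.
have E t : cexp ((z - 1) * (ln t)%:C) = (expR (Re (z - 1) * ln t))%:C *
   ((cos (Im (z - 1) * ln t))%:C + 'i%C * (sin (Im (z - 1) * ln t))%:C).
  rewrite /cexp cReM cImM /= !mulr0 subr0 add0r; congr (_ * _).
  by apply: complex_eq; rewrite !(cReD, cImD) !(cReM, cImM) /=; ring.
under eq_fun do rewrite E; apply: cmeasM; last apply: cmeasD.
- by apply: cmeas_real; apply: (measurableT_comp (@measurable_expR R)).
- by apply: cmeas_real; exact: measurableT_comp.
- by apply: cmeasM; [exact: cmeas_cst|apply: cmeas_real; exact: measurableT_comp].
Qed.

Lemma normc_jpow z t : normc (jpow z t) = if 0 < t then t `^ (Re z - 1) else 0.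
Proof.
rewrite /jpow; case: ifP => t0; last by rewrite normc_0.
by rewrite normc_cpow // cReD cReN.
Qed.

End complex_power.

Section power_substitution.
Context {R : realType}.
Local Notation mu := (@lebesgue_measure R).
Variables (c p : R).
Hypotheses (c0 : 0 < c) (p0 : 0 < p).
Variable h : R -> R.
Hypotheses (mh : measurable_fun setT h) (h0 : forall y, 0 <= h y).
Hypotheses (ch : forall y, 0 < y -> {for y, continuous h}).
Hypothesis hneg : forall y, y <= 0 -> h y = 0.

Let F (t : R) := c * t `^ p.
Let dF (t : R) := c * (p * t `^ (p - 1)).
Let g (t : R) := if 0 < t then h (F t) * dF t else 0.

Let FD (t : R) : 0 < t -> is_derive t 1 F (dF t).
Proof.
move=> t0; have D := @is_derive1_powR R p t t0.
exact: is_deriveZ.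
Qed.

Let FdE (t : R) : 0 < t -> derive1 F t = dF t.
Proof. by move=> t0; rewrite derive1E; have D := FD t0; exact: derive_val. Qed.

Let Fcont (t : R) : 0 < t -> {for t, continuous F}.
Proof.
move=> t0; apply: differentiable_continuous; apply/derivable1_diffP.
by have D := FD t0; exact: (@ex_derive _ _ _ _ _ _ _ D).
Qed.

Let dFcont (t : R) : 0 < t -> {for t, continuous (derive1 F)}.
Proof.
move=> t0; have cdF : {for t, continuous dF}.
  apply: continuousM; first exact: cst_continuous.
  apply: continuousM; first exact: cst_continuous.
  apply: differentiable_continuous; apply/derivable1_diffP.
  by have D := @is_derive1_powR R (p - 1) t t0; exact: ex_derive.
have E : \forall x \near t, derive1 F x = dF x.
  near=> x; apply: FdE; near: x; exact: lt_nbhsr.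
rewrite /prop_for /continuous_at (FdE t0); apply: cvg_trans cdF.
by apply: near_eq_cvg; near=> x; apply/esym; near: x.
Unshelve. all: by end_near. Qed.

Let Fincr (s t : R) : 0 <= s -> s < t -> F s < F t.
Proof. by move=> s0 st; rewrite /F ltr_pM2l // gt0_ltr_powR // nnegrE // ltW // (le_lt_trans s0). Qed.

Let step (a b : R) : 0 < a -> a <= b ->
  (\int[mu]_(y in `[F a, F b]) (h y)%:E = \int[mu]_(t in `[a, b]) (g t)%:E)%E.
Proof.
move=> a0 ab; have b0 := lt_le_trans a0 ab.
have pos x : x \in `[a, b] -> 0 < x by rewrite in_itv /= => /andP[ax _]; exact: lt_le_trans ax.
have poso x : x \in `]a, b[ -> 0 < x by rewrite in_itv /= => /andP[ax _]; exact: lt_trans ax.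
have F0 : 0 < F a by rewrite mulr_gt0 // powR_gt0.
rewrite (@integration_by_substitution_increasing _ F h a b ab).
- apply: eq_integral => t /[!inE] tab; congr EFin; rewrite /g.
  by rewrite (pos t tab) /= [LHS]/(h (F t) * derive1 F t) FdE //; exact: pos.
- by move=> s t /pos s0 _ st; apply: Fincr => //; exact: ltW.
- by move=> t /poso t0; exact: dFcont.
- by apply/cvg_ex; exists (derive1 F a); apply: cvg_at_right_filter; exact: dFcont.
- by apply/cvg_ex; exists (derive1 F b); apply: cvg_at_left_filter; exact: dFcont.
- split.
  + by move=> t /poso t0; have D := FD t0; exact: ex_derive.
  + by apply: cvg_at_right_filter; exact: Fcont.
  + by apply: cvg_at_left_filter; exact: Fcont.
- apply: continuous_in_subspaceT => y; rewrite inE /= in_itv /= => /andP[ay _].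
  by apply: ch; exact: lt_le_trans ay.
Qed.

(** The substitution y = c t^p is available on compact intervals of the open
    half-line, which exhaust it. *)
Lemma ge0_integral_power : (\int[mu]_y (h y)%:E = \int[mu]_t (g t)%:E)%E.
Proof.
pose A (n : nat) : set R := `[n.+1%:R^-1, n.+1%:R]%classic.
pose B (n : nat) : set R := `[F n.+1%:R^-1, F n.+1%:R]%classic.
have n0 (n : nat) : 0 < n.+1%:R^-1 :> R by rewrite invr_gt0.
have mg : measurable_fun setT g.
  apply: measurable_fun_ifT => //; first exact: measurable_fun_ltr.
  apply: measurable_funM; last by do 2 apply: measurable_funM => //.
  by apply: (measurableT_comp mh); apply: measurable_funM.
have g0 t : 0 <= g t.
  rewrite /g; case: ifP => t0 //; rewrite mulr_ge0 // mulr_ge0 ?ltW //.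
  by rewrite mulr_gt0 // powR_gt0.
have ndA : nondecreasing_seq A.
  move=> m n mn; apply/subsetPset => x; rewrite /A /B /= !in_itv /= => /andP[h1 h2].
  apply/andP; split.
    by apply: le_trans h1; rewrite lef_pV2 ?posrE // ler_nat.
  by apply: (le_trans h2); rewrite ler_nat.
have ndB : nondecreasing_seq B.
  have Fle s t : 0 <= s -> s <= t -> F s <= F t.
    by move=> s0; rewrite le_eqVlt => /predU1P[->//|/(Fincr s0)/ltW].
  move=> m n mn; apply/subsetPset => x; rewrite /A /B /= !in_itv /= => /andP[h1 h2].
  apply/andP; split.
    by apply: le_trans h1; apply: Fle; [exact: ltW|
      rewrite lef_pV2 ?posrE // ler_nat].
  by apply: (le_trans h2); apply: Fle; rewrite ?ler_nat.
have UA : \bigcup_n A n = `]0, +oo[%classic.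
  apply/seteqP; split => [x [n _]|x]; rewrite /A /B /= !in_itv /= ?andbT.
    by move=> /andP[+ _]; exact: lt_le_trans.
  move=> x0; exists (maxn (Num.truncn x) (Num.truncn x^-1)) => //.
  rewrite /A /= in_itv /=; apply/andP; split; last first.
    apply/ltW/(lt_le_trans (truncnS_gt _)); rewrite ler_nat ltnS leq_maxl //.
  rewrite -[leRHS]invrK lef_pV2 ?posrE ?invr_gt0 //.
  by apply/ltW/(lt_le_trans (truncnS_gt _)); rewrite ler_nat ltnS leq_maxr.
have UB : \bigcup_n B n = `]0, +oo[%classic.
  apply/seteqP; split => [x [n _]|x]; rewrite /A /B /= !in_itv /= ?andbT.
    by move=> /andP[+ _]; apply: lt_le_trans; rewrite mulr_gt0 // powR_gt0.
  move=> x0; pose y := (x / c) `^ p^-1.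
  have xc : 0 < x / c by rewrite divr_gt0.
  have y0 : 0 < y by rewrite powR_gt0.
  have Fy : F y = x.
    by rewrite /F /y -powRrM mulVf ?gt_eqF // powRr1 ?ltW // mulrC divfK // gt_eqF.
  have : (\bigcup_n A n) y by rewrite UA /= in_itv /= y0.
  move=> [n _]; rewrite /A /= in_itv /= => /andP[h1 h2]; exists n => //=.
  rewrite /B /= in_itv /= -Fy; apply/andP; split.
    by move: h1; rewrite le_eqVlt => /predU1P[->//|/Fincr]; rewrite ltW // => /(_ isT)/ltW.
  by move: h2; rewrite le_eqVlt => /predU1P[->//|/Fincr]; rewrite ltW // => /(_ isT)/ltW.
have ext (q : R -> R) : (forall y, y <= 0 -> q y = 0) ->
    (\int[mu]_y (q y)%:E = \int[mu]_(y in `]0%R, +oo[) (q y)%:E)%E.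
  move=> q0; rewrite [RHS]integral_mkcond; apply: eq_integral => y _.
  rewrite patchE; case: ifPn => //; rewrite notin_setE /= in_itv /= andbT.
  by move=> /negP; rewrite -leNgt => /q0 ->.
have gneg y : y <= 0 -> g y = 0 by move=> y0; rewrite /g ifN // -leNgt.
rewrite (ext h hneg) (ext g gneg) -{1}UB -UA.
have cA := @ge0_nondecreasing_set_cvg_integral _ (measurableTypeR R) R A (EFin \o g) mu ndA.
have cB := @ge0_nondecreasing_set_cvg_integral _ (measurableTypeR R) R B (EFin \o h) mu ndB.
have {}cA := cA (fun i => measurable_itv _)
  (fun i => measurable_funTS ((measurable_EFinP _ _).2 mg)).
have {}cB := cB (fun i => measurable_itv _)
  (fun i => measurable_funTS ((measurable_EFinP _ _).2 mh)).
have {}cA := cA (fun i x _ => g0 x).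
have {}cB := cB (fun i x _ => h0 x).
have E : (fun i => \int[mu]_(x in B i) (EFin \o h) x)%E =
  (fun i => \int[mu]_(x in A i) (EFin \o g) x)%E.
  apply/funext => n; apply: step => //.
  by rewrite (@le_trans _ _ 1) // ?invf_le1 ?ler1n.
by rewrite E in cB; exact: (cvg_unique _ cB cA).
Qed.

End power_substitution.

(** * The Gamma function on the right half-plane *)

Section gamma.
Context {R : realType}.
Local Notation mu := (@lebesgue_measure R).
Implicit Types (z w : R[i]) (s t x y : R).

(* The logarithm lies below its tangent line of slope s / (2x). *)
Let le1_exp_bound (s x t : R) : 0 < s -> 1 <= x -> 0 < t ->
  expR (- (s * t)) * t `^ (x - 1) <=
  expR ((x - 1) * (- 1 - ln (s / (2 * x)))) * expR (- (s / 2 * t)).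
Proof.
move=> s0 x1 t0; have x0 : 0 < x := lt_le_trans ltr01 x1.
pose d := s / (2 * x); have d0 : 0 < d by rewrite divr_gt0 // mulr_gt0.
rewrite /powR gt_eqF // -!expRD ler_expR -/d.
have ll : ln t <= d * t - 1 - ln d.
  have dt : 0 < d * t by rewrite mulr_gt0.
  have := @le_ln1Dx R (d * t - 1); rewrite addrCA subrr addr0 lnM ?posrE //.
  by move=> /(_ _); rewrite ltrBrDl subrr => /(_ dt); lra.
have h1 : (x - 1) * ln t <= (x - 1) * (d * t - 1 - ln d) by rewrite ler_wpM2l // subr_ge0.
have h2 : (x - 1) * (d * t) <= s / 2 * t.
  have -> : s / 2 * t = (x - 1) * (d * t) + d * t by rewrite /d; field; rewrite gt_eqF.
  by rewrite lerDl mulr_ge0 ?ltW.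
lra.
Qed.

Let lt1_exp_bound (s p t : R) : 0 < s -> 1 <= p -> 0 < t ->
  expR (- (s * t `^ p)) <= expR s * expR (- (s * t)).
Proof.
move=> s0 p1 t0; rewrite -expRD ler_expR.
have [t1|t1] := leP t 1.
  have := mulr_ge0 (ltW s0) (powR_ge0 t p).
  have : s * t <= s * 1 by rewrite ler_wpM2l // ltW.
  lra.
have : s * t <= s * t `^ p by rewrite ler_wpM2l ?(ltW s0) // le1r_powR // ltW.
lra.
Qed.

(** For exponents at least 1 half of the exponential absorbs the power; for
    smaller ones the substitution t = r^(1/x) removes the singularity at 0. *)
Lemma lapL1_jpow z s : 0 < s -> 0 < Re z -> lapL1 (jpow z) s.
Proof.
move=> s0; set x := Re z => x0.
have mj : cmeas (fun t => eweight s t * jpow z t).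
  by apply: cmeasM; [exact: cmeas_eweight|exact: cmeas_jpow].
have nE t : normc (eweight s t * jpow z t) =
    if 0 < t then expR (- (s * t)) * t `^ (x - 1) else 0.
  rewrite cnormM normc_eweight normc_jpow.
  by case: ifP => // _; rewrite mulr0.
have nH c r t : normc (c%:C * (eweight r t * heaviside t)) =
    if 0 <= t then `|c| * expR (- (r * t)) else 0.
  rewrite normcRM cnormM normc_eweight /heaviside.
  by case: ifP => _; rewrite ?normc_0 ?normc_1 ?mulr1 ?mulr0.
have [x1|x1] := leP 1 x.
  pose c := expR ((x - 1) * (- 1 - ln (s / (2 * x)))).
  have s2 : 0 < s / 2 by rewrite divr_gt0.
  apply: (cL1_le _ (cL1Z c%:C (laplace_heaviside s2).1)); [exact: mj|move=> t].
  rewrite nE nH; case: ifPn => t0; last by case: ifP => _ //; rewrite mulr_ge0 ?expR_ge0.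
  by rewrite (ltW t0) ger0_norm ?expR_ge0 //; exact: le1_exp_bound.
split; [exact: mj|pose p := x^-1]; have p0 : 0 < p by rewrite invr_gt0.
pose h t := if 0 < t then expR (- (s * t)) * t `^ (x - 1) else 0.
have mh : measurable_fun setT h.
  by have := measurable_normc mj; under eq_fun do rewrite nE.
have h0 t : 0 <= h t by rewrite /h; case: ifP => // _; rewrite mulr_ge0 ?expR_ge0 ?powR_ge0.
have hneg t : t <= 0 -> h t = 0 by move=> t0; rewrite /h ifN // -leNgt.
have ch y : 0 < y -> {for y, continuous h}.
  move=> y0; pose q t := expR (- (s * t)) * t `^ (x - 1).
  have cq : {for y, continuous q}.
    apply: continuousM.
      apply: continuous_comp; last exact: continuous_expR.
      by apply: continuousN; exact: mulrl_continuous.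
    apply: differentiable_continuous; apply/derivable1_diffP.
    by have D := @is_derive1_powR R (x - 1) y y0; exact: ex_derive.
  rewrite /prop_for /continuous_at {2}/h y0; apply: cvg_trans cq.
  apply: near_eq_cvg; near=> t; rewrite /h ifT //; near: t; exact: lt_nbhsr.
have -> : cmass mu (fun t => eweight s t * jpow z t) = (\int[mu]_t (h t)%:E)%E.
  by apply: eq_integral => t _; rewrite nE.
rewrite (ge0_integral_power ltr01 p0 mh h0 ch hneg).
have := (cL1Z (p * expR s)%:C (laplace_heaviside s0).1).2; apply: le_lt_trans.
have mg := (cL1Z (p * expR s)%:C (laplace_heaviside s0).1).1.
have E t : 0 < t -> h (1 * t `^ p) * (1 * (p * t `^ (p - 1))) = p * expR (- (s * t `^ p)).
  move=> t0; rewrite !mul1r /h powR_gt0 //.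
  have -> : expR (- (s * t `^ p)) * (t `^ p) `^ (x - 1) * (p * t `^ (p - 1)) =
     p * expR (- (s * t `^ p)) * ((t `^ p) `^ (x - 1) * t `^ (p - 1)) by ring.
  rewrite -powRrM -powRD; last by rewrite (gt_eqF t0) implybT.
  have -> : p * (x - 1) + (p - 1) = 0 by rewrite /p; field; rewrite gt_eqF.
  by rewrite powRr0 mulr1.
apply: ge0_le_integral => //.
- move=> t _; rewrite lee_fin; case: ifP => // t0; rewrite E //.
  by rewrite mulr_ge0 ?expR_ge0 // ltW.
- apply/measurable_EFinP; apply: measurable_fun_ifT => //; first exact: measurable_fun_ltr.
  apply: measurable_funM; last by do 2 apply: measurable_funM => //.
  by apply: (measurableT_comp mh); apply: measurable_funM.
- exact: emeasurable_normc.
- move=> t _; rewrite lee_fin nH; case: ifPn => t0; last first.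
    by case: ifP => // _; rewrite mulr_ge0 ?expR_ge0.
  rewrite E // (ltW t0) ger0_norm ?mulr_ge0 ?expR_ge0 ?(ltW p0) //.
  rewrite -mulrA ler_wpM2l ?(ltW p0) //; apply: lt1_exp_bound => //.
  by rewrite -invf_le1 // invrK // ltW.
Unshelve. all: by end_near. Qed.

Definition cGamma z : R[i] := laplace (jpow z) 1.

(** Gamma at the real part, which is also the total mass of the integrand of
    [cGamma z]. *)
Definition rGamma x : R := fine (cmass mu (fun t => eweight 1 t * jpow x%:C t)).

Lemma normc_jpowRe z t : normc (jpow z t) = normc (jpow (Re z)%:C t).
Proof. by rewrite !normc_jpow. Qed.

Lemma jpow_real x t : jpow x%:C t = (normc (jpow x%:C t))%:C.
Proof.
rewrite normc_jpow /jpow /=; case: ifP => // t0.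
by rewrite -(rmorph1 (real_complex R)) -rmorphB /= cpow_powR.
Qed.

Lemma cint_real (h : R -> R) :
  cint mu (fun t => (h t)%:C) = (\int[mu]_t h t)%:C.
Proof. by rewrite /cint /= /Rintegral integral0. Qed.

Lemma cGamma_real x : cGamma x%:C = (rGamma x)%:C.
Proof.
rewrite /cGamma /laplace.
have -> : (fun t => eweight 1 t * jpow x%:C t) =
   (fun t => (normc (eweight 1 t * jpow x%:C t))%:C).
  apply/funext => t; rewrite cnormM normc_eweight rmorphM /=.
  by rewrite -jpow_real.
by rewrite cint_real.
Qed.

Lemma cGamma1 : cGamma 1 = 1.
Proof.
rewrite /cGamma /laplace.
rewrite (cint_null (N := [set 0]) (g := fun t => eweight 1 t * heaviside t)) //.
- by rewrite -/(laplace heaviside 1) (laplace_heaviside ltr01).2 invr1.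
- exact: lebesgue_measure_set1.
move=> t /= t0; congr (_ * _); rewrite /jpow /heaviside subrr.
have [t1|t1|/esym] := ltgtP 0 t; last by move=> /t0.
  by rewrite cpowE // mul0r cexp0.
by [].
Qed.

Lemma jpowM s t z : 0 < s -> jpow z (s * t) = cpow s%:C (z - 1) * jpow z t.
Proof.
move=> s0; rewrite /jpow pmulr_rgt0 //; case: ifP => t0; last by rewrite mulr0.
by rewrite cpow_mul.
Qed.

Lemma cpowS s z : 0 < s -> s%:C * cpow s%:C (z - 1) = cpow s%:C z.
Proof. by move=> s0; rewrite cpowB // cpow1 // mulrC divfK // -(cpow1 s0) cpow_neq0. Qed.

(** By scaling; the power of s is complex while the substitution is real. *)
Lemma laplace_jpow z s : 0 < s -> 0 < Re z ->
  laplace (jpow z) s = cGamma z * cpow s%:C (- z).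
Proof.
move=> s0 z0; have hs := lapL1_jpow s0 z0; have h1 := lapL1_jpow ltr01 z0.
have sN0 : s != 0 by rewrite gt_eqF.
rewrite /cGamma {2}/laplace (cint_affine 0 sN0 h1.1).
have -> : (fun x => `|s|%:C * (eweight 1 (s * x + 0) * jpow z (s * x + 0))) =
    (fun t => cpow s%:C z * (eweight s t * jpow z t)).
  apply/funext => t; rewrite addr0 jpowM // gtr0_norm // -(cpowS z s0).
  by rewrite /eweight mul1r; ring.
by rewrite (cintZ _ hs) (cpowN _ s0) mulrAC divff ?mul1r ?cpow_neq0.
Qed.

Lemma cmass_jpow z s : 0 < s -> 0 < Re z ->
  cmass mu (fun t => eweight s t * jpow z t) =
  (rGamma (Re z) * s `^ (- Re z))%:E.
Proof.
move=> s0 z0; set x := Re z.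
have x0 : 0 < Re x%:C by [].
have -> : cmass mu (fun t => eweight s t * jpow z t) =
  cmass mu (fun t => eweight s t * jpow x%:C t).
  by apply: eq_integral => t _; rewrite !cnormM (normc_jpowRe z).
have hs := lapL1_jpow s0 x0.
have := laplace_jpow s0 x0; rewrite cGamma_real.
rewrite -rmorphN cpow_powR // -rmorphM /= /laplace.
have -> : (fun t => eweight s t * jpow x%:C t) =
   (fun t => (normc (eweight s t * jpow x%:C t))%:C).
  apply/funext => t; rewrite cnormM normc_eweight rmorphM /=.
  by rewrite -jpow_real.
rewrite cint_real => -[<-]; rewrite /Rintegral.
have -> : (fun t => (normc (eweight s t * jpow x%:C t))%:C) =
   (fun t => eweight s t * jpow x%:C t).
  apply/funext => t; rewrite cnormM normc_eweight rmorphM /=.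
  by rewrite -jpow_real.
rewrite -[RHS]/((fine (cmass mu (fun t => eweight s t * jpow x%:C t)))%:E) fineK //.
by rewrite ge0_fin_numE ?cmass_ge0 //; exact: hs.2.
Qed.

Lemma rGamma_ge0 x : 0 <= rGamma x.
Proof. by rewrite fine_ge0 // cmass_ge0. Qed.

(** Scaling turns the convolution of two powers into a multiple of a power;
    comparing Laplace transforms at 1 identifies the multiple. *)
Lemma beta_at w z y : 0 < Re w -> 0 < Re z -> 0 < y ->
  cL1 mu (fun t => jpow w (y - t) * jpow z t) ->
  cGamma w * cGamma z =
  conv (jpow w) (jpow z) y / cpow y%:C (w + z - 1) * cGamma (w + z).
Proof.
move=> w0 z0 y0 hy; set B := _ / _.
have wz0 : 0 < Re (w + z) by rewrite cReD addr_gt0.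
have [hc hE] := laplace_conv (lapL1_jpow ltr01 w0) (lapL1_jpow ltr01 z0).
rewrite -hE -/(cGamma _) /cGamma -cintZ; last exact: lapL1_jpow.
congr cint; apply/funext => x; rewrite mulrCA; congr (_ * _).
have [x0|x0] := leP x 0.
  rewrite causal_jpow // mulr0 /conv.
  have -> : (fun t => jpow w (x - t) * jpow z t) = (fun=> 0).
    apply/funext => t; have [t0|t0] := leP t 0; first by rewrite [jpow z t]causal_jpow ?mulr0.
    by rewrite causal_jpow ?mul0r //; lra.
  by apply: complex_eq; rewrite /cint /= /Rintegral integral0.
pose a := x / y; have a0 : 0 < a by rewrite divr_gt0.
have aN0 : a != 0 by rewrite gt_eqF.
have mx : cmeas (fun t : R => jpow w (x - t) * jpow z t).
  apply: cmeasM; last exact: cmeas_jpow.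
  apply: (cmeas_comp (h := fun t : R => x - t)); last exact: cmeas_jpow.
  exact: measurable_funB.
rewrite /conv (cint_affine 0 aN0 mx).
have -> : (fun t => `|a|%:C * (jpow w (x - (a * t + 0)) * jpow z (a * t + 0))) =
  (fun t => cpow a%:C (w + z - 1) * (jpow w (y - t) * jpow z t)).
  apply/funext => t; rewrite addr0 gtr0_norm //.
  have -> : x - a * t = a * (y - t) by rewrite mulrBr /a divfK // gt_eqF.
  rewrite !jpowM //.
  have -> : w + z - 1 = (w - 1) + (z - 1) + 1 by ring.
  by rewrite !cpowD // cpow1 //; ring.
rewrite cintZ // /B -/(conv (jpow w) (jpow z) y).
have -> : jpow (w + z) x = cpow x%:C (w + z - 1) by rewrite /jpow x0.
have -> : cpow a%:C (w + z - 1) = cpow x%:C (w + z - 1) / cpow y%:C (w + z - 1).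
  by rewrite /a cpow_mul ?invr_gt0 // cpowV // cpowN.
by ring.
Qed.

(** Integrability of the Beta integrand is inherited from Fubini's theorem at
    almost every y, and one y is enough for [beta_at]. *)
Lemma beta_ex w z : 0 < Re w -> 0 < Re z ->
  exists2 y, 0 < y & cL1 mu (fun t => jpow w (y - t) * jpow z t).
Proof.
move=> w0 z0.
have [N [mN N0 NE]] := cL1_conv_ae (lapL1_jpow ltr01 w0) (lapL1_jpow ltr01 z0).
apply: contrapT => h.
have sub : `]0, 1[%classic `<=` N.
  move=> y /=; rewrite in_itv /= => /andP[y0 _]; apply: NE => h1; apply: h; exists y => //.
have mle : (mu (`]0%R, 1%R[%classic : set R) <= mu N)%E by apply: le_measure => //; rewrite inE.
move: mle; rewrite N0 lebesgue_measure_itv /= lte_fin ltr01 oppr0 adde0.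
by rewrite lee_fin ler10.
Qed.

(** Both Beta integrals are taken at the same y; passing to absolute values in the
    complex one gives the real one. *)
Lemma gamma_supermul w z : 0 < Re w -> 0 < Re z ->
  normc (cGamma w) * normc (cGamma z) * rGamma (Re (w + z)) <=
  rGamma (Re w) * rGamma (Re z) * normc (cGamma (w + z)).
Proof.
move=> w0 z0; have [y y0 hy] := beta_ex w0 z0.
pose a := Re w; pose b := Re z.
have a0 : 0 < Re a%:C by []. have b0 : 0 < Re b%:C by [].
have nE t : normc (jpow a%:C (y - t) * jpow b%:C t) = normc (jpow w (y - t) * jpow z t).
  by rewrite !cnormM (normc_jpowRe w) (normc_jpowRe z).
have my : cmeas (fun t : R => jpow a%:C (y - t) * jpow b%:C t).
  apply: cmeasM; last exact: cmeas_jpow.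
  apply: (cmeas_comp (h := fun t : R => y - t)); last exact: cmeas_jpow.
  exact: measurable_funB.
have hr : cL1 mu (fun t => jpow a%:C (y - t) * jpow b%:C t).
  by apply: (cL1_le _ hy); [exact: my|move=> t; rewrite nE].
have Ec := beta_at w0 z0 y0 hy; have Er := beta_at a0 b0 y0 hr.
have convR : conv (jpow a%:C) (jpow b%:C) y =
    (fine (cmass mu (fun t => jpow w (y - t) * jpow z t)))%:C.
  rewrite /conv.
  have -> : (fun t => jpow a%:C (y - t) * jpow b%:C t) =
     (fun t => (normc (jpow w (y - t) * jpow z t))%:C).
    apply/funext => t; rewrite -nE cnormM rmorphM /=.
    by rewrite -!jpow_real.
  by rewrite cint_real.
have convle : normc (conv (jpow w) (jpow z) y) <=
    fine (cmass mu (fun t => jpow w (y - t) * jpow z t)).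
  rewrite -lee_fin fineK; first exact: normc_cint.
  by rewrite ge0_fin_numE ?cmass_ge0 //; exact: hy.2.
move: Er; rewrite !cGamma_real -rmorphD cGamma_real /= convR.
rewrite -(rmorph1 (real_complex R)) -rmorphB cpow_powR // -fmorphV -!rmorphM /= => -[Er].
rewrite -cnormM Ec cnormM normc_div normc_cpow //.
rewrite [leRHS](_ : _ = rGamma a * rGamma b * normc (cGamma (w + z))) // Er.
rewrite !(cReD, cReN) /= -/a -/b -mulrA mulrACA [leRHS]mulrAC -[leRHS]mulrA.
rewrite [leLHS](_ : _ = normc (conv (jpow w) (jpow z) y) *
  ((y `^ (a + b - 1))^-1 * (normc (cGamma (w + z)) * rGamma (a + b)))); last by ring.
rewrite [leRHS](_ : _ = fine (cmass mu (fun t => jpow w (y - t) * jpow z t)) *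
  ((y `^ (a + b - 1))^-1 * (normc (cGamma (w + z)) * rGamma (a + b)))); last by ring.
by rewrite ler_wpM2r // mulr_ge0 ?invr_ge0 ?powR_ge0 // mulr_ge0 ?normc_ge0 ?rGamma_ge0.
Qed.

End gamma.

(** * Nonvanishing and growth of the Gamma function *)

Section gamma_nonvanishing.
Context {R : realType}.
Local Notation mu := (@lebesgue_measure R).
Implicit Types (z w : R[i]) (s t x y : R).

Lemma clnE (w : R[i]) t : 0 < t ->
  cpow t%:C w = (expR (Re w * ln t) * cos (Im w * ln t)) +i*
                (expR (Re w * ln t) * sin (Im w * ln t)).
Proof.
move=> t0; rewrite cpowE // /cexp cReM cImM /= !mulr0 subr0 add0r.
by apply: complex_eq; rewrite !(cReM, cImM) /=; ring.
Qed.

Lemma continuous_Re_cpow w y : 0 < y ->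
  {for y, continuous (fun t => expR (Re w * ln t) * cos (Im w * ln t))}.
Proof.
move=> y0; apply: continuousM.
  apply: (continuous_comp (f := fun t => Re w * ln t)); last exact: continuous_expR.
  by apply: continuousM; [exact: cst_continuous|exact: continuous_ln].
apply: (continuous_comp (f := fun t => Im w * ln t)); last exact: continuous_cos.
by apply: continuousM; [exact: cst_continuous|exact: continuous_ln].
Qed.

Lemma continuous_Im_cpow w y : 0 < y ->
  {for y, continuous (fun t => expR (Re w * ln t) * sin (Im w * ln t))}.
Proof.
move=> y0; apply: continuousM.
  apply: (continuous_comp (f := fun t => Re w * ln t)); last exact: continuous_expR.
  by apply: continuousM; [exact: cst_continuous|exact: continuous_ln].
apply: (continuous_comp (f := fun t => Im w * ln t)); last exact: continuous_sin.
by apply: continuousM; [exact: cst_continuous|exact: continuous_ln].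
Qed.

(** Near t = 1 the real part of t^(w-1) exceeds 1/2, so the running integral of
    t^(w-1) cannot stay zero there. *)
Lemma prim_jpow_neq0 w : 0 < Re w ->
  exists2 y, 0 < y & prim (jpow w) y != 0.
Proof.
move=> w0; apply: contrapT => h.
have p0 y : 0 < y -> prim (jpow w) y = 0.
  by move=> y0; apply/eqP; apply: contrapT => /negP p0; apply: h; exists y.
pose q t := expR (Re (w - 1) * ln t) * cos (Im (w - 1) * ln t).
have cq : {for 1, continuous q} by exact: continuous_Re_cpow.
have q1 : q 1 = 1 by rewrite /q ln1 !mulr0 expR0 cos0 mul1r.
have : \forall t \near (1 : R), 2^-1 < q t.
  move: cq; rewrite /prop_for /continuous_at q1 => /cvgrPdist_lt /(_ 2^-1).
  have h2 : (0 : R) < 2^-1 by rewrite invr_gt0.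
  move=> /(_ h2); apply: filterS => t; rewrite ltr_distl => /andP[h3 h4]; lra.
move=> /nbhs_ballP[e /= e0 He].
pose b := 1 + e / 2; have b1 : 1 < b by rewrite ltrDl divr_gt0.
have b0 : 0 < b by rewrite (lt_trans ltr01).
have lj := lapL1_locL1 ler01 (lapL1_jpow ltr01 w0).
have : cint mu (fun t => trunc (jpow w) b t - trunc (jpow w) 1 t) = 0.
  by rewrite cintB -?/(prim _ _) ?p0 ?subr0 //; exact: lj.
move=> /(congr1 (@complex.Re R)) /= Re0.
have E t : Re (trunc (jpow w) b t - trunc (jpow w) 1 t) =
    if (1 < t) && (t <= b) then q t else 0.
  rewrite /trunc; case: (leP t 1) => t1 /=.
    by rewrite (le_trans t1 (ltW b1)) subrr.
  have t0 : 0 < t := lt_trans ltr01 t1.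
  by case: ifP => _; rewrite ?subr0 // /jpow t0 clnE.
have iL : mu.-integrable setT
    (fun t => (Re (trunc (jpow w) b t - trunc (jpow w) 1 t))%:E).
  by apply: cL1_Re; apply: cL1D; [exact: lj|apply: cL1N; exact: lj].
have : (\int[mu]_t (Re (trunc (jpow w) b t - trunc (jpow w) 1 t))%:E <= 0)%E.
  rewrite -(fineK (integrable_fin_num measurableT iL)) lee_fin.
  by move: Re0; rewrite /Rintegral => ->.
apply/negP; rewrite -ltNge.
apply: (@lt_le_trans _ _ (\int[mu]_(t in `]1%R, b]) (2^-1)%:E)%E).
  rewrite integral_cst //= lebesgue_measure_itv /= lte_fin b1 -EFinB -EFinM lte_fin.
  by rewrite mulr_gt0 ?invr_gt0 // subr_gt0.
rewrite integral_mkcond; apply: ge0_le_integral => //.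
- by move=> t _; rewrite patchE; case: ifP => // _; rewrite lee_fin invr_ge0.
- apply/(measurable_restrictT _ _).1 => //; exact: measurable_cst.
- exact: (measurable_int _ iL).
- move=> t _; rewrite E patchE; case: ifPn.
    rewrite inE /= in_itv /= => /andP[t1 tb]; rewrite t1 tb lee_fin ltW //.
    apply: He; rewrite /ball /= ltr0_norm ?opprB; first by rewrite /b in tb; lra.
    by rewrite subr_lt0.
  by rewrite notin_setE /= in_itv /= => /negP/negbTE ->.
Qed.

Lemma jpow1E : jpow (1 : R[i]) = (fun t : R => if 0 < t then 1 else 0).
Proof.
apply/funext => t; rewrite /jpow subrr; case: ifP => // t0.
by rewrite cpowE // mul0r cexp0.
Qed.

(** The Beta identity with second exponent 1, whose convolution is the running
    integral. *)
Lemma cGammaS_neq0 w : 0 < Re w -> cGamma w = 0 -> cGamma (w + 1) = 0.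
Proof.
move=> w0 G0; have [y y0 py] := prim_jpow_neq0 w0.
have r1 : 0 < Re (1 : R[i]) by [].
have lj := lapL1_locL1 ler01 (lapL1_jpow ltr01 w0).
have E t : t <> y -> jpow (1 : R[i]) (y - t) * jpow w t = trunc (jpow w) y t.
  move=> ty; rewrite jpow1E subr_gt0 /trunc lt_neqAle.
  by have /eqP -> := ty; rewrite /=; case: ifP => _; rewrite ?mul1r ?mul0r.
have m1 : measurable ([set y] : set R) by exact: measurable_set1.
have hy : cL1 mu (fun t : R => jpow (1 : R[i]) (y - t) * jpow w t).
  apply: (cL1_le _ (lj y)).
    apply: cmeasM; last exact: cmeas_jpow.
    apply: (cmeas_comp (h := fun t : R => y - t)); last exact: cmeas_jpow.
    exact: measurable_funB.
  move=> t; have [->|/eqP/E ->//] := eqVneq t y.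
  by rewrite subrr causal_jpow // mul0r normc_0 normc_ge0.
rewrite [w + 1]addrC; have := beta_at r1 w0 y0 hy; rewrite G0 mulr0 => /esym/eqP.
rewrite mulf_eq0 mulf_eq0 invr_eq0 (negbTE (cpow_neq0 _ y0)) orbF => /orP[|/eqP //].
have -> : conv (jpow 1) (jpow w) y = prim (jpow w) y.
  rewrite /conv /prim; apply: (cint_null (N := [set y])).
  - exact: m1.
  - exact: lebesgue_measure_set1.
  - by move=> t /= ty; rewrite E.
by rewrite (negbTE py).
Qed.

Lemma cGamma_mul_eq0 w z : 0 < Re w -> 0 < Re z ->
  cGamma (w + z) = 0 -> cGamma w = 0 \/ cGamma z = 0.
Proof.
move=> w0 z0 G0; have [y y0 hy] := beta_ex w0 z0.
have := beta_at w0 z0 y0 hy; rewrite G0 mulr0 => /eqP.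
by rewrite mulf_eq0 => /orP[/eqP|/eqP]; [left|right].
Qed.

(** The Beta identity expresses Gamma(w) Gamma(z) as a multiple of Gamma(w + z),
    so zeros descend to one of the summands. *)
Lemma cGamma_nat_eq0 w n : 0 < Re w -> cGamma (w * n.+1%:R) = 0 -> cGamma w = 0.
Proof.
move=> w0; elim: n => [|n IH]; first by rewrite mulr1.
have -> : w * n.+2%:R = w + w * n.+1%:R.
  by rewrite -[n.+2]add1n natrD mulrDr mulr1.
move=> /cGamma_mul_eq0; case=> //.
by rewrite cReM -(rmorph_nat (real_complex R)) /= mulr0 subr0 mulr_gt0.
Qed.

(** A zero z would propagate to all z/n and hence to all 1 + z/n, while
    Gamma is continuous at 1 with value 1. *)
Theorem cGamma_neq0 z : 0 < Re z -> cGamma z != 0.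
Proof.
move=> z0; apply/eqP => G0.
pose v n : R[i] := z * (n.+1%:R^-1)%:C.
have v0 n : 0 < Re (v n) by rewrite cReM /= mulr0 subr0 mulr_gt0 // invr_gt0.
have Gv n : cGamma (1 + v n) = 0.
  rewrite addrC; apply: cGammaS_neq0 => //.
  apply: (@cGamma_nat_eq0 _ n) => //; rewrite /v -mulrA.
  rewrite -(rmorph_nat (real_complex R)) -rmorphM /= mulVf ?pnatr_eq0 // mulr1 //.
have lim0 (a : R) : a * n.+1%:R^-1 @[n --> \oo] --> (0 : R).
  rewrite -[X in _ --> X](mulr0 a); apply: cvgMr; exact: cvg_harmonic.
pose f_ n t := (Re (eweight 1 t * jpow (1 + v n) t))%:E.
pose f t := (Re (eweight 1 t * jpow (1 : R[i]) t))%:E.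
pose g t := (normc (eweight 1 t * jpow (1 : R[i]) t) + normc (eweight 1 t * jpow (1 + z) t))%:E.
have r1 : 0 < Re (1 : R[i]) by [].
have rz : 0 < Re (1 + z) by rewrite cReD /= addr_gt0.
have rn n : 0 < Re (1 + v n) by rewrite cReD addr_gt0.
have l1 := lapL1_jpow ltr01 r1.
have ln_ n := lapL1_jpow ltr01 (rn n).
have lz := lapL1_jpow ltr01 rz.
have inorm h : lapL1 h 1 -> mu.-integrable setT (fun t => (normc (eweight 1 t * h t))%:E).
  move=> hh; apply/integrableP; split; first exact: (emeasurable_normc hh.1).
  apply: le_lt_trans hh.2; rewrite le_eqVlt; apply/orP; left; apply/eqP.
  by apply: eq_integral => t _; rewrite abse_EFin ger0_norm // normc_ge0.
have [] := @dominated_convergence _ (measurableTypeR R) R mu setT measurableT f_ f g.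
- by move=> n; exact: (measurable_int _ (cL1_Re (ln_ n))).
- exact: (measurable_int _ (cL1_Re l1)).
- apply: aeW => t _; rewrite /f_ /f; have [t0|t0] := leP t 0.
    have -> : (fun n => (Re (eweight 1 t * jpow (1 + v n) t))%:E) =
      (fun=> (Re (eweight 1 t * jpow (1 : R[i]) t))%:E).
      by apply/funext => n; rewrite !causal_jpow.
    exact: cvg_cst.
  apply: cvg_EFin; first by apply: nearW.
  have -> : fine \o (fun n => (Re (eweight 1 t * jpow (1 + v n) t))%:E) =
    (fun n => expR (- (1 * t)) * (expR (Re z * ln t * n.+1%:R^-1) *
       cos (Im z * ln t * n.+1%:R^-1))).
    apply/funext => n; rewrite /= cReM /= mul0r subr0 /jpow t0 addrAC subrr add0r.
    rewrite clnE //= /v cReM cImM /= !mulr0 subr0 add0r.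
    by rewrite !(mulrAC _ (n.+1%:R^-1)).
  have -> : Re (eweight 1 t * jpow (1 : R[i]) t) = expR (- (1 * t)) * (expR 0 * cos 0).
    by rewrite jpow1E t0 mulr1 /= expR0 cos0 !mulr1.
  apply: cvgMr; apply: cvgM.
    exact: (cvg_comp _ expR (lim0 (Re z * ln t)) (@continuous_expR R 0)).
  exact: (cvg_comp _ cos (lim0 (Im z * ln t)) (@continuous_cos R 0)).
- exact: (integrableD measurableT (inorm _ l1) (inorm _ lz)).
- apply: aeW => t n _; rewrite /f_ /g lee_fin.
  apply: (le_trans (normr_Re_le _)).
  rewrite !cnormM -mulrDr ler_wpM2l ?normc_ge0 // !normc_jpow.
  case: ifP => [t0|_]; last by rewrite addr0.
  have e1 (a b : R) : 1 + a - 1 = a by lra.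
  rewrite !cReD /= (addrAC 1) subrr add0r powRr0 (addrAC 1) subrr add0r.
  have vn : Re (v n) <= Re z.
    rewrite cReM /= mulr0 subr0 ler_piMr ?(ltW z0) // invf_le1 ?ltr0n //.
    by rewrite ler1n.
  have [t1|t1] := leP 1 t.
    by apply: (le_trans (ler_powR t1 vn)); rewrite lerDr.
  apply: (@le_trans _ _ 1); last by rewrite lerDl powR_ge0.
  have -> : 1 = t `^ 0 by rewrite powRr0.
  by apply: ger_powR; rewrite ?t0 ?(ltW t1) // ltW.
move=> _ _; rewrite /=.
have -> : (fun n => \int[mu]_x f_ n x)%E = (fun=> 0%E).
  apply/funext => n; rewrite -[LHS](fineK (integrable_fin_num measurableT (cL1_Re (ln_ n)))).
  have := Gv n; rewrite /cGamma /laplace /cint => -[+ _].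
  by rewrite /Rintegral => ->.
move=> /cvg_lim; rewrite lim_cst // => /(_ _)/esym E.
have : cGamma (1 : R[i]) = 1 by exact: cGamma1.
rewrite /cGamma /laplace /cint => -[+ _]; rewrite /Rintegral.
rewrite -/f [X in fine X](_ : _ = 0%E); last exact: E.
by move=> /= /eqP; rewrite eq_sym oner_eq0.
Qed.

End gamma_nonvanishing.

Section gamma_growth.
Context {R : realType}.
Local Notation mu := (@lebesgue_measure R).
Implicit Types (z w A B : R[i]) (s t x y : R).

Lemma rGamma_gt0 x : 0 < x -> 0 < rGamma x.
Proof.
move=> x0; rewrite lt_def rGamma_ge0 andbT.
have h : 0 < Re x%:C by [].
have := cGamma_neq0 h; rewrite cGamma_real; apply: contra => /eqP ->.
by [].
Qed.

(** The ratio |Gamma(z)|/Gamma(Re z) is supermultiplicative, hence decays at most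
    geometrically along an arithmetic progression. *)
Lemma gamma_ratio A B : 0 < Re A -> 0 < Re B ->
  exists C D : R, [/\ 0 < C, 0 < D & forall n,
    rGamma (Re (A * n%:R + B)) <=
    D * C ^+ n * normc (cGamma (A * n%:R + B))].
Proof.
move=> A0 B0.
pose rho z := rGamma (Re z) / normc (cGamma z).
have nz z : 0 < Re z -> 0 < normc (cGamma z).
  by move=> z0; rewrite normc_gt0 cGamma_neq0.
have rho0 z : 0 < Re z -> 0 < rho z.
  by move=> z0; rewrite divr_gt0 ?rGamma_gt0 ?nz.
exists (rho A), (rho B); split; [exact: rho0|exact: rho0|].
have zn n : 0 < Re (A * n%:R + B).
  rewrite cReD cReM -(rmorph_nat (real_complex R)) /= mulr0 subr0.
  by rewrite ltr_wpDl // mulr_ge0 // ltW.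
elim=> [|n IH].
  by rewrite mulr0 add0r expr0 mulr1 /rho divfK // gt_eqF // nz.
have -> : A * n.+1%:R + B = A + (A * n%:R + B).
  by rewrite -[n.+1]add1n natrD mulrDr mulr1 addrA.
have := gamma_supermul A0 (zn n); set w := A * n%:R + B in IH *.
move=> h; have AG := nz _ A0; have wG := nz w (zn n).
rewrite -(ler_pM2l (mulr_gt0 AG wG)); apply: (le_trans h).
have -> : normc (cGamma A) * normc (cGamma w) *
   (rho B * rho A ^+ n.+1 * normc (cGamma (A + w))) =
   rGamma (Re A) * (rho B * rho A ^+ n * normc (cGamma w)) * normc (cGamma (A + w)).
  have -> : rGamma (Re A) = rho A * normc (cGamma A) by rewrite divfK // gt_eqF.
  rewrite exprS; move: (rho A) (rho B) (rho A ^+ n) (normc _) (normc _) (normc _).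
  by move=> a b c p q r; ring.
by rewrite ler_wpM2r ?normc_ge0 // ler_wpM2l ?rGamma_ge0.
Qed.

(** The integral defining Gamma is bounded below by its part over [t, t + 1];
    this turns summability of the transforms of the terms of the kernel into
    pointwise summability. *)
Lemma powR_le_cmass s t x : 0 < s -> 0 < t -> 0 < x ->
  t `^ (x - 1) <= expR (s * (t + 1)) * ((t + 1) / t) * (rGamma x * s `^ (- x)).
Proof.
move=> s0 t0 x0; have x0' : 0 < Re x%:C by [].
have t1 : 0 < t + 1 by rewrite addr_gt0.
pose c := expR (- (s * (t + 1))) * (t `^ x / (t + 1)).
have c0 : 0 < c by rewrite mulr_gt0 ?expR_gt0 // divr_gt0 // powR_gt0.
have : c <= rGamma x * s `^ (- x).
  rewrite -lee_fin -[x in rGamma x]/(Re x%:C) -(cmass_jpow s0 x0').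
  apply: (@le_trans _ _ (\int[mu]_(y in `]t, (t + 1)%R]) c%:E)%E).
    rewrite integral_cst //= lebesgue_measure_itv /= lte_fin ltrDl ltr01.
    by rewrite -EFinB addrAC subrr add0r mule1.
  rewrite integral_mkcond; apply: ge0_le_integral => //.
  - by move=> y _; rewrite patchE; case: ifP => // _; rewrite lee_fin ltW.
  - by apply/(measurable_restrictT _ _).1 => //; exact: measurable_cst.
  - exact: (emeasurable_normc (lapL1_jpow s0 x0').1).
  - move=> y _; rewrite patchE; case: ifPn; last by rewrite lee_fin normc_ge0.
    rewrite inE /= in_itv /= => /andP[ty yt].
    have y0 : 0 < y := lt_trans t0 ty.
    rewrite lee_fin cnormM normc_eweight normc_jpow y0 /c /=.
    apply: ler_pM; rewrite ?expR_ge0 ?divr_ge0 ?powR_ge0 ?(ltW t1) //.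
      by rewrite ler_expR lerN2 ler_wpM2l ?(ltW s0).
    rewrite powRB ?(gt_eqF y0) ?implybT // powRr1 ?(ltW y0) //.
    apply: ler_pM; rewrite ?powR_ge0 ?invr_ge0 ?(ltW t1) //.
      by rewrite ge0_ler_powR ?nnegrE ?(ltW x0) ?(ltW t0) ?(ltW y0) // ltW.
    by rewrite lef_pV2 ?posrE.
move=> h; apply: le_trans (ler_wpM2l _ h); last first.
  by rewrite mulr_ge0 ?expR_ge0 // divr_ge0 // ltW.
rewrite le_eqVlt; apply/orP; left; apply/eqP.
rewrite /c expRN powRB ?(gt_eqF t0) ?implybT // powRr1 ?(ltW t0) //.
move: (t `^ x) (expR (s * (t + 1))) (expR_gt0 (s * (t + 1))) => a b b0.
by field; rewrite !gt_eqF.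
Qed.

End gamma_growth.

(** * The Prabhakar kernel and its Laplace transform *)

Section kernel.
Context {R : realType}.
Local Notation mu := (@lebesgue_measure R).
Variables (A B : R[i]) (beta : nat -> R[i]).
Hypotheses (A0 : 0 < Re A) (B0 : 0 < Re B).
Implicit Types (s t x y : R).

Definition expo n : R[i] := A * n%:R + B.
Definition kcoef n : R[i] := beta n / cGamma (expo n).

(** The convolution kernel whose Laplace transform is [symbol]. *)
Definition kernel t : R[i] := csum (fun n => kcoef n * jpow (expo n) t).
Definition symbol s : R[i] := csum (fun n => beta n * cpow s%:C (- expo n)).

Lemma Re_expo n : Re (expo n) = Re A * n%:R + Re B.
Proof. by rewrite cReD cReM -(rmorph_nat (real_complex R)) /= mulr0 subr0. Qed.

Lemma Re_expo_gt0 n : 0 < Re (expo n).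
Proof. by rewrite Re_expo ltr_wpDl // mulr_ge0 // ltW. Qed.

(** Absolute summability of the Laplace transforms at s of the terms of the
    kernel, by [cmass_jpow]. *)
Definition kernel_summable s := csummable (fun n =>
  kcoef n * (rGamma (Re (expo n)) * s `^ (- Re (expo n)))%:C).

Section summable_at.
Variable s : R.
Hypotheses (s0 : 0 < s) (ks : kernel_summable s).

Lemma kernel_pointwise t : csummable (fun n => kcoef n * jpow (expo n) t).
Proof.
pose E := expR (s * (t + 1)) * ((t + 1) / t).
apply: (cL1_le (cmeas_nat _) (cL1Z E%:C ks)) => n.
rewrite normcRM !cnormM normc_jpow normcR.
case: ifP => t0; last by rewrite mulr0 !mulr_ge0 ?normc_ge0.
have E0 : 0 <= E by rewrite mulr_ge0 ?expR_ge0 // divr_ge0 ?addr_ge0 // ltW.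
have H := powR_le_cmass s0 t0 (Re_expo_gt0 n).
rewrite [leRHS]mulrCA; apply: ler_wpM2l; first by rewrite mulr_ge0 ?normc_ge0.
by rewrite (ger0_norm E0) (le_trans H) // ler_wpM2l // ler_norm.
Qed.

Let F (p : R * nat) := eweight s p.1 * (kcoef p.2 * jpow (expo p.2) p.1).

Let Fn n : (fun t => F (t, n)) = (fun t => kcoef n * (eweight s t * jpow (expo n) t)).
Proof. by apply/funext => t; rewrite /F /=; ring. Qed.

Let lj n : lapL1 (jpow (expo n)) s.
Proof. exact: lapL1_jpow (Re_expo_gt0 n). Qed.

Let mF : cmeas F.
Proof.
apply: cmeas_prod_nat => n; rewrite Fn; apply: cmeasM; first exact: cmeas_cst.
exact: (lj n).1.
Qed.

Let finF : (\int[mu]_t cmass (@counting nat R) (fun n => F (t, n)) < +oo)%E.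
Proof.
rewrite (@cmass_swap _ _ (measurableTypeR R) nat R mu (@counting nat R) F mF).
apply: le_lt_trans ks.2; rewrite le_eqVlt; apply/orP; left; apply/eqP.
apply: eq_integral => n _; rewrite Fn ge0_nmassZ; last exact: (lj n).1.
rewrite cmass_jpow ?Re_expo_gt0 // -EFinM; congr EFin.
rewrite [in RHS]mulrC normcRM mulrC ger0_norm //.
by rewrite mulr_ge0 ?powR_ge0 ?rGamma_ge0.
Qed.

Let FE t : cint (@counting nat R) (fun n => F (t, n)) = eweight s t * kernel t.
Proof. by rewrite /kernel /csum -cintZ //; exact: kernel_pointwise. Qed.

Lemma lapL1_kernel : lapL1 kernel s.
Proof.
have := @cL1_cint _ _ (measurableTypeR R) nat R mu (@counting nat R) F mF finF.
by under eq_fun do rewrite FE.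
Qed.

Lemma laplace_kernel : laplace kernel s = symbol s.
Proof.
have := @cint_swap _ _ (measurableTypeR R) nat R mu (@counting nat R) F mF finF.
have -> : (fun t => cint (@counting nat R) (fun n => F (t, n))) =
   (fun t => eweight s t * kernel t) by apply/funext => t; rewrite FE.
rewrite -/(laplace kernel s) => ->; congr cint; apply/funext => n.
rewrite Fn cintZ; last exact: lj.
have := laplace_jpow s0 (Re_expo_gt0 n); rewrite /laplace => ->.
by rewrite mulrA divfK // cGamma_neq0 // Re_expo_gt0.
Qed.

End summable_at.

Lemma causal_kernel : causal kernel.
Proof.
by move=> t t0; apply: csum0 => n; rewrite causal_jpow // mulr0.
Qed.

End kernel.

(** * The binomial series *)

Section series_tools.
Context {R : realType}.
Implicit Types (u v : nat -> R[i]) (a : nat -> R).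

Lemma csum_cvg_part (p : R[i] -> R) u : csummable u ->
  (forall z w, p (z - w) = p z - p w) -> (forall z, `|p z| <= normc z) ->
  series (fun n => p (u n)) @ \oo --> p (csum u).
Proof.
move=> su pB pn.
have p0 : p 0 = 0 by rewrite -(subrr (0 : R[i])) pB subrr.
have pN w : p (- w) = - p w by rewrite -[- w]sub0r pB p0 sub0r.
have pD z w : p (z + w) = p z + p w by have := pB z (- w); rewrite opprK pN opprK.
apply/cvgrPdist_lt => e e0; have [N HN] := csum_cvg su e0.
exists N => // n /= /HN; apply: le_lt_trans.
rewrite /series /= big_mkord -(big_morph p pD p0) -pB; exact: pn.
Qed.

Lemma csum_cvg_Re u : csummable u ->
  series (fun n => Re (u n)) @ \oo --> Re (csum u).
Proof.
by move=> su; apply: (csum_cvg_part (p := @complex.Re R) su) => [z w|z];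
  [rewrite cReD cReN|exact: normr_Re_le].
Qed.

Lemma csum_cvg_Im u : csummable u ->
  series (fun n => Im (u n)) @ \oo --> Im (csum u).
Proof.
by move=> su; apply: (csum_cvg_part (p := @complex.Im R) su) => [z w|z];
  [rewrite cImD cImN|exact: normr_Im_le].
Qed.

Lemma nsum_nneg a (l : R) : (forall n, 0 <= a n) -> series a @ \oo --> l ->
  nsum (fun n => (a n)%:C) = l%:E.
Proof.
move=> a0 al; rewrite /nsum /cmass.
under eq_integral do rewrite normcR ger0_norm //.
rewrite ge0_integral_count //; apply: cvg_lim => //.
have -> : (fun n => \sum_(0 <= k < n) (a k)%:E)%E = EFin \o series a.
  by apply/funext => n; rewrite sumEFin.
by apply/fine_cvgP; split => //; exact: nearW.
Qed.

Lemma csummable_nneg a (l : R) : (forall n, 0 <= a n) -> series a @ \oo --> l ->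
  csummable (fun n => (a n)%:C).
Proof.
by move=> a0 al; split; [exact: cmeas_nat|rewrite -/(nsum _) (nsum_nneg a0 al) ltry].
Qed.

Lemma csummable_le u a : csummable (fun n => (a n)%:C) ->
  (forall n, normc (u n) <= a n) -> csummable u.
Proof.
move=> sa ua; apply: (cL1_le (cmeas_nat _) sa) => n.
by rewrite normcR (le_trans (ua n)) // ler_norm.
Qed.

Lemma csummable_geometric (x : R) : 0 <= x < 1 -> csummable (fun n => (x ^+ n)%:C).
Proof.
move=> /andP[x0 x1]; apply: (csummable_nneg (l := 1 / (1 - x))) => [n|].
  exact: exprn_ge0.
have := @cvg_geometric_series R 1 x; rewrite ger0_norm // => /(_ x1).
by rewrite /geometric /=; under eq_fun do rewrite mul1r.
Qed.

Lemma csummable_ratio a (q : R) N : 0 <= q < 1 -> (forall n, 0 <= a n) ->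
  (forall n, (N <= n)%N -> a n.+1 <= q * a n) -> csummable (fun n => (a n)%:C).
Proof.
elim: N a => [|N IH] a q1 a0 aq; last first.
  by apply: csummable_cons; apply: IH => // n Nn; apply: aq.
apply: (cL1_le (cmeas_nat _) (cL1Z (a 0%N)%:C (csummable_geometric q1))) => n.
rewrite normcRM !normcR !ger0_norm ?exprn_ge0 //; last by case/andP: q1.
elim: n => [|n IHn]; first by rewrite expr0 mulr1.
rewrite exprS (le_trans (aq n _)) // mulrCA ler_wpM2l //.
by case/andP: q1.
Qed.

Lemma csumZ (c : R[i]) u : csummable u -> csum (fun n => c * u n) = c * csum u.
Proof. exact: cintZ. Qed.

End series_tools.

Section binomial_coefficients.
Context {R : realType}.
Implicit Types (a z : R[i]) (p x : R).

Definition bcoef a n : R[i] := \prod_(i < n) (a + i%:R) / (n`!)%:R.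
Definition rbcoef p n : R := \prod_(i < n) (p + i%:R) / (n`!)%:R.

Lemma bcoef0 a : bcoef a 0 = 1.
Proof. by rewrite /bcoef big_ord0 fact0 divr1. Qed.

Lemma bcoefS a n : n.+1%:R * bcoef a n.+1 = (a + n%:R) * bcoef a n.
Proof.
rewrite /bcoef big_ord_recr /= factS natrM.
have h1 : n.+1%:R != 0 :> R[i] by rewrite pnatr_eq0.
have h2 : n`!%:R != 0 :> R[i] by rewrite pnatr_eq0 -lt0n fact_gt0.
move: (\prod_(i < n) _) (n`!%:R) (n.+1%:R) (a + n%:R) h1 h2 => P f m b h1 h2.
by field; rewrite h1 h2.
Qed.

Lemma rbcoefS p n : n.+1%:R * rbcoef p n.+1 = (p + n%:R) * rbcoef p n.
Proof.
rewrite /rbcoef big_ord_recr /= factS natrM.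
have h1 : n.+1%:R != 0 :> R by rewrite pnatr_eq0.
have h2 : n`!%:R != 0 :> R by rewrite pnatr_eq0 -lt0n fact_gt0.
move: (\prod_(i < n) _) (n`!%:R) (n.+1%:R) (p + n%:R) h1 h2 => P f m b h1 h2.
by field; rewrite h1 h2.
Qed.

Lemma rbcoef_ge0 p n : 0 <= p -> 0 <= rbcoef p n.
Proof.
by move=> p0; rewrite divr_ge0 //; apply: prodr_ge0 => i _; rewrite addr_ge0.
Qed.

Lemma normc_bcoef a n : normc (bcoef a n) <= rbcoef (normc a) n.
Proof.
rewrite normc_div normc_natr ler_wpM2r ?invr_ge0 //.
elim: n => [|n IH]; first by rewrite !big_ord0 normc_1.
rewrite !big_ord_recr /= cnormM ler_pM ?normc_ge0 //.
by rewrite (le_trans (le_normcD _ _)) // normc_natr.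
Qed.

Lemma rbcoef_shift p n : (p + n%:R) * rbcoef p n = p * rbcoef (p + 1) n.
Proof.
rewrite /rbcoef !mulrA; congr (_ / _).
have <- : \prod_(i < n.+1) (p + i%:R) = (p + n%:R) * \prod_(i < n) (p + i%:R).
  by rewrite big_ord_recr /= mulrC.
rewrite big_ord_recl /= addr0; congr (_ * _).
by apply: eq_bigr => i _; rewrite /bump /= natrD addrA.
Qed.

Lemma bcoef_real p n : bcoef p%:C n = (rbcoef p n)%:C.
Proof.
rewrite /bcoef /rbcoef rmorphM /= fmorphV /= rmorph_nat; congr (_ / _).
by rewrite rmorph_prod; apply: eq_bigr => i _; rewrite rmorphD /= rmorph_nat.
Qed.

(** Consecutive terms have a ratio tending to x < 1. *)
Lemma csummable_rbcoef p x : 0 <= p -> 0 <= x < 1 ->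
  csummable (fun n => (rbcoef p n * x ^+ n)%:C).
Proof.
move=> p0 /andP[x0 x1].
pose q := (1 + x) / 2.
have q1 : 0 <= q < 1 by apply/andP; split; rewrite /q; lra.
(* past the index N the ratio x (p + n) / (n + 1) stays below q *)
pose N := Num.truncn (2 * (x * p) / (1 - x)).
have hN : 2 * (x * p) / (1 - x) < N.+1%:R by exact: truncnS_gt.
apply: (csummable_ratio (q := q) (N := N)) => // n.
  by rewrite mulr_ge0 ?rbcoef_ge0 ?exprn_ge0.
move=> Nn; have n0 : 0 < n.+1%:R :> R by rewrite ltr0n.
rewrite -(ler_pM2l n0).
have -> : n.+1%:R * (rbcoef p n.+1 * x ^+ n.+1) = x * (p + n%:R) * (rbcoef p n * x ^+ n).
  by rewrite exprS mulrA rbcoefS; ring.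
rewrite [leRHS]mulrA; apply: ler_wpM2r; first by rewrite mulr_ge0 ?rbcoef_ge0 ?exprn_ge0.
have : 2 * (x * p) / (1 - x) <= n.+1%:R.
  by rewrite (le_trans (ltW hN)) // ler_nat.
rewrite ler_pdivrMr ?subr_gt0 // => h.
have -> : n.+1%:R = n%:R + 1 :> R by rewrite -addn1 natrD.
move: h; rewrite -addn1 natrD /q => h; nra.
Qed.

End binomial_coefficients.

Section complex_derivative.
Context {R : realType}.
Implicit Types (f g : R -> R[i]) (d e : R[i]) (r : R).

Definition cder f r d := is_derive r 1 (fun x => Re (f x)) (Re d) /\
  is_derive r 1 (fun x => Im (f x)) (Im d).

Lemma cderM f g r d e : cder f r d -> cder g r e ->
  cder (fun x => f x * g x) r (d * g r + f r * e).
Proof.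
move=> [f1 f2] [g1 g2]; split.
  under eq_fun do rewrite cReM.
  apply: is_derive_eq (is_deriveB (is_deriveM f1 g1) (is_deriveM f2 g2)) _.
  by rewrite cReD !cReM /GRing.scale /=; ring.
under eq_fun do rewrite cImM.
apply: is_derive_eq (is_deriveD (is_deriveM f1 g2) (is_deriveM f2 g1)) _.
by rewrite cImD !cImM /GRing.scale /=; ring.
Qed.

Lemma cderZ (c : R[i]) f r d : cder f r d -> cder (fun x => c * f x) r (c * d).
Proof.
move=> hf; have hc : cder (fun=> c) r 0 by split; exact: is_derive_cst.
by have := cderM hc hf; rewrite mul0r add0r.
Qed.

Lemma cder_cexp f r d : cder f r d -> cder (fun x => cexp (f x)) r (d * cexp (f r)).
Proof.
move=> [f1 f2].
have e1 := is_derive1_comp (is_derive_expR _) f1.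
have c1 := is_derive1_comp (is_derive_cos _) f2.
have s1 := is_derive1_comp (is_derive_sin _) f2.
have E x : cexp (f x) = (expR (Re (f x)) * cos (Im (f x))) +i*
                        (expR (Re (f x)) * sin (Im (f x))).
  by rewrite /cexp; apply: complex_eq; rewrite !(cReM, cImM) /=; ring.
split.
  under eq_fun do rewrite E /=.
  apply: is_derive_eq (is_deriveM e1 c1) _.
  by rewrite E cReM /GRing.scale /=; ring.
under eq_fun do rewrite E /=.
apply: is_derive_eq (is_deriveM e1 s1) _.
by rewrite E cImM /GRing.scale /=; ring.
Qed.

Lemma cder0_cst f (a b : R) : a < b -> (forall r, a <= r <= b -> cder f r 0) -> f a = f b.
Proof.
move=> ab hf.
have key (q : R -> R) : (forall r, a <= r <= b -> is_derive r 1 q 0) -> q a = q b.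
  move=> hq.
  have cq : {within `[a, b], continuous q}.
    apply: derivable_within_continuous => r rab.
    by move: rab; rewrite in_itv /= => /hq D; exact: ex_derive.
  have dq r : r \in `]a, b[ -> is_derive r 1 q ((fun=> 0) r).
    by rewrite in_itv /= => /andP[h1 h2]; apply: hq; rewrite !ltW.
  have [r _ /eqP] := MVT ab dq cq.
  by rewrite mul0r subr_eq0 => /eqP.
by apply: complex_eq; apply: (key (fun x => _ (f x))) => r /hf [h1 h2].
Qed.

(** On the right half-plane the argument is an arctangent. *)
Lemma clog_right (w : R[i]) : 0 < Re w ->
  clog w = (ln (Re w ^+ 2 + Im w ^+ 2) / 2) +i*
           atan (Im w / Re w).
Proof.
case: w => x y /= x0; rewrite /clog /carg -!normcE.
set N := x ^+ 2 + y ^+ 2.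
have N0 : 0 < N by rewrite ltr_wpDr ?sqr_ge0 // exprn_gt0.
have nE : normc (x +i* y) = Num.sqrt N by [].
rewrite nE.
have xE : x / Num.sqrt N = cos (atan (y / x)).
  have -> : N = x ^+ 2 * (1 + (y / x) ^+ 2) by rewrite /N; field; rewrite gt_eqF.
  rewrite cos_atan sqrtrM ?sqr_ge0 // sqrtr_sqr gtr0_norm //.
  have s0 : 0 < Num.sqrt (1 + (y / x) ^+ 2) by rewrite sqrtr_gt0 ltr_wpDr ?sqr_ge0.
  by move: (Num.sqrt _) s0 => s s0; field; rewrite !gt_eqF.
have lnE : ln (Num.sqrt N) = ln N / 2.
  have -> : ln N = ln (Num.sqrt N) *+ 2.
    by rewrite -lnXn ?sqrtr_gt0 // sqr_sqrtr // ltW.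
  by rewrite -(mulr_natr (ln _)) mulfK // pnatr_eq0.
have pi2 := pi_gt0 R.
rewrite xE lnE; congr (_ +i* _) => /=; case: ifPn => y0.
  rewrite cosK // in_itv /=; apply/andP; split.
    by rewrite -atan0; apply: le_atan; rewrite divr_ge0 // ltW.
  by have := atan_ltpi2 (y / x); lra.
rewrite -ltNge in y0; rewrite cosKN ?opprK //; apply/andP; split.
  by have := atan_gtNpi2 (y / x); lra.
by rewrite -atan0; apply: le_atan; rewrite mulr_le0_ge0 ?ltW // invr_gt0.
Qed.

(** The chosen branch of the logarithm of 1 - xz has derivative -z / (1 - xz),
    computed from its real and imaginary parts. *)
Lemma cder_clog_ray z r : 0 < Re (1 - r%:C * z) ->
  cder (fun x => (ln (Re (1 - x%:C * z) ^+ 2 + Im (1 - x%:C * z) ^+ 2) / 2)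
     +i* atan (Im (1 - x%:C * z) / Re (1 - x%:C * z))) r
   (- z / (1 - r%:C * z)).
Proof.
case: z => p q u0'.
pose u (x : R) := 1 - x * p. pose v (x : R) := - (x * q).
have WE x : 1 - x%:C * (p +i* q) = u x +i* v x.
  by apply: complex_eq; rewrite /u /v /= ?mul0r; ring.
have u0 : 0 < u r by move: u0'; rewrite WE.
have du : is_derive r 1 u (- p).
  by rewrite /u; apply: is_derive_eq; rewrite /GRing.scale /=; ring.
have dv : is_derive r 1 v (- q).
  by rewrite /v; apply: is_derive_eq; rewrite /GRing.scale /=; ring.
have N0 : 0 < u r ^+ 2 + v r ^+ 2 by rewrite ltr_wpDr ?sqr_ge0 // exprn_gt0.
have uN0 : u r != 0 by rewrite gt_eqF.
have NN0 : u r ^+ 2 + v r ^+ 2 != 0 by rewrite gt_eqF.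
have -> : - (p +i* q) / (1 - r%:C * (p +i* q)) =
  ((- p * u r - q * v r) / (u r ^+ 2 + v r ^+ 2)) +i*
  ((- q * u r + p * v r) / (u r ^+ 2 + v r ^+ 2)).
  have W0 : u r +i* v r != 0.
    by apply/eqP => -[/eqP]; rewrite (negbTE uN0).
  rewrite WE; apply: (mulIf W0); rewrite divfK //.
  by apply: complex_eq; rewrite !(cReM, cImM) /=; field.
have -> : (fun x => (ln (Re (1 - x%:C * (p +i* q)) ^+ 2 +
    Im (1 - x%:C * (p +i* q)) ^+ 2) / 2)
  +i* atan (Im (1 - x%:C * (p +i* q)) / Re (1 - x%:C * (p +i* q)))) =
  (fun x => (ln (u x ^+ 2 + v x ^+ 2) / 2) +i* atan (v x / u x)).
  by apply/funext => x; rewrite WE.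
split => /=.
  have -> : (fun x => ln (u x ^+ 2 + v x ^+ 2) / 2) =
     (fun x => 2^-1 * ln (u x ^+ 2 + v x ^+ 2)) by apply/funext => x; rewrite mulrC.
  have dN : is_derive r 1 (fun x => u x ^+ 2 + v x ^+ 2)
      (2 * (u r * - p) + 2 * (v r * - q)).
    apply: is_derive_eq (is_deriveD (is_deriveX 2 du) (is_deriveX 2 dv)) _.
    by rewrite /GRing.scale /=; ring.
  have dl := @is_derive1_comp R (@ln R) (fun x => u x ^+ 2 + v x ^+ 2) r _ _
    (is_derive1_ln N0) dN.
  apply: is_derive_eq (is_deriveZ _ dl) _.
  by rewrite /GRing.scale /=; field.
have dV := is_deriveM dv (is_deriveV uN0 du).
have dl := @is_derive1_comp R atan (fun x => v x / u x) r _ _ (is_derive1_atan _) dV.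
apply: is_derive_eq dl _.
have N1 : 1 + (v r / u r) ^+ 2 != 0.
  by rewrite gt_eqF // ltr_wpDr ?sqr_ge0.
by rewrite /GRing.scale; move: (u r) (v r) uN0 NN0 N1 => U V h1 h2 h3 /=; field; rewrite h1 h2.
Qed.

End complex_derivative.

Section binomial_theorem.
Context {R : realType}.
Variables (a z : R[i]).
Hypothesis z1 : normc z < 1.

Let c n : R[i] := bcoef a n * z ^+ n.
Let dif n : R[i] := (a + n%:R) * z * c n.
(* The series converges on [-K, K] for some K > 1, so that the end 1 of the ray is
   an interior point. *)
Let K : R := 2 / (1 + normc z).

Let K0 : 0 < K.
Proof. by rewrite divr_gt0 // ltr_pwDl // normc_ge0. Qed.

Let K1 : 1 < K.
Proof.
have h : 0 < 1 + normc z by rewrite ltr_pwDl // normc_ge0.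
by rewrite /K ltr_pdivlMr // mul1r -[2]/(1 + 1) ltrD2l.
Qed.

Let Kz : normc z * K < 1.
Proof.
have h : 0 < 1 + normc z by rewrite ltr_pwDl // normc_ge0.
by rewrite mulrA ltr_pdivrMr // mul1r [ltRHS]addrC mulrDr mulr1 ltrD2l.
Qed.

Let xz (x : R) : `|x| <= K -> 0 <= normc z * `|x| < 1.
Proof.
move=> xK; rewrite mulr_ge0 ?normc_ge0 //=; apply: le_lt_trans Kz.
by rewrite ler_wpM2l ?normc_ge0.
Qed.

Let cn n (x : R) : normc (c n * (x ^+ n)%:C) <= rbcoef (normc a) n * (normc z * `|x|) ^+ n.
Proof.
rewrite /c cnormM (cnormM (bcoef a n)).
rewrite normcR normrX normcX -mulrA -exprMn.
by apply: ler_wpM2r; [rewrite exprn_ge0 ?mulr_ge0 ?normc_ge0|exact: normc_bcoef].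
Qed.

Let an n : normc (a + n%:R) <= normc a + n%:R.
Proof. by rewrite (le_trans (le_normcD _ _)) // normc_natr. Qed.

Let sc (x : R) : `|x| <= K -> csummable (fun n => c n * (x ^+ n)%:C).
Proof.
move=> xK; apply: csummable_le (cn^~ x).
exact: csummable_rbcoef (normc_ge0 a) (xz xK).
Qed.

Let sd (x : R) : `|x| <= K -> csummable (fun n => dif n * (x ^+ n)%:C).
Proof.
move=> xK; have p1 : 0 <= normc a + 1 by rewrite addr_ge0 ?normc_ge0.
apply: (cL1_le (cmeas_nat _)
  (cL1Z (normc z * normc a)%:C (csummable_rbcoef p1 (xz xK)))) => n.
have h1 : 0 <= normc z * normc a by rewrite mulr_ge0 ?normc_ge0.
have h2 : 0 <= rbcoef (normc a + 1) n * (normc z * `|x|) ^+ n.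
  by rewrite mulr_ge0 ?rbcoef_ge0 ?exprn_ge0 ?mulr_ge0 ?normc_ge0.
rewrite normcRM normcR (ger0_norm h1) (ger0_norm h2).
have -> : dif n * (x ^+ n)%:C = ((a + n%:R) * z) * (c n * (x ^+ n)%:C).
  by rewrite /dif -mulrA.
rewrite cnormM (cnormM (a + _)).
apply: (@le_trans _ _ ((normc a + n%:R) * normc z *
    (rbcoef (normc a) n * (normc z * `|x|) ^+ n))).
  apply: ler_pM; rewrite ?mulr_ge0 ?normc_ge0 //.
  by apply: ler_wpM2r; rewrite ?normc_ge0.
rewrite [leLHS](_ : _ = normc z * ((normc a + n%:R) * rbcoef (normc a) n) *
   (normc z * `|x|) ^+ n); last by ring.
by rewrite rbcoef_shift !mulrA.
Qed.

Let nc n : n.+1%:R * c n.+1 = dif n.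
Proof.
rewrite /dif /c mulrA bcoefS exprS; exact: mulrACA.
Qed.

Let nd n : n.+1%:R * dif n.+1 = (a + n.+1%:R) * z * dif n.
Proof. by rewrite -(nc n) /dif; exact: mulrCA. Qed.

Let sdd (x : R) : `|x| <= K -> csummable (fun n => n.+1%:R * dif n.+1 * (x ^+ n)%:C).
Proof.
move=> xK; set p := normc a.
have p0 : 0 <= p := normc_ge0 a.
have p2 : 0 <= p + 1 + 1 by rewrite !addr_ge0.
apply: (cL1_le (cmeas_nat _)
  (cL1Z (normc z ^+ 2 * p * (p + 1))%:C (csummable_rbcoef p2 (xz xK)))) => n.
have h1 : 0 <= normc z ^+ 2 * p * (p + 1).
  by rewrite !mulr_ge0 ?addr_ge0 ?normc_ge0.
have h2 : 0 <= rbcoef (p + 1 + 1) n * (normc z * `|x|) ^+ n.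
  by rewrite mulr_ge0 ?rbcoef_ge0 ?exprn_ge0 ?mulr_ge0 ?normc_ge0.
rewrite normcRM normcR (ger0_norm h1) (ger0_norm h2) nd.
have -> : (a + n.+1%:R) * z * dif n * (x ^+ n)%:C =
    (a + n.+1%:R) * z * ((a + n%:R) * z) * (c n * (x ^+ n)%:C).
  by rewrite /dif; ring.
rewrite cnormM !(cnormM _ z, cnormM (_ * z)).
apply: (@le_trans _ _ ((p + n.+1%:R) * normc z * ((p + n%:R) * normc z) *
    (rbcoef p n * (normc z * `|x|) ^+ n))).
  apply: ler_pM; rewrite ?mulr_ge0 ?normc_ge0 //.
  by apply: ler_pM; rewrite ?mulr_ge0 ?normc_ge0 //; apply: ler_wpM2r; rewrite ?normc_ge0.
have -> : p + n.+1%:R = p + 1 + n%:R by rewrite -addn1 natrD; ring.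
rewrite [leLHS](_ : _ = normc z ^+ 2 * ((p + 1 + n%:R) * ((p + n%:R) * rbcoef p n)) *
   (normc z * `|x|) ^+ n); last by ring.
rewrite rbcoef_shift (mulrCA _ p) rbcoef_shift.
by rewrite le_eqVlt; apply/orP; left; apply/eqP; ring.
Qed.

Let S (x : R) := csum (fun n => c n * (x ^+ n)%:C).
Let T (x : R) := csum (fun n => dif n * (x ^+ n)%:C).

Let near_eq_is_derive (f g : R -> R) (x d : R) :
  (\forall y \near x, f y = g y) -> is_derive x 1 f d -> is_derive x 1 g d.
Proof.
move=> fg [h1 h2]; split; first exact: near_eq_derivable h1.
by rewrite -h2; apply: near_eq_derive; apply: filterS fg => y ->.
Qed.

Let Spart (p : R[i] -> R) (x : R) : `|x| < K ->
  (forall u : nat -> R[i], csummable u -> series (fun n => p (u n)) @ \oo --> p (csum u)) ->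
  (forall (w : R[i]) (t : R), p (w * t%:C) = p w * t) ->
  is_derive x 1 (fun y => p (S y)) (p (T x)).
Proof.
move=> xK pc pR.
have pcn y : `|y| <= K -> series (fun n => p (c n) * y ^+ n) @ \oo --> p (S y).
  by move=> yK; have := pc _ (sc yK); under eq_fun do rewrite pR.
have pdn y : `|y| <= K -> series (fun n => p (dif n) * y ^+ n) @ \oo --> p (T y).
  by move=> yK; have := pc _ (sd yK); under eq_fun do rewrite pR.
have pE (w : R[i]) n : p (n%:R * w) = n%:R * p w.
  by rewrite mulrC -(rmorph_nat (real_complex R)) pR mulrC.
have dE : pseries_diffs (fun n => p (c n)) = (fun n => p (dif n)).
  by apply/funext => n; rewrite /pseries_diffs -pE nc.
have KK : `|K| <= K by rewrite ger0_norm // ltW.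
have d := @pseries_snd_diffs R (fun n => p (c n)) K x.
rewrite dE in d.
have TE : limn (pseries (fun n => p (dif n)) x) = p (T x).
  by apply: cvg_lim => //; apply: pdn; exact: ltW.
rewrite TE in d.
have {}d : is_derive x 1 (fun x => limn (pseries (fun n => p (c n)) x)) (p (T x)).
  apply: d.
  - by apply/cvg_ex; exists (p (S K)); exact: pcn.
  - by apply/cvg_ex; exists (p (T K)); exact: pdn.
  - apply/cvg_ex; exists (p (csum (fun n => n.+1%:R * dif n.+1 * (K ^+ n)%:C))).
    have := pc _ (sdd KK); under eq_fun do rewrite pR pE.
    by [].
  - by rewrite (gtr0_norm K0).
apply: near_eq_is_derive d.
have nK : \forall y \near x, `|y| < K.
  exact: (@cvgr_norm_lt R R^o R (nbhs x) _ id x cvg_id K xK).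
near=> y; apply: cvg_lim => //; apply: pcn; apply/ltW; near: y.
exact: nK.
Unshelve. all: by end_near. Qed.

Let Sder (x : R) : `|x| < K -> cder S x (T x).
Proof.
move=> xK; split; apply: (Spart (p := fun w => _ w)) => //.
- exact: csum_cvg_Re.
- by move=> w t; rewrite cReM /= mulr0 subr0.
- exact: csum_cvg_Im.
- by move=> w t; rewrite cImM /= mulr0 add0r.
Qed.

(* The recurrence of the binomial coefficients. *)
Let ode (x : R) : `|x| <= K -> (1 - x%:C * z) * T x = a * z * S x.
Proof.
move=> xK.
have su : csummable (fun n => x%:C * z * (dif n * (x ^+ n)%:C)) by exact: (cL1Z _ (sd xK)).
pose v n : R[i] := n%:R * (z * c n) * (x ^+ n)%:C.
have vS n : v n.+1 = x%:C * z * (dif n * (x ^+ n)%:C).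
  by rewrite /v -nc exprS rmorphM /=; ring.
have sv : csummable v by apply: csummable_cons; under eq_fun do rewrite vS.
have E1 : x%:C * z * T x = csum v.
  rewrite /T -csumZ; last exact: sd.
  rewrite (csum_shift (u := v)); last by rewrite /v !mul0r.
  by congr csum; apply/funext => n; rewrite vS.
rewrite mulrBl mul1r E1 /S -csumZ; last exact: sc.
rewrite /T /csum -cintB //; last exact: sd.
congr cint; apply/funext => n; rewrite /dif /v; ring.
Qed.

(** Along the ray from 0 to z, the product of the series with (1 - rz)^a has
    zero derivative. *)
Theorem binomial_series :
  csummable (fun n => bcoef a n * z ^+ n) /\
  csum (fun n => bcoef a n * z ^+ n) = cpow (1 - z) (- a).
Proof.
have K11 : `|1| <= K by rewrite normr1 (ltW K1).
split; first by have := sc K11; under eq_fun do rewrite expr1n mulr1.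
have W0 (r : R) : 0 <= r <= 1 -> 0 < Re (1 - r%:C * z).
  move=> /andP[r0 r1]; rewrite cReD cReN cReM /= mul0r subr0 subr_gt0.
  apply: (le_lt_trans _ z1); apply: (le_trans (ler_norm _)).
  rewrite normrM (ger0_norm r0) (le_trans (ler_piMl _ r1)) //.
  exact: normr_Re_le.
pose L (x : R) : R[i] :=
  (ln (Re (1 - x%:C * z) ^+ 2 + Im (1 - x%:C * z) ^+ 2) / 2)
     +i* atan (Im (1 - x%:C * z) / Re (1 - x%:C * z)).
have := @cder0_cst R (fun x => S x * cexp (a * L x)) 0 1 ltr01.
have W1 (r : R) : 0 <= r <= 1 -> 1 - r%:C * z != 0.
  by move=> /W0; apply: contraTneq => ->; rewrite ltxx.
move=> /(_ _) H; have {}H : S 0 * cexp (a * L 0) = S 1 * cexp (a * L 1).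
  apply: H => r r01.
  have rK : `|r| < K.
    by case/andP: r01 => r0 r1; rewrite ger0_norm // (le_lt_trans r1 K1).
  have d1 := cderM (Sder rK) (cder_cexp (cderZ a (cder_clog_ray (W0 r r01)))).
  have E : T r * cexp (a * L r) + S r * (a * (- z / (1 - r%:C * z)) * cexp (a * L r)) = 0.
    have -> : T r = a * z * S r / (1 - r%:C * z).
      by rewrite -(ode (ltW rK)) mulrC mulKf // W1.
    by move: (cexp _) => X; field; exact: W1.
  by rewrite E in d1.
have S0 : S 0 = 1.
  rewrite /S csum_single0 => [|n]; first by rewrite /c bcoef0 !expr0 rmorph1 !mulr1.
  by rewrite expr0n /= mulr0.
have L0 : L 0 = 0.
  rewrite /L mul0r subr0 /= expr1n expr0n /= addr0 ln1 mul0r divr1 atan0 //.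
have L1 : L 1 = clog (1 - z).
  have w0 : 0 < Re (1 - z) by have := W0 1; rewrite mul1r; apply; rewrite ler01 lexx.
  by rewrite /L mul1r clog_right.
move: H; rewrite S0 L0 mulr0 cexp0 mulr1 L1 /S.
under eq_fun do rewrite expr1n mulr1.
move=> H; rewrite /cpow ifN.
  by rewrite mulNr cexpN; apply: (mulIf (cexp_neq0 (a * clog (1 - z))));
     rewrite -H mulVf // cexp_neq0.
by have := W1 1; rewrite mul1r; apply; rewrite ler01 lexx.
Qed.

End binomial_theorem.

(** * Power series and analytic continuation along the real axis *)

Section power_series.
Context {R : realType}.
Implicit Types (c : nat -> R[i]) (g : R -> R[i]) (s r h x : R).

(** The expansion converges absolutely on the closed interval of radius [r]
    around [s], which makes the class stable under products without loss of
    radius. *)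
Definition pwr g s r := exists2 c, csummable (fun n => c n * (r ^+ n)%:C) &
  forall h, `|h| <= r -> g (s + h) = csum (fun n => c n * (h ^+ n)%:C).

Lemma csummable_pwr c r h : csummable (fun n => c n * (r ^+ n)%:C) -> `|h| <= r ->
  csummable (fun n => c n * (h ^+ n)%:C).
Proof.
move=> sc hr; apply: (cL1_le (cmeas_nat _) sc) => n.
rewrite cnormM [leRHS]cnormM !normcR.
rewrite ler_wpM2l ?normc_ge0 // !normrX lerXn2r ?nnegrE //.
by rewrite (le_trans hr) // ler_norm.
Qed.

Lemma csum_cons0 (v : nat -> R[i]) k :
  csum (fun n => if (k <= n)%N then v (n - k)%N else 0) = csum v.
Proof.
elim: k v => [|k IH] v; first by congr csum; apply/funext => n; rewrite subn0.
by rewrite csum_shift // -[RHS]IH; congr csum; apply/funext => n; rewrite ltnS subSS.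
Qed.

Lemma nsum_cons0 (v : nat -> R[i]) k :
  nsum (fun n => if (k <= n)%N then v (n - k)%N else 0) = nsum v.
Proof.
elim: k v => [|k IH] v; first by congr nsum; apply/funext => n; rewrite subn0.
by rewrite nsum_recl normc_0 add0e -[RHS]IH; congr nsum; apply/funext.
Qed.

(** A power series that vanishes on [0, r] is zero: its first nonzero
    coefficient would dominate near 0. *)
Lemma pwr_identity c r : 0 < r -> csummable (fun n => c n * (r ^+ n)%:C) ->
  (forall h, 0 <= h <= r -> csum (fun n => c n * (h ^+ n)%:C) = 0) ->
  forall n, c n = 0.
Proof.
move=> r0 sc c0 n; elim/ltn_ind: n => j IH.
apply/eqP; rewrite -normc_eq0; apply: contrapT => /negP cj.
have {}cj : 0 < normc (c j) by rewrite lt_def cj normc_ge0.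
have sj := csummable_drop j.+1 sc.
have finM : nsum (fun k => c (j.+1 + k)%N * (r ^+ (j.+1 + k))%:C) \is a fin_num.
  by rewrite ge0_fin_numE ?cmass_ge0 //; exact: sj.2.
pose M := fine (nsum (fun k => c (j.+1 + k)%N * (r ^+ (j.+1 + k))%:C)).
have M0 : 0 <= M by rewrite fine_ge0 // cmass_ge0.
have key h : 0 < h <= r -> normc (c j) * r ^+ j.+1 <= h * M.
  move=> /andP[h0 hr].
  have hr' : `|h| <= r by rewrite gtr0_norm.
  have sh := csummable_pwr sc hr'.
  have := c0 h; rewrite (ltW h0) hr => /(_ isT).
  rewrite (csum_split j.+1 sh) big_ord_recr /= big1 => [|i _]; last first.
    by rewrite IH // mul0r.
  rewrite add0r => /eqP; rewrite addr_eq0 => /eqP E.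
  have q0 : 0 <= (h / r) ^+ j.+1 by rewrite exprn_ge0 // divr_ge0 // ltW.
  have : normc (c j * (h ^+ j)%:C) <= (h / r) ^+ j.+1 * M.
    rewrite E normcN -lee_fin EFinM fineK //.
    apply: (le_trans (normc_cint (csummable_drop j.+1 sh))).
    have -> : ((h / r) ^+ j.+1)%:E = (normc ((h / r) ^+ j.+1)%:C)%:E :> \bar R.
      by rewrite normcR ger0_norm.
    rewrite /nsum /cmass -ge0_integralZl //; last first.
    - by rewrite lee_fin normc_ge0.
    - by move=> k _; rewrite lee_fin normc_ge0.
    apply: ge0_le_integral => //.
    - by move=> k _; rewrite lee_fin normc_ge0.
    - move=> k _; rewrite -EFinM lee_fin -cnormM.
      rewrite mulrCA cnormM [leRHS]cnormM.
      rewrite ler_wpM2l ?normc_ge0 // -rmorphM !normcR ger0_norm ?exprn_ge0 ?(ltW h0) //.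
      rewrite ger0_norm ?mulr_ge0 ?exprn_ge0 ?divr_ge0 ?(ltW h0) ?(ltW r0) //.
      rewrite !exprD mulrA -exprMn divfK ?gt_eqF //.
      apply: ler_wpM2l; first by rewrite exprn_ge0 // ltW.
      by rewrite lerXn2r ?nnegrE ?(ltW h0) ?(ltW r0).
  rewrite cnormM normcR ger0_norm ?exprn_ge0 ?(ltW h0) //.
  rewrite expr_div_n => H.
  have hj : 0 < h ^+ j by rewrite exprn_gt0.
  have rj : 0 < r ^+ j.+1 by rewrite exprn_gt0.
  rewrite -(ler_pM2r hj).
  have -> : h * M * h ^+ j = h ^+ j.+1 / r ^+ j.+1 * M * r ^+ j.+1.
    by rewrite exprS; move: (r ^+ j.+1) rj => q q0'; field; rewrite gt_eqF.
  by rewrite mulrAC ler_pM2r.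
pose e := normc (c j) * r ^+ j.+1.
have e0 : 0 < e by rewrite mulr_gt0 // exprn_gt0.
have M1 : 0 < M + 1 by rewrite ltr_wpDl.
have b0 : 0 < e / (2 * (M + 1)) by rewrite divr_gt0 // mulr_gt0.
have half : e / (2 * (M + 1)) * M <= e / 2.
  have -> : e / 2 = e / (2 * (M + 1)) * (M + 1) by field; rewrite gt_eqF.
  by rewrite ler_wpM2l ?(ltW b0) // lerDl.
have [rb|rb] := leP r (e / (2 * (M + 1))).
  have := key r; rewrite r0 lexx => /(_ isT); rewrite -/e => H.
  have : r * M <= e / (2 * (M + 1)) * M by rewrite ler_wpM2r.
  lra.
have := key (e / (2 * (M + 1))); rewrite b0 (ltW rb) => /(_ isT); rewrite -/e => H.
lra.
Qed.

Lemma pwrB g1 g2 s r : pwr g1 s r -> pwr g2 s r -> pwr (fun x => g1 x - g2 x) s r.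
Proof.
move=> [c1 s1 h1] [c2 s2 h2]; exists (fun n => c1 n - c2 n).
  by under eq_fun do rewrite mulrBl; apply: cL1D => //; exact: cL1N.
move=> h hr; rewrite h1 // h2 // /csum -cintB; [|exact: csummable_pwr s1 hr|exact: csummable_pwr s2 hr].
by congr cint; apply/funext => n; rewrite mulrBl.
Qed.

Lemma pwr_zero g s r : 0 < r -> pwr g s r -> (forall x, s <= x <= s + r -> g x = 0) ->
  forall x, s - r <= x <= s + r -> g x = 0.
Proof.
move=> r0 [c sc gc] g0 x /andP[x1 x2].
have hx : `|x - s| <= r by rewrite ler_norml; apply/andP; split; lra.
have c0 n : c n = 0.
  apply: (pwr_identity r0 sc) => h /andP[h0 hr].
  rewrite -gc; last by rewrite ger0_norm.
  by apply: g0; rewrite lerDl h0 lerD2l.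
have -> : x = s + (x - s) by ring.
by rewrite gc // csum0 // => n; rewrite c0 mul0r.
Qed.

End power_series.

(** Superposition: an integral of power series with summable majorant is again
    a power series. *)
Section superposition.
Context d (T : measurableType d) (R : realType).
Variable m : {sigma_finite_measure set T -> \bar R}.
Variables (c : T * nat -> R[i]) (g : R -> R[i]) (s r : R).
Hypotheses (r0 : 0 < r) (mc : forall n, cmeas (fun x => c (x, n))).
Hypothesis fin : (\int[m]_x nsum (fun n => (c (x, n) * (r ^+ n)%:C)%R) < +oo)%E.
Hypothesis gE : forall h, `|h| <= r ->
  g (s + h) = cint m (fun x => csum (fun n => c (x, n) * (h ^+ n)%:C)).

Let F (h : R) (p : T * nat) := c p * (h ^+ p.2)%:C.

Let mF h : cmeas (F h).
Proof. by apply: cmeas_prod_nat => n; apply: cmeasM => //; exact: cmeas_cst. Qed.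

Let finF h : `|h| <= r ->
  (\int[m]_x cmass (@counting nat R) (fun n => F h (x, n)) < +oo)%E.
Proof.
move=> hr; apply: le_lt_trans fin; apply: ge0_le_integral => //.
- by move=> x _; exact: cmass_ge0.
- apply: (@measurable_fun_fubini_tonelli_F _ _ T nat R (@counting nat R)
      (fun p => (normc (F h p))%:E)) => //; first exact: emeasurable_normc.
  by move=> p; rewrite lee_fin normc_ge0.
- apply: (@measurable_fun_fubini_tonelli_F _ _ T nat R (@counting nat R)
      (fun p => (normc (F r p))%:E)) => //; first exact: emeasurable_normc.
  by move=> p; rewrite lee_fin normc_ge0.
- move=> x _; apply: le_cmass; [exact: cmeas_nat|exact: cmeas_nat|move=> n].
  rewrite /F cnormM [leRHS]cnormM !normcR.
  rewrite ler_wpM2l ?normc_ge0 // !normrX lerXn2r ?nnegrE //.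
  by rewrite (le_trans hr) // ler_norm.
Qed.

Let rr : `|r| <= r. Proof. by rewrite gtr0_norm. Qed.

Let termfin (h : nat -> \bar R) n : (forall n, 0 <= h n)%E ->
  (\int[@counting nat R]_n h n < +oo)%E -> (h n < +oo)%E.
Proof.
elim: n h => [|n IH] h h0; rewrite nat_integral_recl // => lt.
  by apply: le_lt_trans lt; rewrite leeDl // integral_ge0.
apply: (IH (fun n => h n.+1)) => //; apply: le_lt_trans lt.
by rewrite leeDr.
Qed.

Let massZ n (w : R[i]) : (cmass m (fun x => (c (x, n) * w)%R) =
   (normc w)%:E * cmass m (fun x => c (x, n)))%E.
Proof.
rewrite /cmass -ge0_integralZl //.
- by apply: eq_integral => x _; rewrite mulrC cnormM.
- exact: emeasurable_normc.
- by move=> x _; rewrite lee_fin normc_ge0.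
- by rewrite lee_fin normc_ge0.
Qed.

Let cn n : cL1 m (fun x => c (x, n)).
Proof.
split=> //; have := finF rr; rewrite (cmass_swap m (@counting nat R) (mF r)) => lt.
have := termfin n (fun n => cmass_ge0 m (fun x => F r (x, n))) lt.
have rn : 0 < normc (r ^+ n)%:C by rewrite normcR gtr0_norm exprn_gt0.
rewrite /F /= massZ; move: (cmass_ge0 m (fun x => c (x, n))).
case: (cmass m (fun x => c (x, n))) => [a||] //; first by rewrite !ltry.
by rewrite gt0_muley // lte_fin.
Qed.

Lemma pwr_superposition : pwr g s r.
Proof.
exists (fun n => cint m (fun x => c (x, n))).
  split; first exact: cmeas_nat.
  have := finF rr; rewrite (cmass_swap m (@counting nat R) (mF r)); apply: le_lt_trans.
  apply: ge0_le_integral => //.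
  - by move=> n _; rewrite lee_fin normc_ge0.
  - move=> n _; rewrite /F /= massZ mulrC cnormM EFinM.
    by rewrite lee_pmul ?lee_fin ?normc_ge0 //; exact: normc_cint.
move=> h hr; rewrite gE //.
have := cint_swap (mF h) (finF hr); rewrite /csum /F /= => ->.
congr cint; apply/funext => n; rewrite mulrC -cintZ //.
by congr cint; apply/funext => x; rewrite mulrC.
Qed.

End superposition.

Section product.
Context {R : realType}.
Implicit Types (g : R -> R[i]) (s r h : R).

(** The Cauchy product, obtained by superposing the shifted series of the
    second factor. *)
Lemma pwrM g1 g2 s r : 0 < r -> pwr g1 s r -> pwr g2 s r ->
  pwr (fun x => g1 x * g2 x) s r.
Proof.
move=> r0 [a sa ga] [b sb gb].
pose c (p : nat * nat) := if (p.1 <= p.2)%N then a p.1 * b (p.2 - p.1)%N else 0.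
have shiftE i h : (fun n => c (i, n) * (h ^+ n)%:C) =
   (fun n => if (i <= n)%N then (a i * (h ^+ i)%:C) * (b (n - i)%N * (h ^+ (n - i))%:C) else 0).
  apply/funext => n; rewrite /c /=; case: leqP => // ni; last by rewrite mul0r.
  have -> : h ^+ n = h ^+ i * h ^+ (n - i) by rewrite -exprD subnKC.
  by rewrite rmorphM; exact: mulrACA.
apply: (@pwr_superposition _ nat R (@counting nat R) c) => //.
- have -> : (fun i => nsum (fun n => (c (i, n) * (r ^+ n)%:C)%R)) =
    (fun i => (normc (a i * (r ^+ i)%:C))%:E * nsum (fun n => (b n * (r ^+ n)%:C)%R))%E.
    apply/funext => i; rewrite shiftE.
    rewrite (nsum_cons0 (fun n => a i * (r ^+ i)%:C * (b n * (r ^+ n)%:C))).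
    rewrite /nsum /cmass -ge0_integralZl //.
    + by apply: eq_integral => n _; rewrite -EFinM -cnormM.
    + by move=> n _; rewrite lee_fin normc_ge0.
    + by rewrite lee_fin normc_ge0.
  have fb : nsum (fun n => b n * (r ^+ n)%:C) \is a fin_num.
    by rewrite ge0_fin_numE ?cmass_ge0 //; exact: sb.2.
  rewrite ge0_integralZr ?cmass_ge0 //; last by move=> n _; rewrite lee_fin normc_ge0.
  rewrite lte_mul_pinfty ?cmass_ge0 //; last exact: sb.2.
  by rewrite ge0_fin_numE ?cmass_ge0 //; exact: sa.2.
move=> h hr; rewrite ga // gb // mulrC -csumZ; last exact: csummable_pwr sa hr.
congr cint; apply/funext => i; rewrite shiftE.
rewrite (csum_cons0 (fun n => a i * (h ^+ i)%:C * (b n * (h ^+ n)%:C))).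
rewrite csumZ; last exact: csummable_pwr sb hr.
exact: mulrC.
Qed.

End product.

Section laplace_power_series.
Context {R : realType}.
Local Notation mu := (@lebesgue_measure R).
Implicit Types (f : R -> R[i]) (s r h x t : R).

Lemma nsum_exp x : nsum (fun n => (x ^+ n / n`!%:R)%:C) = (expR `|x|)%:E.
Proof.
rewrite -(@nsum_nneg R (exp_coeff `|x|) (expR `|x|)).
- apply: eq_integral => n _; rewrite !normcR /exp_coeff /= normrM normrX.
  by rewrite normfV normr_nat normrM normfV normr_nat normrX normr_id.
- by move=> n; exact: exp_coeff_ge0.
- exact: is_cvg_series_exp_coeff.
Qed.

Lemma csummable_exp x : csummable (fun n => (x ^+ n / n`!%:R)%:C).
Proof. by split; [exact: cmeas_nat|rewrite -/(nsum _) nsum_exp ltry]. Qed.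

Lemma csum_exp x : csum (fun n => (x ^+ n / n`!%:R)%:C) = (expR x)%:C.
Proof.
apply: complex_eq => /=.
  have h1 := csum_cvg_Re (csummable_exp x).
  have h2 : series (exp_coeff x) @ \oo --> expR x by exact: is_cvg_series_exp_coeff.
  exact: (cvg_unique _ h1 h2).
by rewrite /Rintegral integral0.
Qed.

(** Expand exp(- h t) under the integral; the majorant exp(r t) costs [r] of the
    abscissa of convergence. *)
Lemma pwr_laplace f s0 s r : causal f -> lapL1 f s0 -> 0 < r -> s0 <= s - r ->
  pwr (laplace f) s r.
Proof.
move=> cf hf r0 sr; have mf := lapL1_cmeas hf.
pose c (p : R * nat) := eweight s p.1 * f p.1 * ((- p.1) ^+ p.2 / p.2`!%:R)%:C.
have cE t n h : c (t, n) * (h ^+ n)%:C =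
    eweight s t * f t * ((- (h * t)) ^+ n / n`!%:R)%:C.
  rewrite /c -mulrA -rmorphM /=; congr (_ * _%:C).
  by rewrite -mulrN (mulrC h) exprMn_comm; [ring|exact: mulrC].
have mp (k : R) n : measurable_fun setT (fun t : R => (k * t) ^+ n / n`!%:R).
  apply: measurable_funM; last exact: measurable_cst.
  by apply: measurable_funX; apply: measurable_funM; [exact: measurable_cst|exact: measurable_id].
apply: (@pwr_superposition _ (measurableTypeR R) R mu c) => //.
- move=> n; apply: cmeasM; first by apply: cmeasM => //; exact: cmeas_eweight.
  by apply: cmeas_real; have := mp (-1) n; under eq_fun do rewrite mulN1r.
- apply: le_lt_trans hf.2; apply: ge0_le_integral => //.
  + by move=> t _; exact: cmass_ge0.
  + apply: (@measurable_fun_fubini_tonelli_F _ _ (measurableTypeR R) nat R (@counting nat R)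
      (fun p => (normc (c p * (r ^+ p.2)%:C))%:E)); last first.
      by move=> p; rewrite lee_fin normc_ge0.
    apply: emeasurable_normc; apply: cmeas_prod_nat => n; under eq_fun do rewrite cE.
    apply: cmeasM; first by apply: cmeasM => //; exact: cmeas_eweight.
    by apply: cmeas_real; have := mp (- r) n; under eq_fun do rewrite mulNr.
  + exact: (emeasurable_normc hf.1).
  + move=> t _; under [X in nsum X]eq_fun do rewrite cE.
    have [t0|t0] := leP t 0.
      rewrite cf // !mulr0 normc_0 /nsum /cmass integral0_eq // => n _.
      by rewrite mul0r normc_0.
    rewrite [nsum _](_ : _ = ((normc (eweight s t * f t))%:E * (expR `|- (r * t)|)%:E)%E).
      rewrite -EFinM lee_fin normrN gtr0_norm ?mulr_gt0 //.
      rewrite cnormM [leRHS]cnormM !normc_eweight.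
      rewrite mulrAC ler_wpM2r ?normc_ge0 // -expRD ler_expR.
      have : s0 * t <= (s - r) * t by rewrite ler_wpM2r // ltW.
      by rewrite mulrBl; lra.
    rewrite -nsum_exp /nsum /cmass -ge0_integralZl //.
    * by apply: eq_integral => n _; rewrite cnormM.
    * by move=> n _; rewrite lee_fin normc_ge0.
    * by rewrite lee_fin normc_ge0.
move=> h hr; congr cint; apply/funext => t; under [X in csum X]eq_fun do rewrite cE.
rewrite csumZ; last exact: csummable_exp.
rewrite csum_exp /eweight mulrDl opprD expRD rmorphM.
by rewrite -!mulrA; congr (_ * _); exact: mulrC.
Qed.

End laplace_power_series.

Section symbol_power_series.
Context {R : realType}.
Local Notation mu := (@lebesgue_measure R).
Variables (A B : R[i]) (beta : nat -> R[i]) (s0 rho : R).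
Hypotheses (A0 : 0 < Re A) (B0 : 0 < Re B) (s00 : 0 < s0) (rho1 : 1 < rho).
Hypothesis slack : csummable (fun n => beta n * cpow s0%:C (- expo A B n) * (rho ^+ n)%:C).
Implicit Types (s r h x : R).

Lemma powR_ge1 (x p : R) : 1 <= x -> 0 <= p -> 1 <= x `^ p.
Proof. by move=> x1 p0; rewrite -[leLHS](powRr0 x); apply: ler_powR. Qed.

Lemma nsum_rbcoef p x : 0 <= p -> 0 <= x < 1 ->
  nsum (fun n => (rbcoef p n * x ^+ n)%:C) = ((1 - x) `^ (- p))%:E.
Proof.
move=> p0 x01; have sx := csummable_rbcoef p0 x01; have /andP[x0 x1] := x01.
have xn : normc x%:C < 1 by rewrite normcR ger0_norm.
have [_] := binomial_series p%:C xn.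
have -> : (fun n => bcoef p%:C n * x%:C ^+ n) = (fun n => (rbcoef p n * x ^+ n)%:C).
  by apply/funext => n; rewrite bcoef_real -rmorphXn -rmorphM.
rewrite -(rmorph1 (real_complex R)) -rmorphB -rmorphN cpow_powR ?subr_gt0 // => -[E _].
rewrite -E /Rintegral fineK.
  by apply: eq_integral => n _; rewrite normcR ger0_norm // mulr_ge0 ?rbcoef_ge0 ?exprn_ge0.
by apply: integrable_fin_num => //; exact: (cL1_Re sx).
Qed.

(** Each power is a binomial series around [s], with majorant
    (1 - r/s)^(- |z_n|); the geometric slack [rho] pays for the growth of |z_n|. *)
Lemma pwr_symbol s r : s0 <= s -> 0 < r -> r < s -> (1 - r / s) `^ (- normc A) <= rho ->
  pwr (symbol A B beta) s r.
Proof.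
move=> ss0 r0 rs rhoA; have s1 : 0 < s := lt_le_trans s00 ss0.
pose z n := expo A B n.
pose c (p : nat * nat) := beta p.1 * cpow s%:C (- z p.1) * (bcoef (z p.1) p.2 * ((- s^-1) ^+ p.2)%:C).
have cE n j h : c (n, j) * (h ^+ j)%:C =
    beta n * cpow s%:C (- z n) * (bcoef (z n) j * (- h / s)%:C ^+ j).
  rewrite /c -mulrA; congr (_ * _); rewrite -mulrA; congr (_ * _).
  by rewrite -rmorphM -rmorphXn /= -exprMn; congr (_ ^+ _)%:C; ring.
have hs h : `|h| <= r -> normc (- h / s)%:C < 1.
  move=> hr; rewrite normcR normrM normrN normfV (gtr0_norm s1) ltr_pdivrMr // mul1r.
  exact: le_lt_trans hr rs.
pose x := r / s; have x01 : 0 <= x < 1.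
  by rewrite divr_ge0 ?ltW //= ltr_pdivrMr // mul1r.
have y0 : 0 < 1 - x by rewrite subr_gt0; case/andP: x01.
have x0 : 0 <= x by case/andP: x01.
pose D := (1 - x) `^ (- normc B).
apply: (@pwr_superposition _ nat R (@counting nat R) c) => //.
- apply: le_lt_trans (cL1Z D%:C slack).2; apply: ge0_le_integral => //.
  + by move=> n _; exact: cmass_ge0.
  + move=> n _; under [X in nsum X]eq_fun do rewrite cE.
    apply: (@le_trans _ _ ((normc (beta n * cpow s%:C (- z n)))%:E *
        nsum (fun j => (rbcoef (normc (z n)) j * x ^+ j)%:C))%E).
      rewrite /nsum /cmass -ge0_integralZl //; last first.
      * by rewrite lee_fin normc_ge0.
      * by move=> j _; rewrite lee_fin normc_ge0.
      apply: ge0_le_integral => //.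
      * by move=> j _; rewrite lee_fin normc_ge0.
      * move=> j _; rewrite -EFinM lee_fin cnormM.
        rewrite ler_wpM2l ?normc_ge0 // (cnormM (bcoef _ _)).
        rewrite normcX !normcR (@ger0_norm _ (rbcoef _ _ * _)); last first.
          by rewrite mulr_ge0 ?rbcoef_ge0 ?exprn_ge0 ?normc_ge0.
        rewrite normrM normrN normfV (gtr0_norm s1) (gtr0_norm r0).
        apply: ler_wpM2r; last exact: normc_bcoef.
        by rewrite exprn_ge0.
    rewrite nsum_rbcoef ?normc_ge0 // -EFinM lee_fin normcRM.
    rewrite ger0_norm ?powR_ge0 // !(cnormM (beta n)).
    rewrite (cnormM (beta n * _)) (cnormM (beta n)).
    rewrite !normc_cpow // normcR (ger0_norm (exprn_ge0 _ (ltW (lt_trans ltr01 rho1)))).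
    rewrite -!mulrA [leRHS]mulrCA ler_wpM2l ?normc_ge0 // [leRHS]mulrCA.
    apply: ler_pM; rewrite ?powR_ge0 //.
      rewrite /powR !gt_eqF // ler_expR cReN.
      rewrite ler_wnM2l ?oppr_le0 ?(ltW (Re_expo_gt0 A0 B0 n)) //.
      by rewrite ler_ln ?posrE.
    apply: (@le_trans _ _ ((1 - x) `^ (- (normc A * n%:R + normc B)))).
      apply: ger_powR; first by rewrite y0 /= gerBl.
      rewrite lerN2 (le_trans (le_normcD _ _)) // lerD2r.
      by rewrite cnormM normc_natr.
    rewrite opprD powRD ?(gt_eqF y0) ?implybT // mulrC ler_wpM2l ?powR_ge0 //.
    rewrite -(mulNr (normc A)) powRrM powR_mulrn ?powR_ge0 // lerXn2r ?nnegrE ?powR_ge0 //.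
    by rewrite ltW // (lt_trans ltr01 rho1).
move=> h hr; rewrite /symbol; congr cint; apply/funext => n.
under [X in csum X]eq_fun do rewrite cE.
have [sb bE] := binomial_series (z n) (hs h hr).
rewrite csumZ // bE -mulrA; congr (_ * _).
have h1 : 0 < 1 + h / s.
  have : `|h / s| < 1 by have := hs h hr; rewrite normcR mulNr normrN.
  by rewrite ltr_norml => /andP[]; lra.
have -> : 1 - (- h / s)%:C = (1 + h / s)%:C.
  by rewrite -(rmorph1 (real_complex R)) -rmorphB /= mulNr opprK.
rewrite -cpow_mul //; congr (cpow _%:C _).
by rewrite mulrDr mulr1 mulrC divfK // gt_eqF.
Qed.

(** The geometric loss in [gamma_ratio] is compensated by a larger abscissa,
    since s^(- Re z_n) decays geometrically in n with a ratio tending to 0. *)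
Lemma kernel_summable_large : exists2 S, s0 <= S &
  forall s, S <= s -> kernel_summable A B beta s.
Proof.
have [C [D [C0 D0 HG]]] := gamma_ratio A0 B0.
pose S := s0 * (Num.max 1 C) `^ (Re A)^-1.
have M1 : 1 <= Num.max 1 C by rewrite le_max lexx.
have S0 : s0 <= S.
  by rewrite /S ler_peMr ?(ltW s00) // powR_ge1 // invr_ge0 ltW.
have Sgt0 : 0 < S := lt_le_trans s00 S0.
exists S => // s Ss; have s1 : 0 < s := lt_le_trans Sgt0 Ss.
apply: (cL1_le (cmeas_nat _) (cL1Z D%:C slack)) => n.
have zn := Re_expo_gt0 A0 B0 n.
have Gn : 0 < normc (cGamma (expo A B n)) by rewrite normc_gt0 cGamma_neq0.
rewrite mulrC normcRM normcRM [leRHS]mulrC (ger0_norm (ltW D0)).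
rewrite (cnormM (beta n * _)) (cnormM (beta n) (cpow _ _)).
rewrite normc_cpow // normcR cReN.
rewrite /kcoef normc_div.
rewrite !ger0_norm ?mulr_ge0 ?powR_ge0 ?rGamma_ge0 ?exprn_ge0 //; last first.
  by rewrite ltW // (lt_trans ltr01 rho1).
have H := HG n.
rewrite -/(expo A B n) in H.
set x := Re (expo A B n) in H *.
have sx : s `^ (- x) * C ^+ n <= s0 `^ (- x) * rho ^+ n.
  have q0 : 0 < s / s0 by rewrite divr_gt0.
  have sE : s `^ (- x) = s0 `^ (- x) * (s / s0) `^ (- x).
    rewrite -powRM ?(ltW s00) ?(ltW q0) //; congr (_ `^ _).
    by rewrite mulrC divfK // gt_eqF.
  have qM : (Num.max 1 C) `^ (Re A)^-1 <= s / s0.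
    by rewrite ler_pdivlMr // mulrC.
  have q1 : 1 <= s / s0.
    by rewrite ler_pdivlMr // mul1r (le_trans S0).
  have qC : C <= (s / s0) `^ (Re A).
    apply: (@le_trans _ _ (Num.max 1 C)); first by rewrite le_max lexx orbT.
    have -> : Num.max 1 C = ((Num.max 1 C) `^ (Re A)^-1) `^ (Re A).
      by rewrite -powRrM mulVf ?gt_eqF // powRr1 // (le_trans ler01).
    by rewrite ge0_ler_powR ?nnegrE ?powR_ge0 ?(ltW A0) ?(ltW q0).
  rewrite sE -mulrA ler_wpM2l ?powR_ge0 //.
  apply: (@le_trans _ _ 1); last by rewrite exprn_ege1 // ltW.
  rewrite powRN ler_pdivrMl ?powR_gt0 // mulr1 /x Re_expo.
  rewrite powRD ?(gt_eqF q0) ?implybT // powRrM powR_mulrn ?powR_ge0 //.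
  apply: (@le_trans _ _ (((s / s0) `^ Re A) ^+ n)).
    by rewrite lerXn2r ?nnegrE ?powR_ge0 ?(ltW C0).
  by rewrite ler_peMr ?exprn_ge0 ?powR_ge0 // powR_ge1 // ltW.
apply: (@le_trans _ _ ((D * C ^+ n * normc (cGamma (expo A B n))) * s `^ (- x) *
    (normc (beta n) / normc (cGamma (expo A B n))))).
  apply: ler_wpM2r; first by rewrite divr_ge0 ?normc_ge0.
  by apply: ler_wpM2r; rewrite ?powR_ge0.
have -> : D * C ^+ n * normc (cGamma (expo A B n)) * s `^ (- x) *
    (normc (beta n) / normc (cGamma (expo A B n))) =
    normc (beta n) * (s `^ (- x) * C ^+ n) * D.
  move: (normc (cGamma _)) Gn => G G0; move: (C ^+ n) (s `^ (- x)) (normc (beta n)) => p q w.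
  by field; rewrite gt_eqF.
apply: ler_wpM2r; first exact: ltW.
by rewrite -mulrA; apply: ler_wpM2l; first exact: normc_ge0.
Qed.

(** The convolution equation gives the product formula for large [s], where the
    transform of the kernel converges; both sides being power series around every
    point of the half-line [s0, +oo[, with radius proportional to the centre,
    finitely many re-expansions carry the identity down to [s0]. *)
Theorem laplace_continuation (a b : R -> R[i]) :
  causal a -> causal b -> lapL1 a s0 -> lapL1 b s0 ->
  a = conv (kernel A B beta) b ->
  laplace a s0 = symbol A B beta s0 * laplace b s0.
Proof.
move=> ca cb ha hb aE.
pose W s := laplace a s - symbol A B beta s * laplace b s.
suff : W s0 = 0 by move/eqP; rewrite subr_eq0 => /eqP.
have AN0 : 0 < normc A.
  by apply: lt_le_trans A0 _; exact: Re_le_normc.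
have [S S0 KS] := kernel_summable_large.
have Sgt0 : 0 < S := lt_le_trans s00 S0.
have large s : S <= s -> W s = 0.
  move=> Ss; have s1 : 0 < s := lt_le_trans Sgt0 Ss; have ks := KS s Ss.
  have lb := lapL1_le cb (le_trans S0 Ss) hb.
  have [_ E] := laplace_conv (lapL1_kernel A0 B0 s1 ks) lb.
  by rewrite /W aE E (laplace_kernel A0 B0 s1 ks) subrr.
pose tau := rho `^ (- (normc A)^-1).
have rho0 : 0 < rho := lt_trans ltr01 rho1.
have tau0 : 0 < tau by rewrite powR_gt0.
have tau1 : tau < 1.
  rewrite /tau powRN invf_lt1 ?powR_gt0 //.
  by rewrite /powR gt_eqF // -expR0 ltr_expR mulr_gt0 ?invr_gt0 // ln_gt0.
have tauA : tau `^ (- normc A) = rho.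
  by rewrite /tau -powRrM mulNr mulrN opprK mulVf ?gt_eqF // powRr1 // ltW.
have step n s : s0 <= s -> S * tau ^+ n <= s -> W s = 0.
  elim: n s => [|n IH] s ss Sn; first by apply: large; rewrite expr0 mulr1 in Sn.
  have s1 : 0 < s := lt_le_trans s00 ss.
  pose s2 := s / tau; have s20 : 0 < s2 by rewrite divr_gt0.
  have ss2 : s < s2 by rewrite ltr_pdivlMr // gtr_pMr.
  pose r := s2 - s; have r0 : 0 < r by rewrite subr_gt0.
  have S2 : S * tau ^+ n <= s2 by rewrite ler_pdivlMr // -mulrA -exprSr.
  have rE : 1 - r / s2 = tau.
    by rewrite /r mulrBl divff ?gt_eqF // opprB addrCA subrr addr0 /s2 invfM invrK mulrA divff ?mul1r // gt_eqF.
  have p1 : pwr (laplace a) s2 r by apply: (pwr_laplace ca ha) => //; rewrite /r; lra.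
  have p2 : pwr (laplace b) s2 r by apply: (pwr_laplace cb hb) => //; rewrite /r; lra.
  have p3 : pwr (symbol A B beta) s2 r.
    apply: pwr_symbol => //; [exact: le_trans ss (ltW ss2)|by rewrite /r; lra|].
    by rewrite rE tauA.
  apply: (pwr_zero r0 (pwrB p1 (pwrM r0 p3 p2))).
    move=> y /andP[y1 _]; apply: IH; last exact: le_trans y1.
    exact: le_trans (le_trans ss (ltW ss2)) y1.
  by rewrite /r; apply/andP; split; lra.
have ct : S * tau ^+ n @[n --> \oo] --> (0 : R).
  rewrite -[X in _ --> X](mulr0 S); apply: cvgMr; apply: cvg_expr.
  by rewrite gtr0_norm.
have [n _ Hn] : \forall n \near \oo, S * tau ^+ n < s0.
  by apply: cvgr_lt ct _ s00.
by apply: (step n) => //; apply/ltW/Hn => /=.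
Qed.

End symbol_power_series.

(** * Absolutely continuous functions are indefinite integrals *)

Section chains.
Context {R : realType}.
Implicit Types (a b : R) (f : R -> R) (L : seq (R * R)).

(** Ordered families of nonoverlapping intervals, so that a subfamily or a
    refinement is obtained by list surgery. *)
Definition chain a b L :=
  all (fun p => [&& a <= p.1, p.1 <= p.2 & p.2 <= b]) L &&
  pairwise (fun p q : R * R => p.2 <= q.1) L.

Definition chain_length L := \sum_(p <- L) (p.2 - p.1).

Definition oscillation f L := \sum_(p <- L) `|f p.2 - f p.1|.

(* A non-strict bound, which suprema preserve. *)
Definition chain_ac a b f := forall e : R, 0 < e -> exists2 d : R, 0 < d &
  forall L, chain a b L -> chain_length L < d -> oscillation f L <= e.

Lemma abs_continuous_chain_ac a b f : abs_continuous a b f -> chain_ac a b f.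
Proof.
move=> acf e /acf[d d0 H]; exists d => // L /andP[/allP aL pL] Ld.
pose x0 : R * R := (a, a).
have Eb (F : R * R -> R) : \sum_(p <- L) F p = \sum_(i < size L) F (nth x0 L i).
  by rewrite (big_nth x0) big_mkord.
rewrite /oscillation Eb; apply: ltW.
apply: (H _ (fun i => (nth x0 L i).1) (fun i => (nth x0 L i).2)).
- by move=> i; have /aL/and3P[] := mem_nth x0 (ltn_ord i).
- apply/trivIsetP => i j _ _.
  have key (i1 j1 : 'I_(size L)) : (i1 < j1)%N ->
      `](nth x0 L i1).1, (nth x0 L i1).2[%classic `&`
      `](nth x0 L j1).1, (nth x0 L j1).2[%classic = set0.
    move=> ij; apply/seteqP; split => // x /= [].
    rewrite !in_itv /= => /andP[_ h1] /andP[h2 _].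
    have /(pairwiseP x0) /(_ i1 j1) := pL.
    by rewrite !inE !ltn_ord => /(_ isT isT ij); lra.
  by case: (ltngtP i j) => [/key//|/key|/val_inj ->]; rewrite 1?setIC ?eqxx.
- by rewrite -(Eb (fun p => p.2 - p.1)).
Qed.

Lemma chain_acS a b c d f : a <= c -> d <= b -> chain_ac a b f -> chain_ac c d f.
Proof.
move=> ac db acf e /acf[r r0 H]; exists r => // L /andP[/allP aL pL]; apply: H.
rewrite /chain pL andbT; apply/allP => p /aL /and3P[h1 h2 h3].
by rewrite h2 (le_trans ac) // (le_trans h3).
Qed.

Lemma chain_acB a b f g : chain_ac a b f -> chain_ac a b g ->
  chain_ac a b (fun x => f x - g x).
Proof.
move=> af ag e e0; have e20 : 0 < e / 2 by lra.
have [d1 d10 H1] := af _ e20; have [d2 d20 H2] := ag _ e20.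
exists (Num.min d1 d2); first by rewrite lt_min d10.
move=> L cL; rewrite lt_min => /andP[/(H1 _ cL) h1 /(H2 _ cL) h2].
apply: (@le_trans _ _ (oscillation f L + oscillation g L)); last by lra.
rewrite /oscillation -big_split; apply: ler_sum => p _ /=.
by rewrite (_ : f p.2 - _ - _ = (f p.2 - f p.1) - (g p.2 - g p.1)) ?ler_normB //; ring.
Qed.

Fixpoint pairs a (s : seq R) : seq (R * R) :=
  if s is x :: s' then (a, x) :: pairs x s' else [::].

Lemma oscillation_pairs a f s :
  \sum_(x <- zip s (a :: s)) `|f x.1 - f x.2| = oscillation f (pairs a s).
Proof.
elim: s a => [|x s IH] a; first by rewrite /oscillation !big_nil.
by rewrite /oscillation /= !big_cons; congr (_ + _); exact: IH.
Qed.

Lemma pairs_chain a s : path <%R a s ->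
  chain a (last a s) (pairs a s) /\ chain_length (pairs a s) = last a s - a.
Proof.
elim: s a => [|x s IH] a /=; first by rewrite /chain_length big_nil subrr.
move=> /andP[ax /IH[/andP[/allP h1 h2] h3]]; split; last first.
  by rewrite /chain_length big_cons /= -/(chain_length _) h3; ring.
have xl : x <= last x s.
  case: (s) h1 => [|y s'] //= /(_ (x, y)) /=; rewrite mem_head => /(_ isT).
  by move=> /and3P[_ h]; exact: le_trans.
rewrite /chain /= lexx (ltW ax) xl h2 /= andbT; apply/andP; split; apply/allP => p /h1.
  by move=> /and3P[q1 -> ->]; rewrite (le_trans (ltW ax)).
by move=> /and3P[].
Qed.

(** Refining one interval of a chain. *)
Lemma chain_replace a b l r L1 L2 P : chain a b (L1 ++ (l, r) :: L2) -> chain l r P ->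
  chain a b (L1 ++ P ++ L2).
Proof.
rewrite /chain !all_cat !pairwise_cat /= allrel_consr allrel_catr.
move=> /andP[/and3P[a1 /and3P[al lr rb] a2] /and3P[/andP[r1 r12] p1 /andP[rl p2]]].
move=> /andP[aP pP]; rewrite a1 a2 p1 p2 pP r12 !andbT /=.
apply/and3P; split.
- apply: sub_all aP => p /and3P[h1 -> h3].
  by rewrite (le_trans al h1) (le_trans h3 rb).
- apply/allrelP => p q /(allP r1) h1 /(allP aP) /and3P[h2 _ _].
  exact: le_trans h2.
- apply/allrelP => p q /(allP aP) /and3P[_ _ h1] /(allP rl) h2.
  exact: le_trans h2.
Qed.

Lemma chain_length_cat L1 L2 :
  chain_length (L1 ++ L2) = chain_length L1 + chain_length L2.
Proof. exact: big_cat. Qed.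

Lemma oscillation_cat f L1 L2 :
  oscillation f (L1 ++ L2) = oscillation f L1 + oscillation f L2.
Proof. exact: big_cat. Qed.

(** One interval after the other, the total variation over it is approached by
    the oscillation of [f] along a partition, which refines the chain without
    changing its length. *)
Lemma chain_tv_le a b f (d e : R) :
  (forall L, chain a b L -> chain_length L < d -> oscillation f L <= e) ->
  forall L2 L1, chain a b (L1 ++ L2) -> chain_length (L1 ++ L2) < d ->
  ((oscillation f L1)%:E + \sum_(p <- L2) total_variation p.1 p.2 f <= e%:E)%E.
Proof.
move=> H; elim=> [|[l r] L2 IH] L1 cL dL.
  by rewrite cats0 in cL dL; rewrite big_nil adde0 lee_fin H.
rewrite big_cons /=; set S := (\sum_(p <- L2) _)%E.
have S0 : (0 <= S)%E.
  rewrite /S big_seq; apply: sume_ge0 => p pL; apply: total_variation_ge0.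
  by move: cL => /andP[/allP /(_ p)]; rewrite mem_cat inE pL !orbT => /(_ isT) /and3P[].
have Sfin : S \is a fin_num.
  have := IH (L1 ++ [:: (l, r)]); rewrite -catA => /(_ cL dL) h.
  rewrite ge0_fin_numE //; apply: le_lt_trans (ltry e).
  by apply: le_trans h; apply: leeDr; rewrite lee_fin; apply: sumr_ge0.
rewrite addeCA -leeBrDr ?fin_numD ?Sfin //.
apply: ge_ereal_sup => _ [_ [s sP <-] <-].
rewrite leeBrDr ?fin_numD ?Sfin // addeA -EFinD.
have [/pairs_chain[cP lP] ls] := sP; rewrite (eqP ls) in cP lP.
rewrite (variation_zip f sP) oscillation_pairs [(oscillation f (pairs _ _) + _)%R]addrC -oscillation_cat.
have := IH (L1 ++ pairs l s); rewrite -catA; apply; first exact: chain_replace cL cP.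
by move: dL; rewrite !chain_length_cat lP {2}/chain_length big_cons.
Qed.

(** Intervals shorter than d have variation at most 1, and finitely many of them
    cover [a, b]. *)
Lemma chain_ac_tv_fin a b f : chain_ac a b f -> a <= b ->
  total_variation a b f \is a fin_num.
Proof.
move=> acf ab; have [d d0 H] := acf 1 ltr01.
have key (n : nat) : forall x y, a <= x -> x <= y -> y <= b -> y - x <= n%:R * (d / 2) ->
    total_variation x y f \is a fin_num.
  elim: n => [|n IH] x y ax xy yb yx.
    have -> : x = y by rewrite mul0r in yx; lra.
    by rewrite total_variationxx.
  pose z := Num.max x (y - d / 2).
  have xz : x <= z by rewrite le_max lexx.
  have zy : z <= y by rewrite ge_max xy /=; lra.
  have yz : y - z <= d / 2.
    have : y - d / 2 <= z by rewrite le_max lexx orbT.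
    by lra.
  have zx : z - x <= n%:R * (d / 2).
    rewrite /z maxEle; case: ifP => _; last by rewrite subrr mulr_ge0 //; lra.
    by move: yx; rewrite -natr1 mulrDl mul1r; lra.
  rewrite (total_variationD f xz zy) fin_numD; apply/andP; split.
    by apply: IH => //; exact: le_trans yb.
  have := @chain_tv_le a b f d 1 H [:: (z, y)] [::].
  rewrite /chain /= /chain_length /oscillation !big_cons !big_nil /= add0e adde0 addr0.
  rewrite zy yb (le_trans ax xz) => /(_ isT) h.
  rewrite ge0_fin_numE ?total_variation_ge0 //; apply: le_lt_trans (ltry 1).
  by apply: h; lra.
apply: (key (Num.truncn ((b - a) / (d / 2))).+1) => //.
rewrite -ler_pdivrMr; last by lra.
apply: ltW; exact: truncnS_gt.
Qed.

Lemma chain_ac_tv a b f : chain_ac a b f -> a <= b ->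
  chain_ac a b (fun x => fine (total_variation a x f)).
Proof.
move=> acf ab e /acf[d d0 H]; exists d => // L cL dL.
have := @chain_tv_le a b f d e H L [::] cL dL.
rewrite {1}/oscillation big_nil add0e -lee_fin; apply: le_trans.
rewrite /oscillation -sumEFin le_eqVlt; apply/orP; left; apply/eqP.
rewrite big_seq [RHS]big_seq; apply: eq_bigr => p pL.
have /andP[/allP /(_ p pL) /and3P[h1 h2 h3] _] := cL.
have fin x y : a <= x -> x <= y -> y <= b -> total_variation x y f \is a fin_num.
  by move=> ax xy yb; apply: chain_ac_tv_fin => //; exact: chain_acS acf.
have f1 : total_variation a p.1 f \is a fin_num by apply: fin => //; exact: le_trans h3.
have f2 : total_variation p.1 p.2 f \is a fin_num by exact: fin.
rewrite [total_variation a p.2 f](total_variationD f h1 h2) fineD //.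
by rewrite addrAC subrr add0r ger0_norm ?fineK // fine_ge0 // total_variation_ge0.
Qed.

(** The variation V of [f] from [a], and V - f. *)
Lemma chain_ac_monotone a b f : chain_ac a b f -> a <= b -> exists h1 h2 : R -> R,
  [/\ chain_ac a b h1, chain_ac a b h2,
   (forall x y, a <= x -> x <= y -> y <= b -> h1 x <= h1 y),
   (forall x y, a <= x -> x <= y -> y <= b -> h2 x <= h2 y) &
   forall x, f x = h1 x - h2 x].
Proof.
move=> acf ab; pose V x := fine (total_variation a x f).
have Vac := chain_ac_tv acf ab.
have fin x y : a <= x -> x <= y -> y <= b -> total_variation x y f \is a fin_num.
  by move=> ax xy yb; apply: chain_ac_tv_fin => //; exact: chain_acS acf.
have VD x y : a <= x -> x <= y -> y <= b -> V y = V x + fine (total_variation x y f).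
  move=> ax xy yb; rewrite /V (total_variationD f ax xy) fineD ?fin //.
  exact: le_trans xy yb.
exists V, (fun x => V x - f x); split => //.
- exact: chain_acB.
- move=> x y ax xy yb; rewrite (VD x y) // lerDl fine_ge0 //.
  exact: total_variation_ge0.
- move=> x y ax xy yb; rewrite (VD x y) //.
  have : `|f y - f x| <= fine (total_variation x y f).
    by rewrite -lee_fin fineK ?fin //; exact: total_variation_ge.
  by have := ler_norm (f y - f x); lra.
- by move=> x; ring.
Qed.

End chains.

(** The cells of a uniform grid of [a, b] that lie inside [U] form a chain, and as
    the grid gets finer they fill [U]. This relates null sets, which are covered
    by open sets of small measure, to chains. *)
Section grid.
Context {R : realType}.
Variables (a b : R) (U : set R).
Hypothesis ab : a < b.

Let w (n : nat) : R := (b - a) / n.+1%:R.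

Let w0 n : 0 < w n.
Proof. by rewrite divr_gt0 ?subr_gt0. Qed.

Let lo n i : R := a + i%:R * w n.

Let cell n i : set R := `]lo n i, lo n i.+1]%classic.

Let loS n i : lo n i < lo n i.+1.
Proof. by rewrite /lo ltrD2l ltr_pM2r ?ltr_nat. Qed.

Let lo_le n i j : (i <= j)%N -> lo n i <= lo n j.
Proof. by move=> ij; rewrite /lo lerD2l ler_pM2r ?ler_nat. Qed.

Let lo0 n : lo n 0 = a. Proof. by rewrite /lo mul0r addr0. Qed.

Let lon n : lo n n.+1 = b.
Proof. by rewrite /lo /w mulrC divfK ?pnatr_eq0 //; ring. Qed.

Let sel n i : bool := `[< cell n i `<=` U >].

Definition grid_inside n : set R :=
  \big[setU/set0]_(i < n.+1 | sel n i) cell n i.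

Definition grid_chain n : seq (R * R) :=
  [seq (lo n i, lo n i.+1) | i <- iota 0 n.+1 & sel n i].

Lemma grid_chainP n : chain a b (grid_chain n).
Proof.
rewrite /chain /grid_chain; apply/andP; split.
  rewrite all_map; apply/allP => i.
  rewrite mem_filter mem_iota add0n => /andP[_ /andP[_ iN]]; rewrite /preim.
  apply/and3P; split; rewrite /= ?(ltW (loS _ _)) //.
    by rewrite -[leLHS](lo0 n); exact: lo_le.
  by rewrite -[leRHS](lon n); exact: lo_le.
rewrite pairwise_map; apply: (@sub_pairwise _ ltn) => [i j ij /=|].
  exact: lo_le.
by rewrite -(@sorted_pairwise _ ltn ltn_trans) sorted_filter ?iota_ltn_sorted //; exact: ltn_trans.
Qed.

Lemma measurable_grid n : measurable (grid_inside n).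
Proof. by apply: bigsetU_measurable => i _; exact: measurable_itv. Qed.

Lemma grid_measure (m : {measure set (measurableTypeR R) -> \bar R}) (H : R -> R) n :
  (forall p q, p <= q -> m `]p, q]%classic = (H q - H p)%:E) ->
  m (grid_inside n) = (\sum_(p <- grid_chain n) (H p.2 - H p.1))%:E.
Proof.
move=> mH; rewrite /grid_inside measure_bigsetU_ord_cond.
- rewrite /grid_chain big_map big_filter -[iota 0 n.+1]/(index_iota 0 n.+1) big_mkord -sumEFin.
  by apply: eq_bigr => i _; exact: (mH _ _ (ltW (loS n i))).
- by move=> i _; exact: measurable_itv.
apply/trivIsetP => i j _ _.
have key (i1 j1 : nat) : (i1 < j1)%N -> cell n i1 `&` cell n j1 = set0.
  move=> ij; apply/seteqP; split => // x /= [].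
  rewrite /cell /= !in_itv /= => /andP[_ h1] /andP[h2 _].
  by have := lo_le n ij; lra.
by case: (ltngtP i j) => [/key//|/key|/val_inj ->]; rewrite 1?setIC ?eqxx.
Qed.

Lemma grid_subset n : grid_inside n `<=` U.
Proof.
rewrite /grid_inside; elim/big_ind: _ => // [A B AU BU x []|i /asboolP].
- exact: AU.
- exact: BU.
- by [].
Qed.

Lemma grid_exhausts x : open U -> U x -> a < x -> x <= b ->
  exists N, forall n, (N <= n)%N -> grid_inside n x.
Proof.
move=> oU Ux ax xb.
have /nbhs_ballP[r /= r0 xr] : nbhs x U by exact: open_nbhs_nbhs.
exists (Num.truncn ((b - a) / r)).+1 => n nN.
have wr : w n < r.
  rewrite /w ltr_pdivrMr // mulrC -ltr_pdivrMr //.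
  by apply: lt_le_trans (truncnS_gt _) _; rewrite ler_nat ltnW.
have ex : exists i, x <= lo n i.+1 by exists n; rewrite lon.
case: (ex_minnP ex) => i xi imin.
have iN : (i < n.+1)%N by rewrite ltnS imin // lon.
have ix : lo n i < x.
  case: (i) imin => [|j] imin; first by rewrite lo0.
  by rewrite ltNge; apply/negP => /imin; rewrite ltnn.
have cx : cell n i x by rewrite /cell /= in_itv /= ix xi.
have si : sel n i.
  apply/asboolP => y; rewrite /cell /= in_itv /= => /andP[iy yi].
  apply: xr; rewrite /ball /= ltr_norml.
  have : lo n i.+1 - lo n i < r.
    by apply: le_lt_trans wr; rewrite /lo -natr1; lra.
  by move=> h; apply/andP; split; lra.
by rewrite /grid_inside (bigD1 (Ordinal iN)) //=; left.
Qed.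

End grid.

Section monotone_density.
Context {R : realType}.
Local Notation mu := (@lebesgue_measure R).
Variables (a b : R) (h : R -> R).
Hypotheses (ab : a < b) (hac : chain_ac a b h)
  (hnd : forall x y, a <= x -> x <= y -> y <= b -> h x <= h y).

Let cl (x : R) := Num.max a (Num.min x b).

Let clE x : [/\ a <= cl x, cl x <= b & (a <= x -> x <= b -> cl x = x)].
Proof.
rewrite /cl; split; first by rewrite le_max lexx.
  by rewrite ge_max (ltW ab) ge_min lexx orbT.
by move=> ax xb; rewrite (min_idPl xb) (max_idPr ax).
Qed.

Let cl_le x y : x <= y -> cl x <= cl y /\ cl y - cl x <= y - x.
Proof.
by move=> xy; rewrite /cl !maxEle !minEle; do !case: ifPn; rewrite -?ltNge; split; lra.
Qed.

Let H x := h (cl x).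

Let Hnd : nondecreasing H.
Proof.
move=> x y xy; have [h1 _ _] := clE x; have [_ h2 _] := clE y.
by have [? _] := cl_le xy; exact: hnd.
Qed.

Let Hrc : right_continuous H.
Proof.
move=> x; apply/cvgrPdist_le => e /hac[d d0 hd].
near=> t.
have xt : x < t by near: t; exact: nbhs_right_gt.
have td : t < x + d by near: t; apply: nbhs_right_lt; lra.
have [h1 h2] := cl_le (ltW xt); have [h3 _ _] := clE x; have [_ h4 _] := clE t.
have := hd [:: (cl x, cl t)].
rewrite /chain /chain_length /oscillation /= !big_cons !big_nil /= h1 h3 h4 !addr0 distrC.
by apply => //; lra.
Unshelve. all: by end_near. Qed.

(** The extension of [h] by constants is the distribution function of a measure.
    A null set lies in an open set of measure less than d; by absolute continuity
    the cells inside it have small Lebesgue-Stieltjes measure. *)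
Lemma monotone_density : exists g : R -> R,
  [/\ forall x, 0 <= g x, mu.-integrable setT (EFin \o g) &
   forall x, a <= x -> x <= b ->
     ((h x - h a)%:E = \int[mu]_(t in `]a, x]) (g t)%:E)%E].
Proof.
pose Hc : cumulative R R := HB.pack H (isCumulative.Build R _ R H Hnd Hrc).
pose nu : {measure set (measurableTypeR R) -> \bar R} := lebesgue_stieltjes_measure Hc.
have nuE p q : p <= q -> nu `]p, q]%classic = (H q - H p)%:E.
  move=> pq; rewrite /nu /= /lebesgue_stieltjes_measure /measure_extension measurable_mu_extE/=.
    by rewrite wlength_itv_bnd.
  exact: is_ocitv.
have muE p q : p <= q -> mu `]p, q]%classic = (q - p)%:E.
  move=> pq; rewrite lebesgue_measure_itv /= lte_fin; case: ltP => // qp.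
  by congr EFin; lra.
pose D : set (measurableTypeR R) := `]a, b]%classic.
have mD : measurable D by exact: measurable_itv.
have Dfin : (nu D < +oo)%E by rewrite nuE ?ltry // ltW.
pose nuD := mfrestr mD Dfin.
have dom : nuD `<< mu.
  apply/null_content_dominatesP => A mA A0.
  apply/eqP; rewrite eq_le measure_ge0 andbT; apply/lee_addgt0Pr => e e0; rewrite add0e.
  have [d d0 hd] := hac e0.
  have [|U [oU AU Ud]] := @lebesgue_regularity_outer R A d mA _ d0.
    by rewrite A0.
  have mU : measurable U by exact: open_measurable.
  have muU : (mu U < d%:E)%E.
    have := measureDI mu mU mA; rewrite (setIidr AU) => ->.
    by rewrite A0 adde0.
  pose E N : set (measurableTypeR R) := \bigcap_(n in [set n | (N <= n)%N]) grid_inside a b U n.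
  have mE N : measurable (E N).
    by apply: bigcap_measurableType => n _; exact: measurable_grid.
  have mUE : measurable (\bigcup_N E N) by exact: bigcup_measurable.
  have ndE : nondecreasing_seq E.
    move=> N M NM; apply/subsetPset => x Ex n /= Mn; apply: Ex => /=.
    exact: leq_trans Mn.
  have nuEle N : (nu (E N) <= e%:E)%E.
    apply: (@le_trans _ _ (nu (grid_inside a b U N))).
      apply: le_measure; rewrite ?inE //; first exact: measurable_grid.
      by move=> x /(_ N); apply => /=.
    rewrite (grid_measure U ab N nuE) lee_fin.
    have gd : chain_length (grid_chain a b U N) < d.
      rewrite -lte_fin -(grid_measure U ab N muE); apply: le_lt_trans muU.
      apply: le_measure; rewrite ?inE //; first exact: measurable_grid.
      exact: grid_subset.
    apply: le_trans (hd _ (grid_chainP U ab N) gd).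
    rewrite /oscillation big_seq [leRHS]big_seq; apply: ler_sum => p pL.
    have /andP[/allP /(_ _ pL) /and3P[h1 h2 h3] _] := grid_chainP U ab N.
    have -> : H p.2 - H p.1 = h p.2 - h p.1.
      have [_ _ c1] := clE p.1; have [_ _ c2] := clE p.2.
      by rewrite /H c1 ?c2 //; [exact: le_trans h2|exact: le_trans h3].
    exact: ler_norm.
  apply: (@le_trans _ _ (nu (\bigcup_N E N))).
    rewrite /nuD /mfrestr /mrestr; apply: le_measure; rewrite ?inE //.
      exact: measurableI.
    move=> x [Ax]; rewrite /D /= in_itv /= => /andP[ax xb].
    have [N HN] := grid_exhausts oU (AU _ Ax) ax xb.
    by exists N => // n /=; exact: HN.
  have cE := @nondecreasing_cvg_mu _ _ _ nu E mE mUE ndE.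
  rewrite -(cvg_lim _ cE) //; apply: lime_le; first by apply/cvg_ex; eexists; exact: cE.
  by near=> N; exact: nuEle.
have [g [g0 gfin gint gE]] := radon_nikodym_sigma_finite dom.
exists (fun x => fine (g x)); split.
- by move=> x; exact: fine_ge0.
- by apply: eq_integrable gint => // x _ /=; rewrite fineK.
move=> x ax xb; have [_ _ ca] := clE a; have [_ _ cx] := clE x.
have -> : h x - h a = H x - H a by rewrite /H ca ?cx // ltW.
rewrite -nuE //; transitivity (nuD `]a, x]%classic).
  rewrite /nuD /mfrestr /mrestr; congr (nu _); apply/seteqP; split => y /=.
    by move=> yx; split=> //; move: yx; rewrite /D /= !in_itv /= => /andP[-> /le_trans ->].
  by case.
transitivity (\int[mu]_(t in `]a, x]) g t)%E; first by apply: gE; exact: measurable_itv.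
by apply: eq_integral => y _; rewrite fineK.
Unshelve. all: by end_near. Qed.

End monotone_density.

Section absolutely_continuous_density.
Context {R : realType}.
Local Notation mu := (@lebesgue_measure R).

Lemma abs_continuous_density (a b : R) (f : R -> R) : a < b -> abs_continuous a b f ->
  exists g : R -> R, mu.-integrable setT (EFin \o g) /\
   forall x, a <= x -> x <= b -> f x - f a = \int[mu]_(t in `]a, x]) g t.
Proof.
move=> ab /abs_continuous_chain_ac acf.
have [h1 [h2 [ac1 ac2 nd1 nd2 fE]]] := chain_ac_monotone acf (ltW ab).
have [g1 [g10 i1 E1]] := monotone_density ab ac1 nd1.
have [g2 [g20 i2 E2]] := monotone_density ab ac2 nd2.
exists (fun x => g1 x - g2 x); split.
  by apply: eq_integrable (integrableB measurableT i1 i2) => // x _; rewrite /= EFinB.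
move=> x ax xb.
have mI : measurable (`]a, x]%classic : set (measurableTypeR R)) by exact: measurable_itv.
have j1 := integrableS measurableT mI (@subsetT _ _) i1.
have j2 := integrableS measurableT mI (@subsetT _ _) i2.
rewrite RintegralB //.
rewrite /Rintegral -(E1 _ ax xb) -(E2 _ ax xb) !fE /=; ring.
Qed.

End absolutely_continuous_density.

(** * Derivatives within the half-line *)

Section one_sided_derivatives.
Context {R : realType}.
Local Notation mu := (@lebesgue_measure R).
Implicit Types (D : set R) (f g F : R -> R).

Lemma diff_quotient_cvgP D f t (d : R) :
  (diff_quotient f t x @[x --> within D t^'] --> d) <->
  (forall e : R, 0 < e -> exists2 r : R, 0 < r & forall x, D x -> x != t ->
     `|x - t| < r -> `|d - diff_quotient f t x| < e).
Proof.
split=> [/cvgrPdist_lt H e /H|H].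
  move=> /nbhs_ballP[r /= r0 Hr]; exists r => // x Dx xt xr.
  by apply: Hr => //; rewrite /ball /= distrC.
apply/cvgrPdist_lt => e /H[r r0 Hr]; apply/nbhs_ballP; exists r => // x.
by rewrite /ball /= distrC => xr xt Dx; exact: Hr.
Qed.

Lemma derivable_withinP D f t : derivable_within D f t <->
  exists d : R, diff_quotient f t x @[x --> within D t^'] --> d.
Proof. by split=> [?|[d h]]; [exists (derive_within D f t)|apply/cvg_ex; exists d]. Qed.

Lemma derive_withinE f t (d : R) : 0 <= t ->
  (diff_quotient f t x @[x --> within `[0, +oo[ t^'] --> d) ->
  derive_within `[0, +oo[ f t = d.
Proof.
move=> t0 h; apply: cvg_lim => //; apply: Build_ProperFilter.
move=> /nbhs_ballP[r /= r0 Hr]; apply: (Hr (t + r / 2)).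
- by rewrite /ball /= opprD addrA subrr add0r normrN gtr0_norm; lra.
- by rewrite gt_eqF // ltrDl; lra.
- by rewrite /= in_itv /= andbT; lra.
Qed.

(** Only the germs of the function and of the domain at [t] matter. *)
Lemma diff_quotient_local D D' f g t (r : R) : 0 < r -> f t = g t ->
  (forall x, `|x - t| < r -> D x -> D' x /\ f x = g x) -> forall d : R,
  (diff_quotient g t x @[x --> within D' t^'] --> d) ->
  (diff_quotient f t x @[x --> within D t^'] --> d).
Proof.
move=> r0 ft H d /diff_quotient_cvgP h; apply/diff_quotient_cvgP => e /h[p p0 hp].
exists (Num.min r p); first by rewrite lt_min r0.
move=> x Dx xt; rewrite lt_min => /andP[xr xp].
by have [D'x E] := H _ xr Dx; have := hp x D'x xt xp; rewrite /diff_quotient E ft.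
Qed.

Lemma derive_within_local D D' f g t (r : R) : 0 < r -> f t = g t ->
  (forall x, `|x - t| < r -> (D x <-> D' x) /\ (D x -> f x = g x)) ->
  derive_within D f t = derive_within D' g t.
Proof.
move=> r0 ft H.
have E : (fun d : R => diff_quotient f t x @[x --> within D t^'] --> d) =
         (fun d : R => diff_quotient g t x @[x --> within D' t^'] --> d).
  apply/funext => d; apply/propext; split; apply: (diff_quotient_local r0) => //.
  - by move=> x /H[[h1 h2] h3] /h2 Dx; split => //; rewrite h3.
  - by move=> x /H[[h1 h2] h3] Dx; split; [exact: h1|exact: h3].
exact: (congr1 get E).
Qed.

Lemma derivable_diff_quotient F t (d : R) : derivable F t 1 -> derive1 F t = d ->
  forall D, diff_quotient F t x @[x --> within D t^'] --> d.
Proof.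
move=> dF <- D; apply/diff_quotient_cvgP => e e0.
have /cvgrPdist_lt/(_ e e0) : (fun h : R => h^-1 *: (F (h + t) - F t)) @ 0^' --> derive1 F t.
  move: dF; rewrite /derivable /derive1 /= => dF.
  have E : (fun h : R => h^-1 *: (F (h *: 1 + t) - F t)) = (fun h => h^-1 *: (F (h + t) - F t)).
    by apply/funext => h; rewrite [h *: 1]mulr1.
  by move: dF; rewrite E.
move=> /nbhs_ballP[r /= r0 Hr]; exists r => // x Dx xt xr.
have := Hr (x - t); rewrite /ball /= sub0r normrN subrK => /(_ xr).
by rewrite subr_eq0 => /(_ xt); rewrite /diff_quotient [_ *: _]mulrC.
Qed.

Lemma diff_quotient_derivable D f t d (r : R) : 0 < r ->
  (forall x, `|x - t| < r -> D x) ->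
  (diff_quotient f t x @[x --> within D t^'] --> d) ->
  derivable f t 1 /\ derive1 f t = d.
Proof.
move=> r0 H /diff_quotient_cvgP h.
have key : (fun h : R => h^-1 *: (f (h + t) - f t)) @ 0^' --> (d : R).
  apply/cvgrPdist_lt => e /h[p p0 hp]; apply/nbhs_ballP; exists (Num.min r p).
    by rewrite /= lt_min r0.
  move=> y; rewrite /ball /= sub0r normrN lt_min => /andP[yr yp] y0.
  have := hp (y + t); rewrite addrK /diff_quotient [_ *: _]mulrC addrK; apply => //.
    by apply: H; rewrite addrK.
  by rewrite -subr_eq0 addrK.
split; last exact/cvg_lim.
apply/cvg_ex; exists d.
have -> // : (fun h : R => h^-1 *: ((f \o shift t) (h *: 1) - f t)) =
  (fun h => h^-1 *: (f (h + t) - f t)).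
by apply/funext => y; rewrite /= [y *: 1]mulr1.
Qed.

Lemma diff_quotient_continuous D f t (d : R) :
  (diff_quotient f t x @[x --> within D t^'] --> d) ->
  forall e : R, 0 < e -> exists2 r : R, 0 < r & forall x, D x -> `|x - t| < r ->
    `|f t - f x| < e.
Proof.
move=> /diff_quotient_cvgP/(_ 1 ltr01)[r r0 H] e e0.
have d1 : 0 < `|d| + 1 by apply: ltr_pwDr.
exists (Num.min r (e / (`|d| + 1))).
  by rewrite lt_min r0 divr_gt0.
move=> x Dx; rewrite lt_min => /andP[xr xe].
have [->|xt] := eqVneq x t; first by rewrite subrr normr0.
have := H x Dx xt xr; rewrite /diff_quotient => h.
have h2 : `|(f x - f t) / (x - t)| < `|d| + 1.
  move: h; set q := _ / _ => h; have := ler_normB d (d - q).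
  by rewrite (_ : d - (d - q) = q); [lra|ring].
have xt0 : 0 < `|x - t| by rewrite normr_gt0 subr_eq0.
rewrite distrC; move: xe h2; rewrite ltr_pdivlMr // => xe.
rewrite normrM normfV ltr_pdivrMr // => h2; apply: lt_trans h2 _.
by rewrite mulrC.
Qed.

End one_sided_derivatives.

Section half_line.
Context {R : realType}.
Local Notation mu := (@lebesgue_measure R).
Local Notation dn := (fun j f => @deriven_within R `[0, +oo[ j f).

(** At an interior or left end point, derivatives relative to a bounded interval
    and to the half-line agree. *)
Lemma deriven_within_local (b : R) (f : R -> R) j t : 0 <= t -> t < b ->
  deriven_within `[0, b] j f t = deriven_within `[0, +oo[ j f t.
Proof.
elim: j t => // j IH t t0 tb; rewrite /deriven_within /=.
apply: (@derive_within_local _ _ _ _ _ _ (b - t)); first by lra.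
  exact: IH.
move=> x; rewrite ltr_norml /= !in_itv /= andbT => /andP[_ xb].
split; first by split => [/andP[]//|->]; lra.
by move=> /andP[x0 _]; apply: IH => //; lra.
Qed.

Section smooth.
Variables (n : nat) (f : R -> R).
Hypothesis acf : forall b : R, 0 < b -> ACn n 0 b f.

Lemma ACn_diff_quotient j t : (j.+1 < n)%N -> 0 <= t ->
  diff_quotient (dn j f) t x @[x --> within `[0, +oo[ t^'] --> dn j.+1 f t.
Proof.
move=> jn t0; have t10 : 0 < t + 1 by lra.
have [/(_ j jn t) + _] := acf t10; rewrite in_itv /= t0 lerDl ler01 => /(_ isT).
move=> /derivable_withinP[d hd].
suff h : diff_quotient (dn j f) t x @[x --> within `[0, +oo[ t^'] --> d.
  by move: (h); rewrite -(derive_withinE t0 h).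
apply: (@diff_quotient_local _ _ _ _ _ _ 1 _ _ _ _ hd) => //.
  by rewrite deriven_within_local //; lra.
move=> x; rewrite ltr_norml /= !in_itv /= andbT => /andP[_ xb] x0.
by rewrite x0 deriven_within_local //; [split => //; lra|lra].
Qed.

Lemma ACn_abs_continuous (b : R) : 0 < b -> abs_continuous 0 b (dn n.-1 f).
Proof.
move=> b0 e e0; have b10 : 0 < b + 1 by lra.
have [_ /(_ e e0)[d d0 H]] := acf b10; exists d => // N l r lr tI sd.
apply: le_lt_trans (H N l r _ tI sd); last first.
  by move=> i; have [h1 [h2 h3]] := lr i; do !split => //; lra.
apply: ler_sum => i _; have [h1 [h2 h3]] := lr i.
by rewrite !deriven_within_local //; lra.
Qed.

Lemma ACn_continuous j t : (j < n)%N -> 0 <= t ->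
  forall e : R, 0 < e -> exists2 r : R, 0 < r & forall x, `[0, +oo[%classic x ->
    `|x - t| < r -> `|dn j f t - dn j f x| < e.
Proof.
move=> jn t0; have [jn1|] := ltnP j.+1 n.
  exact: (diff_quotient_continuous (ACn_diff_quotient jn1 t0)).
move=> nj e e0; have -> : j = n.-1 by case: (n) jn nj => // n'; rewrite !ltnS => h1 h2; apply/eqP; rewrite eqn_leq h1.
have t10 : 0 < t + 1 by lra.
have /abs_continuous_chain_ac acn := ACn_abs_continuous t10.
have e20 : 0 < e / 2 by lra.
have [d d0 H] := acn _ e20; exists (Num.min d 1); first by rewrite lt_min d0 /=.
move=> x; rewrite /= in_itv /= andbT lt_min => x0 /andP[xd x1].
have key (p q : R) : 0 <= p -> p <= q -> q <= t + 1 -> q - p < d ->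
    `|dn n.-1 f q - dn n.-1 f p| < e.
  move=> p0 pq qt qp; apply: (@le_lt_trans _ _ (e / 2)); last by lra.
  have := H [:: (p, q)]; rewrite /chain /chain_length /oscillation /= !big_cons !big_nil /=.
  by rewrite p0 pq qt !addr0; apply.
have /andP[h1 h2] : - d < x - t < d by rewrite -ltr_norml.
have /andP[h3 h4] : - 1 < x - t < 1 by rewrite -ltr_norml.
have [xt|tx] := leP x t; first by apply: key => //; lra.
by rewrite distrC; apply: key => //; lra.
Qed.

(** Below the top order the derivatives are continuous, hence this is the
    classical fundamental theorem. *)
Lemma ACn_FTC j (x : R) : (j.+1 < n)%N -> 0 < x ->
  dn j f x - dn j f 0 = \int[mu]_(t in `]0, x]) dn j.+1 f t.
Proof.
move=> jn x0.
have cont i : (i < n)%N -> {within `[0, x], continuous (dn i f)}.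
  move=> iN; apply/subspace_continuousP => t; rewrite /= in_itv /= => /andP[t0 tx].
  apply/cvgrPdist_lt => e /(ACn_continuous iN t0)[r r0 H].
  apply/nbhs_ballP; exists r => // y; rewrite /ball /= distrC => yr.
  by rewrite in_itv /= => /andP[y0 _]; apply: H => //=; rewrite in_itv /= y0.
have c1 := cont _ jn.
have dq t : 0 < t -> derivable (dn j f) t 1 /\ derive1 (dn j f) t = dn j.+1 f t.
  move=> t0; apply: (diff_quotient_derivable t0) (ACn_diff_quotient jn (ltW t0)).
  by move=> y; rewrite ltr_norml /= in_itv /= andbT => /andP[h _]; lra.
have FT : (\int[mu]_(y in `[0%R, x]) (dn j.+1 f y)%:E = (dn j f x)%:E - (dn j f 0)%:E)%E.
  apply: continuous_FTC2 => //.
    have cj := cont _ (ltnW jn).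
    have [_ h1 h2] := (continuous_within_itvP _ x0).1 cj; split => //.
    by move=> t; rewrite in_itv /= => /andP[/dq[]].
  by move=> t; rewrite in_itv /= => /andP[/dq[]].
have ij : mu.-integrable `[0, x] (EFin \o dn j.+1 f).
  by apply: continuous_compact_integrable => //; exact: segment_compact.
rewrite Rintegral_itv_obnd_cbnd; first by rewrite /Rintegral FT.
apply: (@integrableS _ _ _ mu _ _ _ _ _ _ ij); [exact: measurable_itv..|].
by apply: subset_itv; rewrite bnd_simp.
Qed.

End smooth.
End half_line.

Section half_line_density.
Context {R : realType}.
Local Notation mu := (@lebesgue_measure R).

Lemma density_derivative (b : R) (phi g : R -> R) : 0 < b -> mu.-integrable setT (EFin \o g) ->
  (forall x, 0 <= x -> x <= b -> phi x - phi 0 = \int[mu]_(t in `]0, x]) g t) ->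
  {ae mu, forall x, 0 < x -> x < b -> derive_within `[0, +oo[ phi x = g x}.
Proof.
move=> b0 ig E.
have ii (y : R) : mu.-integrable `]0, y] (EFin \o g).
  by apply: (@integrableS _ _ _ mu _ _ _ _ _ _ ig).
have lg : locally_integrable [set: R] g by apply: open_integrable_locally => //; exact: openT.
have [N [mN N0 NE]] := FTC1 (a := BRight 0) ii lg.
exists N; split => // x /= Hx; apply: NE => /= H; apply: Hx => x0 xb.
have [d1 d2] := H x0.
pose F y := \int[mu]_(t in `]0, y]) g t.
apply: derive_withinE; first exact: ltW.
apply: (@diff_quotient_local _ _ setT _ (fun y => phi 0 + F y) _ (Num.min x (b - x))).
- by rewrite lt_min x0 subr_gt0.
- by rewrite /F -E ?(ltW x0) ?(ltW xb) //; ring.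
- move=> y; rewrite lt_min ltr_norml => /andP[/andP[h1 h2]]; rewrite ltr_norml => /andP[h3 h4] _.
  by split => //; rewrite /F -E; [ring|lra|lra].
apply: (@diff_quotient_local _ _ setT _ (fun y => F y + phi 0) _ 1) => //.
- by rewrite addrC.
- by move=> y _ _; rewrite addrC.
apply: derivable_diff_quotient.
- exact: (derivableD d1 (derivable_cst (phi 0) x 1)).
- by rewrite derive1E (deriveD d1 (derivable_cst (phi 0) x 1)) derive_cst addr0 -derive1E.
Qed.

(** The densities on the intervals [0, n + 1] agree almost everywhere with the
    derivative; choosing on [n, n + 1[ the density of index n glues them into one
    measurable function. *)
Lemma half_line_density (phi : R -> R) :
  (forall b : R, 0 < b -> abs_continuous 0 b phi) -> exists g : R -> R,
  [/\ measurable_fun setT g, forall t, t <= 0 -> g t = 0,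
   {ae mu, forall x, 0 < x -> derive_within `[0, +oo[ phi x = g x},
   forall x : R, mu.-integrable `]0, x] (EFin \o g) &
   forall x, 0 < x -> phi x - phi 0 = \int[mu]_(t in `]0, x]) g t].
Proof.
move=> acp.
have [G HG] := choice (fun n : nat => abs_continuous_density (ltr0Sn R n) (acp _ (ltr0Sn R n))).
have aeG : {ae mu, forall x : R, forall n : nat, 0 < x -> x < n.+1%:R ->
    derive_within `[0, +oo[ phi x = G n x}.
  apply: ae_foralln => n; have [h1 h2] := HG n.
  exact: density_derivative.
have mG n : measurable_fun setT (G n).
  by have [/measurable_int/measurable_EFinP] := HG n.
pose g x := if 0 < x then G (Num.truncn x) x else 0.
have mF : measurable_fun setT (fun x : R => G (Num.truncn x) x).
  pose E i : set (measurableTypeR R) := if i is i'.+1 then `[i%:R, i.+1%:R[%classic else `]-oo, 1%R[%classic.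
  have mE i : measurable (E i) by case: i => *; exact: measurable_itv.
  have EE i x : E i x -> Num.truncn x = i.
    case: i => [|i] /=; rewrite in_itv /= => h.
      have [x0|x0] := leP 0 x; last by apply: truncn0Pn; rewrite -ltNge (lt_trans x0).
      by apply/eqP; rewrite truncn_eq // x0 h.
    by apply/eqP; rewrite truncn_eq // (le_trans _ (andP h).1).
  have -> : [set: R] = \bigcup_i E i.
    apply/seteqP; split => // x _; exists (Num.truncn x) => //.
    case tx : (Num.truncn x) => [|i] /=; rewrite in_itv /=.
      by have := truncnS_gt x; rewrite tx.
    have x0 : 0 <= x by rewrite (le_trans ler01) // -truncn_gt0 tx.
    by rewrite -tx truncn_le x0 truncnS_gt.
  apply/measurable_fun_bigcup => // i.
  apply: (@eq_measurable_fun _ _ _ _ _ (G i)); first by move=> x; rewrite inE => /EE ->.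
  exact: measurable_funS (mG i).
have mg : measurable_fun setT g.
  apply: measurable_fun_ifT => //; first exact: measurable_fun_ltr.
have aeg : {ae mu, forall x, 0 < x -> derive_within `[0, +oo[ phi x = g x}.
  have [N [mN N0 NE]] := aeG; exists N; split => // x /= Hx; apply: NE => /= H.
  by apply: Hx => x0; rewrite /g x0; apply: H => //; exact: truncnS_gt.
have aeE (x : R) : {ae mu, forall y, 0 < y -> y <= x -> g y = G (Num.truncn x) y}.
  have [N [mN N0 NE]] := aeG; exists N; split => // y /= Hy; apply: NE => /= H.
  apply: Hy => y0 yx; rewrite /g y0 -!H //; first exact: le_lt_trans (truncnS_gt _).
  exact: truncnS_gt.
exists g; split => //.
- by move=> t t0; rewrite /g ltNge t0.
- move=> x; have [h1 h2] := HG (Num.truncn x).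
  apply/integrableP; split; first (apply/measurable_EFinP; apply: measurable_funTS; (exact: mg || exact: mG)).
  have h3 : mu.-integrable `]0, x] (EFin \o G (Num.truncn x)).
    by apply: (@integrableS _ _ _ mu _ _ _ _ _ _ h1).
  have /integrableP[_] := h3; apply: le_lt_trans.
  rewrite le_eqVlt; apply/orP; left; apply/eqP; apply: ae_eq_integral => //.
  - apply: measurableT_comp => //; apply/measurable_EFinP; apply: measurable_funTS; (exact: mg || exact: mG).
  - apply: measurableT_comp => //; apply/measurable_EFinP; apply: measurable_funTS; (exact: mg || exact: mG).
  have [N [mN N0 NE]] := aeE x; exists N; split => // y /= Hy; apply: NE => /= H.
  by apply: Hy; rewrite in_itv /= => /andP[y0 yx]; rewrite H //.
move=> x x0; have [h1 h2] := HG (Num.truncn x).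
rewrite h2 ?ltW //; last exact: truncnS_gt.
rewrite /Rintegral; congr fine; apply: ae_eq_integral => //.
- apply/measurable_EFinP; apply: measurable_funTS; (exact: mg || exact: mG).
- apply/measurable_EFinP; apply: measurable_funTS; (exact: mg || exact: mG).
have [N [mN N0 NE]] := aeE x; exists N; split => // y /= Hy; apply: NE => /= H.
by apply: Hy; rewrite in_itv /= => /andP[y0 yx]; rewrite H //.
Qed.

End half_line_density.

(** * The k-Prabhakar kernel *)

Section kgamma.
Context {R : realType}.
Local Notation mu := (@lebesgue_measure R).

Lemma continuous_cpow_part (p : R[i] -> R) (c w : R[i]) (y : R) :
  p = @complex.Re R \/ p = @complex.Im R -> 0 < y ->
  {for y, continuous (fun t : R => p (c * cpow t%:C w))}.
Proof.
move=> pP y0.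
have key (g : R -> R) : (forall t, 0 < t -> p (c * cpow t%:C w) = g t) -> {for y, continuous g} ->
    {for y, continuous (fun t : R => p (c * cpow t%:C w))}.
  move=> E; rewrite /prop_for /continuous_at (E _ y0); apply: cvg_trans.
  by apply: near_eq_cvg; near=> t; apply/esym; apply: E; near: t; exact: lt_nbhsr.
have cR := continuous_Re_cpow (w := w) y0; have cI := continuous_Im_cpow (w := w) y0.
have cc (r : R) : {for y, continuous (fun _ : R => r)} by exact: cst_continuous.
case: pP => E.
  apply: (key _ _ (continuousB (continuousM (cc (Re c)) cR) (continuousM (cc (Im c)) cI))).
  by move=> t t0; rewrite E clnE // cReM.
apply: (key _ _ (continuousD (continuousM (cc (Re c)) cI) (continuousM (cc (Im c)) cR))).
by move=> t t0; rewrite E clnE // cImM.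
Unshelve. all: by end_near. Qed.

(** Substitution y = t^k / k in the Euler integral. *)
Lemma cGamma_subst (k : R) (c z : R[i]) : 0 < k -> 0 < Re z ->
  c * cGamma z = cint mu (fun t => if 0 < t then
    (k^-1 * (k * t `^ (k - 1)) * expR (- (t `^ k / k)))%:C * (c * cpow (t `^ k / k)%:C (z - 1)) else 0).
Proof.
move=> k0 z0; rewrite /cGamma /laplace -cintZ; last exact: lapL1_jpow.
have E1 : (fun t => c * (eweight 1 t * jpow z t)) = (fun t => eweight 1 t * (c * jpow z t)).
  by apply/funext => t; rewrite mulrCA.
rewrite E1.
pose phi (t : R) := k^-1 * t `^ k.
pose w (t : R) := if 0 < t then k^-1 * (k * t `^ (k - 1)) else 0.
have kV : 0 < k^-1 by rewrite invr_gt0.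
have w0 t : 0 <= w t.
  by rewrite /w; case: ifP => // _; rewrite mulr_ge0 ?(ltW kV) // mulr_ge0 ?powR_ge0 // ltW.
rewrite (@cint_transport _ _ _ _ _ mu mu phi w w0).
  congr cint; apply/funext => t; rewrite /w; case: ifP => t0; last by rewrite mul0r.
  have p0 : 0 < phi t by rewrite mulr_gt0 // powR_gt0.
  have -> : t `^ k / k = phi t by rewrite mulrC.
  by rewrite /jpow p0 /eweight (mul1r (phi t)) [LHS]mulrA -(rmorphM (real_complex R)).
move=> p pP.
have mf : measurable_fun setT (fun y => p (eweight 1 y * (c * jpow z y))).
  have [m1 m2] := cmeasM (cmeas_eweight 1) (cmeasM (cmeas_cst _ c) (cmeas_jpow z)).
  by case: pP => ->.
have pR (r : R) (d : R[i]) : p (r%:C * d) = r * p d.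
  by case: pP => ->; rewrite ?cReM ?cImM /= ?mul0r ?subr0 ?addr0.
have cp y : 0 < y -> {for y, continuous (fun y => p (eweight 1 y * (c * jpow z y)))}.
  move=> y0; have c1 := continuous_cpow_part (c := c) (w := z - 1) pP y0.
  have c2 : {for y, continuous (fun t : R => expR (- (1 * t)))}.
    apply: (continuous_comp (f := fun t : R => - (1 * t))); last exact: continuous_expR.
    apply: (@continuousN _ R^o R^o); apply: continuousM; first exact: cst_continuous.
    exact: cvg_id.
  have c3 := continuousM c2 c1.
  rewrite /prop_for /continuous_at /eweight pR /jpow y0; apply: cvg_trans c3.
  apply: near_eq_cvg; near=> t; have t0 : 0 < t by near: t; exact: lt_nbhsr.
  by rewrite t0 pR.
have pn y : y <= 0 -> p (eweight 1 y * (c * jpow z y)) = 0.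
  by move=> y0; rewrite pR causal_jpow // mulr0; case: pP => ->; rewrite /= mulr0.
have key (g : R -> R) : measurable_fun setT g -> (forall y, 0 < y -> {for y, continuous g}) ->
    (forall y, y <= 0 -> g y = 0) ->
    (\int[mu]_y (Num.max (g y) 0)%:E = \int[mu]_x (w x * Num.max (g (phi x)) 0)%:E)%E.
  move=> mg cg g0.
  rewrite (@ge0_integral_power R k^-1 k kV k0 (fun y => Num.max (g y) 0)) //.
  - apply: eq_integral => t _; congr EFin; rewrite /w; case: ifP => _; last by rewrite mul0r.
    by rewrite mulrC.
  - by apply: measurable_maxr => //; exact: measurable_cst.
  - by move=> y; rewrite le_max lexx orbT.
  - move=> y y0; apply: continuous_max; [exact: cg|exact: cst_continuous].
  - by move=> y y0; rewrite g0 // maxxx.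
split; first exact: key.
apply: (key (fun y => - p (eweight 1 y * (c * jpow z y)))).
- exact: measurable_funN.
- by move=> y y0; apply: (@continuousN _ R^o R^o); exact: cp.
- by move=> y y0; rewrite pn // oppr0.
Unshelve. all: by end_near. Qed.

Lemma kGammaE (k : R) (z : R[i]) : 0 < k -> 0 < Re z ->
  kGamma k z = cpow k%:C (z / k%:C - 1) * cGamma (z / k%:C).
Proof.
move=> k0 z0; set a := z / k%:C - 1.
have kC : k%:C != 0 :> R[i] by apply/eqP => -[]; apply/eqP; rewrite gt_eqF.
have kR : Re (z / k%:C) = Re z / k.
  by rewrite -fmorphV /= cReM /= mulr0 subr0.
rewrite (cGamma_subst _ k0) ?kR ?divr_gt0 //.
rewrite /kGamma (cintegral_cint (N := [set 0])
  (g := fun t => if 0 < t then (expR (- (t `^ k / k)))%:C * cpow t%:C (z - 1) else 0)) //.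
- congr cint; apply/funext => t; case: ifP => // t0.
  have tk : 0 < t `^ k by rewrite powR_gt0.
  rewrite cpow_mul ?invr_gt0 // cpowV // cpowN // -/a cpow_powR_base //.
  have -> : z - 1 = (k - 1)%:C + k%:C * a.
    by rewrite /a rmorphB /= mulrBr mulr1 mulrC divfK //; ring.
  rewrite cpowD // cpow_powR // [k^-1 * _]mulrA mulVf ?gt_eqF // mul1r (rmorphM (real_complex R)) /=.
  have := cpow_neq0 a k0; move: (cpow k%:C a) (cpow t%:C _) => u v u0.
  by rewrite (mulrCA u) mulfV // mulr1 [in RHS](mulrC (t `^ _)%:C) -mulrA.
- exact: lebesgue_measure_set1.
move=> t t0; rewrite mem_setE in_itv /= andbT; case: (ltgtP 0 t) => // E.
by case: t0; rewrite /= -E.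
Qed.

End kgamma.

Section prabhakar_kernel.
Context {R : realType}.
Variables (k : R) (alpha nu omega g : R[i]).
Hypotheses (k0 : 0 < k) (alpha0 : 0 < Re alpha) (nu0 : 0 < Re nu).

Let A := alpha / k%:C.
Let B := nu / k%:C.

Let kC : k%:C != 0 :> R[i].
Proof. by apply/eqP => -[]; apply/eqP; rewrite gt_eqF. Qed.

Lemma Re_div_real (z : R[i]) : Re (z / k%:C) = Re z / k.
Proof. by rewrite -fmorphV /= cReM /= mulr0 subr0. Qed.

Let A0 : 0 < Re A. Proof. by rewrite Re_div_real divr_gt0. Qed.
Let B0 : 0 < Re B. Proof. by rewrite Re_div_real divr_gt0. Qed.

(** The numbers beta_n whose symbol is the Laplace transform of the k-Prabhakar
    kernel. *)
Definition prabhakar_coef n : R[i] :=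
  bcoef (g / k%:C) n * (omega * k%:C) ^+ n * cpow k%:C (- expo A B n).

Lemma kPochhammer_bcoef n : kPochhammer k g n / n`!%:R = k%:C ^+ n * bcoef (g / k%:C) n.
Proof.
rewrite /bcoef mulrA; congr (_ / _).
rewrite /kPochhammer -[in k%:C ^+ n](card_ord n) -prodr_const -big_split.
by apply: eq_bigr => i _ /=; rewrite mulrDr [k%:C * (g / _)]mulrC divfK // mulrC.
Qed.

Lemma kMittagLeffler_kernel (s x : R) : 0 < s -> kernel_summable A B prabhakar_coef s ->
  0 < x ->
  cpow x%:C (nu / k%:C - 1) / k%:C *
    kMittagLeffler k alpha nu g (omega * cpow x%:C (alpha / k%:C)) =
  kernel A B prabhakar_coef x.
Proof.
move=> s0 ks x0; rewrite -/A -/B.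
set c := cpow x%:C (B - 1) / k%:C.
have c0 : c != 0 by rewrite mulf_neq0 ?invr_eq0 // cpow_neq0.
pose u n := kPochhammer k g n / kGamma k (alpha * n%:R + nu)
      * ((omega * cpow x%:C A) ^+ n / (n`!)%:R).
have E n : c * u n = kcoef A B prabhakar_coef n * jpow (expo A B n) x.
  have zE : (alpha * n%:R + nu) / k%:C = expo A B n by rewrite /expo mulrDl mulrAC.
  have z0 : 0 < Re (alpha * n%:R + nu).
    have := Re_expo_gt0 A0 B0 n; rewrite -zE Re_div_real.
    by rewrite pmulr_lgt0 // invr_gt0.
  have G0 : cGamma (expo A B n) != 0 by apply: cGamma_neq0; exact: Re_expo_gt0.
  rewrite /u kGammaE // zE [cpow k%:C (_ - 1)]cpowB // cpow1 // /kcoef /prabhakar_coef /jpow x0 /c.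
  have -> : kPochhammer k g n = k%:C ^+ n * bcoef (g / k%:C) n * n`!%:R.
    by rewrite -kPochhammer_bcoef divfK // pnatr_eq0 -lt0n fact_gt0.
  have -> : expo A B n - 1 = A * n%:R + (B - 1) by rewrite /expo addrA.
  rewrite [cpow x%:C (A * _ + _)]cpowD // cpowMn // cpowN //.
  have nz : n`!%:R != 0 :> R[i] by rewrite pnatr_eq0 -lt0n fact_gt0.
  have pz := cpow_neq0 (expo A B n) k0.
  rewrite !exprMn.
  move: (cGamma _) (cpow k%:C _) G0 pz nz kC => G P G0 P0 nz kz.
  move: (n`!%:R) nz (bcoef _ _) (cpow x%:C (B - 1)) (cpow x%:C A ^+ n) (omega ^+ n) => F F0 b y w o.
  move: (k%:C) kz => K kz; move: (K ^+ n) => Kn.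
  by field; rewrite G0 P0 F0 kz.
have kp := kernel_pointwise A0 B0 s0 ks x.
have su : csummable u.
  have := cL1Z c^-1 kp; have -> // : (fun n => c^-1 * (kcoef A B prabhakar_coef n * jpow (expo A B n) x)) = u.
  by apply/funext => n; rewrite -E mulrA mulVf // mul1r.
rewrite /kMittagLeffler limn_series_csum // -csumZ //.
by congr cint; apply/funext => n; rewrite -E.
Qed.

Lemma prabhakar_term (s : R) n : 0 < s ->
  prabhakar_coef n * cpow s%:C (- expo A B n) =
  cpow ((k * s)^-1)%:C B *
    (bcoef (g / k%:C) n * (omega * k%:C * cpow ((k * s)^-1)%:C A) ^+ n).
Proof.
move=> s0; have ks0 : 0 < k * s by rewrite mulr_gt0.
have v0 : 0 < (k * s)^-1 by rewrite invr_gt0.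
rewrite /prabhakar_coef -[LHS]mulrA -cpow_mul // -cpowV // cpowD // cpowMn //.
rewrite [RHS](_ : _ = cpow ((k * s)^-1)%:C B * (bcoef (g / k%:C) n * ((omega * k%:C) ^+ n * cpow ((k * s)^-1)%:C A ^+ n))); last by rewrite -exprMn.
by rewrite mulrA [LHS]mulrC; congr (_ * _); exact: esym (mulrA _ _ _).
Qed.

Section at_point.
Variable s : R.
Hypothesis s0 : 0 < s.

Let w := omega * k%:C * cpow ((k * s)^-1)%:C A.

Hypothesis w1 : normc w < 1.

Lemma prabhakar_symbol : symbol A B prabhakar_coef s =
  cpow ((k * s)^-1)%:C B * cpow (1 - w) (- (g / k%:C)).
Proof.
have [sb E] := binomial_series (g / k%:C) w1.
rewrite -E -csumZ //; congr cint; apply/funext => n; exact: prabhakar_term.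
Qed.

(** Since |w| < 1 there is room for rho = 2 / (1 + |w|) > 1 with |w| rho < 1. *)
Lemma prabhakar_slack : exists2 rho : R, 1 < rho & csummable (fun n =>
  prabhakar_coef n * cpow s%:C (- expo A B n) * (rho ^+ n)%:C).
Proof.
have nw := normc_ge0 w; have nw1 := w1.
exists (2 / (1 + normc w)).
  by rewrite ltr_pdivlMr ?mul1r; move: nw nw1; move: (normc w) => y; lra.
set rho := 2 / _.
have r0 : 0 <= rho by rewrite divr_ge0 //; lra.
have x1 : 0 <= normc w * rho < 1.
  rewrite mulr_ge0 //= /rho mulrA.
  by rewrite ltr_pdivrMr; move: nw nw1; move: (normc w) => y; lra.
have H := csummable_rbcoef (normc_ge0 (g / k%:C)) x1.
apply: (cL1_le (cmeas_nat _) (cL1Z (cpow ((k * s)^-1)%:C B) H)) => n.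
rewrite prabhakar_term // -/w -[X in normc X]mulrA !(cnormM (cpow _ _)).
apply: ler_wpM2l; first exact: normc_ge0.
rewrite -mulrA (cnormM (bcoef _ _)) normcR ger0_norm; last first.
  by rewrite mulr_ge0 ?rbcoef_ge0 ?normc_ge0 // exprn_ge0 // mulr_ge0.
apply: ler_pM; rewrite ?normc_ge0 ?normc_bcoef //.
rewrite (cnormM (w ^+ n)) normcX normcR.
by rewrite ger0_norm ?exprn_ge0 // -exprMn.
Qed.

End at_point.

End prabhakar_kernel.

(** * Repeated primitives and the Taylor formula *)

Section iterated_primitives.
Context {R : realType}.
Local Notation mu := (@lebesgue_measure R).
Implicit Types (f g h K : R -> R[i]).

Lemma cint0 : cint mu (fun=> 0) = 0 :> R[i].
Proof. by apply: complex_eq; rewrite /cint /= /Rintegral integral0. Qed.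

Lemma causal_prim g : causal g -> causal (prim g).
Proof.
move=> cg x x0; rewrite /prim (_ : (fun t => _) = (fun=> 0)).
  exact: cint0.
by apply/funext => t; case: ifP => // tx; rewrite cg // (le_trans tx).
Qed.

Lemma causal_conv K g : causal K -> causal g -> causal (conv K g).
Proof.
move=> cK cg x x0; rewrite /conv (_ : (fun t => _) = (fun=> 0)).
  exact: cint0.
apply/funext => t; have [t0|t0] := leP t 0; first by rewrite cg // mulr0.
by rewrite cK ?mul0r //; lra.
Qed.

Lemma lapL1_trunc g x s : 0 <= s -> causal g -> locL1 g -> lapL1 (trunc g x) s.
Proof.
move=> s0 cg /(_ x) lg; apply: (cL1_le _ lg).
  by apply: cmeasM; [exact: cmeas_eweight|exact: lg.1].
move=> t; rewrite cnormM /trunc; case: ifP => _; last by rewrite normc_0 mulr0.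
have [t0|t0] := leP t 0; first by rewrite cg // normc_0 mulr0.
rewrite ler_piMl ?normc_ge0 // normc_eweight -expR0 ler_expR oppr_le0.
by rewrite mulr_ge0 // ltW.
Qed.

Lemma cmeas_prim g : cmeas g -> cmeas (prim g).
Proof.
move=> mg; apply: (@cmeas_cint _ _ (measurableTypeR R) (measurableTypeR R) R mu
  (fun p => if p.2 <= p.1 then g p.2 else 0)).
apply: cmeas_if; last exact: cmeas_cst.
- by apply: measurable_fun_ler; [exact: measurable_snd|exact: measurable_fst].
- by apply: (cmeas_comp measurable_snd).
Qed.

(** The primitive up to [x] only sees the truncation at [x], which has a Laplace
    transform. *)
Lemma locL1_prim g : causal g -> locL1 g -> locL1 (prim g).
Proof.
move=> cg lg x.
have [h1 _] := laplace_prim ltr01 (lapL1_trunc x ler01 cg lg).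
have := lapL1_locL1 ler01 h1 x; congr (cL1 _ _); apply/funext => t.
rewrite /trunc; case: ifP => // tx; congr cint; apply/funext => r.
by case: ifP => // rt; rewrite (le_trans rt tx).
Qed.

Lemma laplace_iter_prim g s m : 0 < s -> lapL1 g s ->
  lapL1 (iter m prim g) s /\ laplace (iter m prim g) s = (s^-1)%:C ^+ m * laplace g s.
Proof.
move=> s0 lg; elim: m => [|m [IH1 IH2]]; first by rewrite expr0 mul1r.
have [h1 h2] := laplace_prim s0 IH1; split => //=.
by rewrite h2 IH2 exprS mulrA.
Qed.

Lemma causal_iter_prim g m : causal g -> causal (iter m prim g).
Proof. by move=> cg; elim: m => //= m IH; exact: causal_prim. Qed.

Lemma locL1_iter_prim g m : causal g -> locL1 g -> locL1 (iter m prim g).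
Proof.
move=> cg lg; elim: m => //= m IH; apply: locL1_prim => //; exact: causal_iter_prim.
Qed.

Lemma conv_iter_prim K g m : cmeas K -> causal K -> locL1 K ->
  causal g -> locL1 g -> cmeas g -> conv K (iter m prim g) = iter m prim (conv K g).
Proof.
move=> mK cK lK cg lg mg; elim: m => //= m <-; apply/funext => x.
rewrite prim_conv //; [|exact: causal_iter_prim|exact: locL1_iter_prim].
by elim: m => //= m IH; exact: cmeas_prim.
Qed.

(** Taylor polynomials by repeated integration: [d] lists the derivatives at 0
    from the highest order down. *)
Fixpoint jet (d : nat -> R[i]) (i : nat) : R -> R[i] :=
  if i is i'.+1 then fun x => d i' * heaviside x + prim (jet d i') x else fun=> 0.

Lemma jet_neg d i x : x < 0 -> jet d i x = 0.
Proof.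
elim: i x => //= i IH x x0.
rewrite /heaviside leNgt x0 mulr0 add0r /prim (_ : (fun t => _) = (fun=> 0)).
  exact: cint0.
by apply/funext => t; case: ifP => // tx; rewrite IH // (le_lt_trans tx).
Qed.

Lemma laplace_jet d i s : 0 < s ->
  lapL1 (jet d i) s /\
  laplace (jet d i) s = \sum_(n < i) d (i - n.+1)%N * (s^-1)%:C ^+ n.+1.
Proof.
move=> s0; elim: i => [|i [IH1 IH2]].
  rewrite big_ord0 /lapL1 /laplace /=.
  have -> : (fun t : R => eweight s t * 0) = (fun=> 0) by apply/funext => t; rewrite mulr0.
  split.
    by split; [exact: cmeas_cst|rewrite /cmass; under eq_integral do rewrite normc_0; rewrite integral0].
  exact: cint0.
have [h1 h2] := laplace_prim s0 IH1; have [h3 h4] := laplace_heaviside s0.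
have E : (fun t => eweight s t * jet d i.+1 t) =
   (fun t => d i * (eweight s t * heaviside t) + eweight s t * prim (jet d i) t).
  by apply/funext => t /=; rewrite mulrDr mulrCA.
rewrite /lapL1 /laplace E; split; first by apply: cL1D => //; exact: cL1Z.
rewrite cintD //; last exact: cL1Z.
rewrite cintZ // -/(laplace heaviside s) -/(laplace (prim (jet d i)) s) h4 h2 IH2.
rewrite big_ord_recl /= subSS subn0 expr1; congr (_ + _).
rewrite mulr_sumr; apply: eq_bigr => n _; rewrite /bump /= add1n subSS.
by rewrite [in RHS]exprS mulrCA.
Qed.

End iterated_primitives.

Section sumudu_laplace.
Context {R : realType}.
Local Notation mu := (@lebesgue_measure R).

Lemma sumudu_laplace (h h' : R -> R[i]) (u : R) : 0 < u ->
  (forall t, 0 < t -> h t = h' t) -> causal h' -> sumudu_exists h u ->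
  lapL1 h' u^-1 /\ sumudu h u = (u^-1)%:C * laplace h' u^-1.
Proof.
move=> u0 hh ch' /cintegrable_cL1 ex.
have {}ex := ex (measurable_itv _).
have uV : u^-1 != 0 by rewrite invr_neq0 // gt_eqF.
have E t : 0 < t -> sumudu_integrand h u t = (u^-1)%:C * (eweight u^-1 t * h' t).
  by move=> t0; rewrite /sumudu_integrand /eweight hh // rmorphM /= -mulrA mulrC (mulrC t) mulrC.
have H : cL1 mu (fun t => (u^-1)%:C * (eweight u^-1 t * h' t)).
  have EE : (fun t => (u^-1)%:C * (eweight u^-1 t * h' t)) =
     (fun t => if 0 < t then (if t \in `[0, +oo[%classic then sumudu_integrand h u t else 0) else 0).
    apply/funext => t; case: ifP => t0; last by rewrite ch' ?mulr0 // leNgt t0.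
    by rewrite mem_set ?E //= in_itv /= ltW.
  rewrite EE; apply: (cL1_le _ ex).
    by apply: cmeas_if; [exact: measurable_fun_ltr|exact: ex.1|exact: cmeas_cst].
  by move=> t; case: (0 < t) => //; rewrite normc_0 normc_ge0.
have L : lapL1 h' u^-1.
  have := cL1Z ((u^-1)%:C)^-1 H; congr (cL1 _ _); apply/funext => t.
  rewrite mulrA mulVf ?mul1r //; apply/eqP => -[]; exact/eqP.
split => //; rewrite /laplace -cintZ // /sumudu.
apply: (cintegral_cint (N := [set 0])) => //; first exact: lebesgue_measure_set1.
move=> t /= t0; rewrite mem_setE in_itv /= andbT; case: (ltgtP 0 t) => [tp|tn|te].
- exact: E.
- by rewrite ch' ?mulr0 // ltW.
- by case: t0.
Qed.

End sumudu_laplace.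

Section taylor.
Context {R : realType}.
Local Notation mu := (@lebesgue_measure R).

Lemma prim_real (phi : R -> R) (h : R -> R[i]) (x : R) :
  (forall t, 0 < t -> h t = (phi t)%:C) -> (forall t, t < 0 -> h t = 0) ->
  prim h x = (\int[mu]_(t in `]0, x]) phi t)%:C.
Proof.
move=> hp hn; transitivity (cintegral `]0, x] (fun t => (phi t)%:C)); last first.
  by rewrite /cintegral /= /Rintegral integral0.
apply/esym/(cintegral_cint (N := [set 0])) => //; first exact: lebesgue_measure_set1.
move=> t /= t0; rewrite mem_setE in_itv /=; case: (ltgtP 0 t) => [tp|tn|te] /=.
- by rewrite hp.
- by rewrite hn ?if_same.
- by case: t0.
Qed.

Lemma primD (g h : R -> R[i]) (x : R) : locL1 g -> locL1 h ->
  prim (fun t => g t + h t) x = prim g x + prim h x.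
Proof.
move=> lg lh; rewrite /prim -(cintD (lg x) (lh x)); congr cint; apply/funext => t.
by rewrite /trunc; case: ifP => // _; rewrite addr0.
Qed.

Lemma locL1_real (g : R -> R) : measurable_fun setT g -> (forall t, t <= 0 -> g t = 0) ->
  (forall x : R, mu.-integrable `]0, x] (EFin \o g)) -> locL1 (fun t => (g t)%:C).
Proof.
move=> mg g0 ig x.
have : cintegrable `]0, x] (fun t => (g t)%:C).
  by split; [exact: ig|exact: integrable0].
move=> /cintegrable_cL1 H; have {}H := H (measurable_itv _).
move: H; congr (cL1 _ _); apply/funext => t; rewrite /trunc mem_setE in_itv /=.
by case: (ltP 0 t) => // t0; rewrite g0 // if_same.
Qed.

(** Taylor's formula with integral remainder. The function [g] is a measurable
    representative of the derivative of order [n], and the remainder is its [n]-fold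
    primitive. *)
Lemma ACn_taylor (n : nat) (f : R -> R) : (0 < n)%N ->
  (forall b : R, 0 < b -> ACn n 0 b f) ->
  exists (g : R -> R[i]) (N : set R), [/\ cmeas g /\ causal g, locL1 g,
    measurable N /\ mu N = 0%E,
    forall x, 0 < x -> ~ N x -> (deriven_within `[0, +oo[ n f x)%:C = g x &
    forall x, 0 < x -> (f x)%:C = iter n prim g x +
      jet (fun i => (deriven_within `[0, +oo[ (n - i.+1) f 0)%:C) n x].
Proof.
move=> n0 acf; set d := fun i : nat => _.
have [g [mg g0 [N [mN N0 NE]] ig gE]] := half_line_density (ACn_abs_continuous acf).
pose gc (t : R) := (g t)%:C.
have lg : locL1 gc by exact: locL1_real.
have cg : causal gc by move=> t t0; rewrite /gc g0.
have mgc : cmeas gc by exact: cmeas_real.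
exists gc, N; split => //.
- move=> x x0 xN; rewrite /gc -[in LHS](prednK n0); congr (_%:C).
  by apply: contrapT => H; apply: xN; apply: NE => /= /(_ x0).
have key i : (i < n)%N -> forall x, 0 < x ->
    (deriven_within `[0, +oo[ (n - i.+1) f x)%:C = iter i.+1 prim gc x + jet d i.+1 x.
  elim: i => [|i IH] iN x x0.
    have -> : iter 1 prim gc x = (\int[mu]_(t in `]0, x]) g t)%:C.
      by apply: prim_real => // t /ltW /cg.
    rewrite -gE // subn1 /= /heaviside (ltW x0) mulr1 /d subn1.
    have -> : prim (fun=> 0) x = 0 :> R[i].
      by rewrite /prim -[RHS]cint0; congr cint; apply/funext => t; rewrite if_same.
    by rewrite addr0 -rmorphD /= subrK.
  have E : (n - i.+1)%N = (n - i.+2).+1 by rewrite subnSK.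
  have jn : ((n - i.+2).+1 < n)%N by rewrite -E ltn_subrL n0.
  have F := ACn_FTC acf jn x0.
  have lQ := locL1_iter_prim i.+1 cg lg.
  have lJ := lapL1_locL1 ler01 (laplace_jet d i.+1 ltr01).1.
  have P : prim (fun t => iter i.+1 prim gc t + jet d i.+1 t) x =
      (\int[mu]_(t in `]0, x]) deriven_within `[0, +oo[ (n - i.+2).+1 f t)%:C.
    apply: prim_real => t t0; first by rewrite -E (IH (ltnW iN)).
    by rewrite jet_neg // (causal_iter_prim i.+1 cg) ?addr0 // ltW.
  move: P; rewrite primD // -F => P.
  rewrite -[iter i.+2 prim gc x]/(prim (iter i.+1 prim gc) x).
  rewrite -[jet d i.+2 x]/(d i.+1 * heaviside x + prim (jet d i.+1) x).
  rewrite /heaviside (ltW x0) mulr1 addrCA P /d -rmorphD /=.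
  by congr (_%:C); rewrite addrC subrK.
by move=> x x0; have := key n.-1; rewrite prednK // subnn; apply.
Qed.

End taylor.

(** * The Sumudu transform of the regularized derivative *)

Section derivative_as_convolution.
Context {R : realType}.
Local Notation mu := (@lebesgue_measure R).

(** The integrands agree off the exceptional set of the derivative and the two
    end points. *)
Lemma prabhakar_conv (k : R) (alpha nu omega g : R[i]) (s : R) (phi : R -> R)
    (q : R -> R[i]) (N : set R) :
  0 < k -> 0 < Re alpha -> 0 < Re nu -> 0 < s ->
  kernel_summable (alpha / k%:C) (nu / k%:C) (prabhakar_coef k alpha nu omega g) s ->
  causal q -> measurable N -> mu N = 0%E ->
  (forall x, 0 < x -> ~ N x -> (phi x)%:C = q x) -> forall t, 0 < t ->
  kPrabhakar k alpha nu omega g (fun x => (phi x)%:C) t =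
  conv (kernel (alpha / k%:C) (nu / k%:C) (prabhakar_coef k alpha nu omega g)) q t.
Proof.
move=> k0 al0 nu0 s0 ks cq mN N0 pq t t0; rewrite /kPrabhakar /conv.
set K := kernel _ _ _.
have mNt : measurable (N `|` [set 0; t] : set (measurableTypeR R)).
  by apply: measurableU => //; apply: measurableU; exact: measurable_set1.
apply: (cintegral_cint mNt).
  apply/eqP; rewrite -measure_le0; apply: (@le_trans _ _ (mu N + mu [set 0%R; t])%E).
    by apply: measureU2 => //; apply: measurableU; exact: measurable_set1.
  rewrite N0 add0e; apply: (@le_trans _ _ (mu [set 0%R] + mu [set t])%E).
    by apply: measureU2; exact: measurable_set1.
  by rewrite !lebesgue_measure_set1 adde0.
move=> x /= /not_orP[Nx /not_orP[x0 xt]].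
rewrite mem_setE in_itv /=; case: (ltgtP 0 x) => [x1|x1|x1]; last by case: x0.
  case: (ltgtP x t) => [x2|x2|x2]; last by case: xt.
    have tx : 0 < t - x by rewrite subr_gt0.
    by rewrite /= pq // (kMittagLeffler_kernel k0 al0 nu0 s0 ks tx).
  by rewrite /= /K causal_kernel ?mul0r //; lra.
by rewrite /= cq ?mulr0 // ltW.
Qed.

End derivative_as_convolution.

Section regularized_derivative.
Context {R : realType}.

(** The transform of the [m]-fold primitive of [K * q] is computed in two ways: by
    [laplace_iter_prim] from that of the derivative, and by
    [laplace_continuation] from those of [f] and of its Taylor polynomial. *)
Lemma sumudu_regularized (k : R) (alpha mu omega gamma : R[i]) (m : nat)
    (f : R -> R) (D : R -> R[i]) (u : R) :
  0 < k -> 0 < Re alpha -> (0 < m)%N -> Re mu < m%:R * k ->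
  (forall b : R, 0 < b -> ACn m 0 b f) ->
  (forall t, 0 < t -> D t = (k ^+ m)%:C * kPrabhakar k alpha (m%:R * k%:C - mu) omega (- gamma)
        (fun s => (deriven_within `[0, +oo[ m f s)%:C) t) ->
  0 < u -> sumudu_exists (fun t => (f t)%:C) u -> sumudu_exists D u ->
  let v := (u / k)%:C in
  let w := omega * k%:C * cpow v (alpha / k%:C) in
  normc w < 1 ->
  sumudu D u = cpow v (- (mu / k%:C)) * cpow (1 - w) (gamma / k%:C) *
    (sumudu (fun t => (f t)%:C) u -
     \sum_(n < m) (deriven_within `[0, +oo[ n f 0)%:C * (u ^+ n)%:C).
Proof.
move=> k0 al0 m0 mum acf Dk u0 exf exD v w w1n.
have kC : k%:C != 0 :> R[i] by apply/eqP => -[]; apply/eqP; rewrite gt_eqF.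
have uC : u%:C != 0 :> R[i] by apply/eqP => -[]; apply/eqP; rewrite gt_eqF.
pose nu := m%:R * k%:C - mu.
have nu0 : 0 < Re nu.
  rewrite cReD cReN cReM -(rmorph_nat (real_complex R)) /= mul0r subr0 subr_gt0.
  exact: mum.
have s0 : 0 < u^-1 by rewrite invr_gt0.
have vE : (k * u^-1)^-1 = u / k by rewrite invfM invrK mulrC.
pose A := alpha / k%:C; pose B := nu / k%:C.
have A0 : 0 < Re A by rewrite Re_div_real divr_gt0.
have B0 : 0 < Re B by rewrite Re_div_real divr_gt0.
pose beta := prabhakar_coef k alpha nu omega (- gamma).
have wv : normc (omega * k%:C * cpow ((k * u^-1)^-1)%:C A) < 1 by rewrite vE.
have [rho rho1 slack] := prabhakar_slack nu (- gamma) k0 s0 wv.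
have Phi := prabhakar_symbol nu (- gamma) k0 s0 wv.
have [S S0 KS] := kernel_summable_large A0 B0 s0 rho1 slack.
have Sp : 0 < S := lt_le_trans s0 S0.
have ks := KS S (lexx _).
pose K := kernel A B beta.
have lapK : lapL1 K S := lapL1_kernel A0 B0 Sp ks.
have mK := lapL1_cmeas lapK.
have lK := lapL1_locL1 (ltW Sp) lapK.
have cK : causal K by exact: causal_kernel.
have [q [N [[mq cq] lq [mN N0] pq fE]]] := ACn_taylor m0 acf.
set d := fun i : nat => _ in fE.
pose h := conv K q.
have ch : causal h := causal_conv cK cq.
have DE t : 0 < t -> D t = (k ^+ m)%:C * h t.
  move=> t0; rewrite Dk //; congr (_ * _).
  exact: (prabhakar_conv k0 al0 nu0 Sp ks cq mN N0 pq t0).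
have cD : causal (fun t => (k ^+ m)%:C * h t) by move=> t /ch ->; rewrite mulr0.
have [lD ED] := sumudu_laplace u0 DE cD exD.
have kmC : (k ^+ m)%:C != 0 :> R[i].
  by apply/eqP => -[]; apply/eqP; rewrite expf_eq0 gt_eqF // andbF.
have lh : lapL1 h u^-1.
  have := cL1Z ((k ^+ m)%:C)^-1 lD; congr (cL1 _ _); apply/funext => t.
  by rewrite mulrCA mulKf.
have lapD : laplace (fun t => (k ^+ m)%:C * h t) u^-1 = (k ^+ m)%:C * laplace h u^-1.
  by rewrite /laplace -cintZ //; congr cint; apply/funext => t; rewrite mulrCA.
pose f' t : R[i] := if 0 < t then (f t)%:C else 0.
have [lf Ef] : lapL1 f' u^-1 /\ sumudu (fun t => (f t)%:C) u = (u^-1)%:C * laplace f' u^-1.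
  apply: sumudu_laplace => // t t0; first by rewrite /f' t0.
  by rewrite /f' ltNge t0.
have [lJ EJ] := laplace_jet d m s0.
pose Q := iter m prim q.
have QE t : 0 < t -> Q t = f' t - jet d m t.
  by move=> t0; rewrite /f' t0 fE // addrK.
have cQ : causal Q by exact: causal_iter_prim.
have lQ0 : cL1 lebesgue_measure (fun t => eweight u^-1 t * f' t - eweight u^-1 t * jet d m t).
  by apply: cL1D => //; have := cL1Z (-1) lJ; under eq_fun do rewrite mulN1r.
have mQ : cmeas Q by rewrite /Q; elim: (m) => //= i IH; exact: cmeas_prim.
have lQ : lapL1 Q u^-1.
  apply: (cL1_le _ lQ0); first by apply: cmeasM => //; exact: cmeas_eweight.
  move=> t; have [t0|t0] := ltP 0 t; first by rewrite QE // mulrBr.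
  by rewrite cQ // mulr0 normc_0 normc_ge0.
have EQ : laplace Q u^-1 = laplace f' u^-1 - laplace (jet d m) u^-1.
  rewrite /laplace -cintB //; apply: (cint_null (N := [set 0])) => //.
    exact: lebesgue_measure_set1.
  move=> t t0; case: (ltgtP 0 t) => [tp|tn|te].
  - by rewrite QE // mulrBr.
  - by rewrite jet_neg // cQ ?(ltW tn) // /f' ltNge (ltW tn) mulr0 subr0.
  - by case: t0.
have aE : conv K Q = iter m prim h by exact: conv_iter_prim.
have [la Ea] := laplace_iter_prim m s0 lh.
have lKQ : lapL1 (conv K Q) u^-1 by rewrite aE.
have main := laplace_continuation A0 B0 s0 rho1 slack (causal_conv cK cQ) cQ lKQ lQ erefl.
rewrite -/beta in Phi main; rewrite -/A -/B Phi vE -/v -/w EQ aE Ea invrK in main.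
have uk0 : 0 < u / k by rewrite divr_gt0.
have cB : cpow v B = ((u / k) ^+ m)%:C * cpow v (- (mu / k%:C)).
  by rewrite -(cpow_nat m uk0) -cpowD // /B /nu mulrBl mulfK.
pose T := \sum_(n < m) (deriven_within `[0, +oo[ n f 0)%:C * (u ^+ n)%:C.
have JT : laplace (jet d m) u^-1 = u%:C * T.
  rewrite EJ invrK mulr_sumr; apply: eq_bigr => n _.
  have -> : d (m - n.+1)%N = (deriven_within `[0, +oo[ n f 0)%:C.
    by rewrite /d -[(m - (m - n.+1).+1)%N]/(m - (m - n.+1).+1)%N subnSK ?subKn // ltnW.
  by rewrite exprS mulrCA rmorphXn.
rewrite -/T ED lapD Ef; rewrite JT cB mulNr opprK in main.
have km0 : k ^+ m != 0 by rewrite expf_neq0 // gt_eqF.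
have um0 : u%:C ^+ m != 0 by rewrite expf_neq0.
have vmE : ((u / k) ^+ m)%:C = u%:C ^+ m / (k ^+ m)%:C :> R[i].
  by rewrite expr_div_n rmorphM fmorphV rmorphXn.
have uVE : (u^-1)%:C = u%:C^-1 :> R[i] by rewrite fmorphV.
rewrite vmE in main; rewrite uVE.
have -> : laplace h u^-1 = (u%:C ^+ m)^-1 * (u%:C ^+ m * laplace h u^-1) by rewrite mulKf.
rewrite main; move: (k ^+ m)%:C kmC (u%:C ^+ m) um0 => y y0 z z0.
move: (cpow v (- (mu / k%:C))) (cpow (1 - w) (gamma / k%:C)) => P G.
move: (laplace f' _) (T) (u%:C) uC => L T' U U0.
by field; rewrite y0 U0 z0.
Qed.

End regularized_derivative.

Theorem lemma3p7 (R : realType) (k : R) (alpha mu omega gamma : R[i])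
    (f : R -> R) (u : R) :
  0 < k -> 0 < complex.Re alpha -> 0 < complex.Re mu ->
  (forall b : R, 0 < b -> ACn (kPrabhakar_order k mu) 0 b f) ->
  0 < u ->
  sumudu_exists (fun t => (f t)%:C) u ->
  sumudu_exists (reg_kPrabhakar_derivative k alpha mu omega gamma f) u ->
  `|omega * k%:C * cpow (u / k)%:C (alpha / k%:C)| < 1 ->
  let F := sumudu (fun t => (f t)%:C) in
  sumudu (reg_kPrabhakar_derivative k alpha mu omega gamma f) u =
    cpow (u / k)%:C (- (mu / k%:C))
      * cpow (1 - omega * k%:C * cpow (u / k)%:C (alpha / k%:C))
          (gamma / k%:C)
      * F u
    - \sum_(0 <= n < kPrabhakar_order k mu)
        (k ^+ n)%:C
        * cpow (u / k)%:C ((n%:R * k%:C - mu) / k%:C)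
        * cpow (1 - omega * k%:C * cpow (u / k)%:C (alpha / k%:C))
            (gamma / k%:C)
        * (deriven_within `[0, +oo[ n f 0)%:C.
Proof.
move=> k0 al0 mu0 acf u0 exf exD w1.
set m := kPrabhakar_order k mu in acf *.
have mum : Re mu < m%:R * k by rewrite -ltr_pdivrMr //; exact: truncnS_gt.
have w1n : normc (omega * k%:C * cpow (u / k)%:C (alpha / k%:C)) < 1.
  by move: w1; rewrite -ltcR.
have m0 : (0 < m)%N by [].
have uk0 : 0 < u / k by rewrite divr_gt0.
have kC : k%:C != 0 :> R[i] by apply/eqP => -[]; apply/eqP; rewrite gt_eqF.
rewrite (sumudu_regularized (omega := omega) (gamma := gamma) k0 al0 m0 mum acf _ u0 exf exD w1n) //.
rewrite mulrBr; congr (_ - _); rewrite mulr_sumr big_mkord; apply: eq_bigr => n _.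
have -> : (n%:R * k%:C - mu) / k%:C = n%:R - mu / k%:C by rewrite mulrBl mulfK.
have -> : cpow (u / k)%:C (n%:R - mu / k%:C) = ((u / k) ^+ n)%:C * cpow (u / k)%:C (- (mu / k%:C)).
  by rewrite -(cpow_nat n uk0) -cpowD.
have -> : (u ^+ n)%:C = (k ^+ n)%:C * ((u / k) ^+ n)%:C.
  by rewrite -rmorphM /= -exprMn [k * _]mulrC divfK // gt_eqF.
move: (deriven_within _ _ _ _)%:C (cpow _ _) (cpow _ _) (k ^+ n)%:C ((u / k) ^+ n)%:C => c P G x y.
by ring.
Qed.
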